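(* Assume $\operatorname{tr}B\ge0$ and let $0<s<1$ and $1\le p<\infty$. Then for every $f\in\mathscr S$ and every $t,\tau>0$, $$\|P_tf-P_\tau f\|_{L^p}\le\frac{2|t-\tau|^s}{\Gamma(1+s)}\ \sup_{\sigma>0}\|(-\mathscr A)^sP_\sigma f\|_{L^p}.$$
   Context: Let $N\ge 2$. Let $Q,B$ be real constant $N\times N$ matrices with $Q=Q^\star\ge 0$, $\mathscr A u=\operatorname{tr}(Q\nabla^2u)+\langle BX,\nabla u\rangle$, and assume $K(t)=\frac1t\int_0^t e^{rB}Qe^{rB^\star}\,dr$ is positive definite for every $t>0$. Let $m_t(X,Y)^2=\langle K(t)^{-1}(Y-e^{tB}X),\,Y-e^{tB}X\rangle$, $p(X,Y,t)=(4\pi)^{-N/2}(\det(tK(t)))^{-1/2}\exp(-m_t(X,Y)^2/(4t))$, $P_tf(X)=\int p(X,Y,t)f(Y)\,dY$. $\mathscr S$ is the Schwartz class. For $0<s<1$ and $f\in\mathscr S$, $(-\mathscr A)^sf(X)=-\frac{s}{\Gamma(1-s)}\int_0^\infty t^{-1-s}[P_tf(X)-f(X)]\,dt$. *)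

(* Defs.v *)
From HB Require Import structures.
From mathcomp Require Import all_boot all_order all_algebra.
From mathcomp Require Import all_classical all_reals all_analysis.
Set Implicit Arguments. Unset Strict Implicit. Unset Printing Implicit Defensive.
Import Order.TTheory GRing.Theory Num.Theory.
Import numFieldNormedType.Exports.
Local Open Scope classical_set_scope.
Local Open Scope ring_scope.

Section Defs.
Variable R : realType.
Let mu := @lebesgue_measure R.

Definition expmx (N : nat) (M : 'M[R]_N) : 'M[R]_N :=
  lim ((fun n : nat => \sum_(k < n) (k`!%:R)^-1 *: M ^+ k) @ \oo).

Definition Gamma (x : R) : R :=
  Rintegral mu `]0, +oo[ (fun t => t `^ (x - 1) * expR (- t)).

Fixpoint iRint (n : nat) (F : (nat -> R) -> R) : R :=
  match n with
  | 0 => F (fun _ => 0)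
  | n'.+1 => Rintegral mu setT
       (fun x => iRint n' (fun v => F (fun i => if i == n' then x else v i)))
  end.

Fixpoint iEint (n : nat) (F : (nat -> R) -> \bar R) : \bar R :=
  match n with
  | 0 => F (fun _ => 0)
  | n'.+1 => (\int[mu]_(x in setT)
       iEint n' (fun v => F (fun i => if i == n' then x else v i)))%E
  end.

Definition intRN (N : nat) (g : 'cV[R]_N -> R) : R :=
  iRint N (fun v => g (\col_(i < N) v i)).

Definition LpnormRN (N : nat) (p : R) (g : 'cV[R]_N -> R) : \bar R :=
  poweR (iEint N (fun v => ((`|g (\col_(i < N) v i)|) `^ p)%:E)) p^-1.

Definition iterD (N : nat) (ds : seq 'cV[R]_N) (f : 'cV[R]_N -> R) :
  'cV[R]_N -> R := foldr (fun v g => 'D_v g) f ds.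

Definition ecoord (N : nat) (j : 'I_N) : 'cV[R]_N := delta_mx j 0.

Definition Schwartz (N : nat) (f : 'cV[R]_N -> R) : Prop :=
  (forall (beta : seq 'I_N) (x : 'cV[R]_N),
      differentiable (iterD [seq ecoord j | j <- beta] f) x) /\
  (forall (alpha : 'I_N -> nat) (beta : seq 'I_N), exists M : R,
      forall x : 'cV[R]_N,
        `| (\prod_(i < N) (x i 0) ^+ alpha i) *
           iterD [seq ecoord j | j <- beta] f x | <= M).

Definition Kmx (N : nat) (Q B : 'M[R]_N) (t : R) : 'M[R]_N :=
  \matrix_(i, j) (t^-1 * Rintegral mu `[0, t]
      (fun r => (expmx (r *: B) *m Q *m (expmx (r *: B))^T) i j)).

Definition mt2 (N : nat) (Q B : 'M[R]_N) (X Y : 'cV[R]_N) (t : R) : R :=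
  let d := Y - expmx (t *: B) *m X in
  ((invmx (Kmx Q B t) *m d)^T *m d) 0 0.

Definition pker (N : nat) (Q B : 'M[R]_N) (X Y : 'cV[R]_N) (t : R) : R :=
  (4 * pi) `^ (- (N%:R / 2)) * (\det (t *: Kmx Q B t)) `^ (- (1 / 2)) *
  expR (- (mt2 Q B X Y t / (4 * t))).

Definition Pt (N : nat) (Q B : 'M[R]_N) (t : R) (f : 'cV[R]_N -> R)
  (X : 'cV[R]_N) : R :=
  intRN (fun Y => pker Q B X Y t * f Y).

Definition fracA (N : nat) (Q B : 'M[R]_N) (s : R) (f : 'cV[R]_N -> R)
  (X : 'cV[R]_N) : R :=
  - (s / Gamma (1 - s)) *
  Rintegral mu `]0, +oo[ (fun t => t `^ (- 1 - s) * (Pt Q B t f X - f X)).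

End Defs.

(* Main.v *)
Require Import Defs.
From HB Require Import structures.
From mathcomp Require Import all_boot all_order all_algebra.
From mathcomp Require Import all_classical all_reals all_analysis.
From mathcomp Require Import measurable_realfun.
From mathcomp Require Import ring lra.
Set Implicit Arguments. Unset Strict Implicit. Unset Printing Implicit Defensive.
Import Order.TTheory GRing.Theory Num.Theory.
Import numFieldNormedType.Exports.
Local Open Scope classical_set_scope.
Local Open Scope ring_scope.

(* Put u(t) = P_t f. By the Chapman-Kolmogorov identity the integral defining
   (-A)^s P_sigma f is, up to a constant, the Marchaud derivative of u at sigma.
   With k(x) = (x - d)_+^(s-1) - x_+^(s-1), Marchaud inversion reads
     Gamma(s) (u(tau + d) - u(tau)) = \int_0^oo k(x) (-A)^s P_(tau + x) f dx,
   and \int |k| = 2 d^s / s, so Jensen and Tonelli give the bound with constant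
   2 d^s / (s Gamma(s)). To invert, truncate the Marchaud derivative of w to r > e;
   Fubini and scaling turn its integral against k into
   \int Psi(z) (w(e z + d) - w(e z)) dz with Psi integrable and independent of e, which
   tends to (\int Psi) (w(d) - w(0)); the test function exp(- max(x, 0)) yields \int Psi.
   This needs u bounded and Lipschitz in time, uniformly in space, which holds as
   P_h f - f = O(h): second differences of f absorb the Gaussian part, whose
   covariance is O(h), and rapid decay absorbs the drift. *)

(** * Lebesgue measure on tuples *)

(** The iterated integrals of the statement are recognised as integrals against a sigma-finite
    measure [lebn] on tuples, where Fubini and pushforwards apply. Only triangular affine
    substitutions are needed: a Cholesky factor carries every Gaussian to the standard one by such a
    map. P_t f(X) is the average of f under the Gaussian centred at e^(tB) X with covariance matrix
    2 t K(t), so the semigroup law is a composition rule for Gaussians together with the rule by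
    which t K(t) adds up in time. The truncation at e is forced: w(x + r) and w(x) must be separated
    before Fubini can move the shift onto k, and against r^(-1-s) neither converges alone near r =
    0. Psi does not depend on e because convolving r^(-1-s), cut at e, with x_+^(s-1) gives a family
    homogeneous of degree -1, which rescales like an approximate identity. For the exponential test
    function both sides of the inversion formula are Gamma integrals, so \int Psi is found without a
    Beta function. Tonelli in (time, space) requires joint measurability of the orbit; it comes from
    the Lipschitz bounds, by discretisation. *)

Definition pushforward_measure d d' (T : measurableType d)
    (T' : measurableType d') (R : realFieldType) (m : {measure set T -> \bar R})
    (f : T -> T') (mf : measurable_fun [set: T] f) :
    {measure set T' -> \bar R} :=
  measure_function_pushforward__canonical__measure_function_Measure m mf.

Section pushforward_setT.
Context d d' (T : measurableType d) (T' : measurableType d') (R : realType).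
Variables (m : {measure set T -> \bar R}) (f : T -> T').
Hypothesis mf : measurable_fun [set: T] f.
Local Open Scope ereal_scope.

Lemma ge0_integral_pushforwardT (F : T' -> \bar R) :
  measurable_fun setT F -> (forall y, 0 <= F y) ->
  \int[pushforward_measure m mf]_y F y = \int[m]_x F (f x).
Proof.
move=> mF F0; have := ge0_integral_pushforward mf m measurableT mF (fun y _ => F0 y).
by rewrite preimage_setT.
Qed.

Lemma integrable_pushforward_comp (F : T' -> \bar R) :
  (pushforward_measure m mf).-integrable setT F ->
  m.-integrable setT (fun x => F (f x)).
Proof.
move=> /integrableP[mF Foo]; apply/integrableP; split.
  exact: measurableT_comp mF mf.
suff <- : \int[pushforward_measure m mf]_y `|F y| = \int[m]_x `|F (f x)| by [].
apply: (@ge0_integral_pushforwardT (abse \o F)) => [|y]; last exact: abse_ge0.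
exact: measurableT_comp.
Qed.

Lemma integral_pushforwardT (F : T' -> \bar R) :
  (pushforward_measure m mf).-integrable setT F ->
  \int[pushforward_measure m mf]_y F y = \int[m]_x F (f x).
Proof.
move=> iF; have := @integral_pushforward _ _ _ _ _ _ mf m setT F (measurable_int _ iF).
by rewrite preimage_setT; apply => //; exact: integrable_pushforward_comp.
Qed.

End pushforward_setT.

(** * Affine substitution on the line *)

Section affine_substitution.
Variable R : realType.
Local Notation leb := (@lebesgue_measure R).
Implicit Types (a b : R) (f : R -> \bar R).
Local Open Scope ereal_scope.

Lemma measurable_affine a b :
  measurable_fun [set: R] (fun x => (a * x + b)%R : measurableTypeR R).
Proof. by apply: measurable_funD => //; apply: measurable_funM. Qed.

(** Lebesgue measure is determined by its values on half-open intervals, and [a] times the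
    pushforward under x |-> a x + b takes the same values there. *)
Lemma ge0_integral_scale_shift a b f : (0 < a)%R ->
  measurable_fun [set: R] f -> (forall x, 0 <= f x) ->
  \int[leb]_x f x = a%:E * \int[leb]_x f (a * x + b)%R.
Proof.
move=> a0 mf f0.
pose phi := (fun x => (a * x + b)%R) : R -> measurableTypeR R.
have mphi : measurable_fun [set: R] phi by exact: measurable_affine.
pose nu : {measure set (measurableTypeR R) -> \bar R} :=
  mscale (NngNum (ltW a0)) (pushforward_measure leb mphi).
have E A : measurable A -> leb A = nu A.
  apply: lebesgue_measure_unique => _ [[c d]] _ <-.
  rewrite /nu /= /mscale /= /pushforward.
  have -> : phi @^-1` [set` `]c, d]] =
      [set` `](c - b) / a, (d - b) / a]]%R.
    apply/seteqP; split=> x /=; rewrite !in_itv/= /phi.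
      by rewrite ltr_pdivrMr// ler_pdivlMr// => /andP[? ?]; apply/andP; split; lra.
    by rewrite ltr_pdivrMr// ler_pdivlMr// => /andP[? ?]; apply/andP; split; lra.
  rewrite !lebesgue_measure_itv/= !lte_fin.
  have -> : ((c - b) / a < (d - b) / a)%R = (c < d)%R.
    by rewrite ltr_pM2r ?invr_gt0// ltrD2r.
  case: ifPn => _; last by rewrite mule0.
  rewrite -!EFinD -EFinM; congr (_%:E).
  by field; rewrite gt_eqF.
transitivity (\int[nu]_x f x).
  by apply: eq_measure_integral => A mA _; exact: E.
rewrite /nu ge0_integral_mscale//=.
by rewrite ge0_integral_pushforward.
Qed.

Lemma ge0_integral_opp f : measurable_fun [set: R] f -> (forall x, 0 <= f x) ->
  \int[leb]_x f x = \int[leb]_x f (- x)%R.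
Proof.
move=> mf f0.
have mphi : measurable_fun [set: R] (-%R : R -> measurableTypeR R) by [].
transitivity (\int[pushforward_measure leb mphi]_x f x).
  by apply: eq_measure_integral => A mA _; exact/esym/lebesgue_measureN.
by rewrite ge0_integral_pushforward.
Qed.

Lemma ge0_integral_affine a b f : a != 0%R ->
  measurable_fun [set: R] f -> (forall x, 0 <= f x) ->
  \int[leb]_x f x = `|a|%:E * \int[leb]_x f (a * x + b)%R.
Proof.
move=> a0 mf f0; have [ap|an|/eqP] := ltgtP 0%R a; last by rewrite eq_sym (negbTE a0).
  by rewrite gtr0_norm//; exact: ge0_integral_scale_shift.
rewrite ltr0_norm// (@ge0_integral_scale_shift (- a) b)// ?oppr_gt0//; congr (_ * _).
rewrite ge0_integral_opp//; last first.
  by apply: (measurableT_comp mf); exact: measurable_affine.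
by apply: eq_integral => x _; rewrite mulrNN.
Qed.

End affine_substitution.

(** * Construction of the product measure *)

Section tuple_measure.
Variable R : realType.
Local Notation leb := (@lebesgue_measure R).
Local Open Scope ereal_scope.

Definition tcons n (p : R * n.-tuple R) : n.+1.-tuple R :=
  [the n.+1.-tuple R of p.1 :: p.2].

Lemma measurable_tcons n : measurable_fun setT (@tcons n).
Proof. by apply: measurable_cons. Qed.

Definition tuncons n (t : n.+1.-tuple R) : R * n.-tuple R :=
  (tnth t ord0, [tuple of behead t]).

Lemma measurable_tuncons n : measurable_fun setT (@tuncons n).
Proof.
apply/measurable_fun_pair; first exact: measurable_tnth.
exact: measurable_behead.
Qed.

Lemma tconsK n : cancel (@tcons n) (@tuncons n).
Proof. by case=> x t; rewrite /tuncons; congr (_, _); apply/val_inj. Qed.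

Lemma tunconsK n : cancel (@tuncons n) (@tcons n).
Proof. by move=> t; rewrite /tcons/= [RHS]tuple_eta; apply/val_inj. Qed.

Lemma sigma_finite_pushforward d d' (T : measurableType d)
    (T' : measurableType d') (m : {measure set T -> \bar R}) (f : T -> T')
    (g : T' -> T) (mf : measurable_fun [set: T] f) :
  measurable_fun [set: T'] g -> cancel f g -> sigma_finite setT m ->
  sigma_finite setT (pushforward m f).
Proof.
move=> mg fK [F FT Foo]; exists (fun i => g @^-1` F i).
  by rewrite -preimage_bigcup -FT preimage_setT.
move=> i; have [mF Fi] := Foo i; split; first by rewrite -[X in measurable X]setTI; exact: mg.
rewrite /pushforward (_ : f @^-1` (g @^-1` F i) = F i)//.
by apply/seteqP; split=> x /=; rewrite fK.
Qed.

Lemma product_sigma_finite d d' (T : measurableType d) (T' : measurableType d')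
    (m : {sigma_finite_measure set T -> \bar R})
    (m' : {sigma_finite_measure set T' -> \bar R}) :
  sigma_finite setT (m \x m').
Proof.
have /sigma_finiteP[F [TF ndF Foo]] := sigma_finiteT m.
have /sigma_finiteP[G [TG ndG Goo]] := sigma_finiteT m'.
exists (fun n => F n `*` G n) => [|n].
  apply/seteqP; split=> // -[x y] _.
  have [i _ Fx] : (\bigcup_i F i) x by rewrite -TF.
  have [j _ Gy] : (\bigcup_i G i) y by rewrite -TG.
  exists (maxn i j) => //; split=> /=.
    by apply: subsetPset Fx; exact/ndF/leq_maxl.
  by apply: subsetPset Gy; exact/ndG/leq_maxr.
have [mF Fn] := Foo n; have [mG Gn] := Goo n.
split; first exact: measurableX.
by rewrite product_measure1E// lte_mul_pinfty// ge0_fin_numE.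
Qed.

(** A named definition, so that the sigma-finite instance can be attached to it and [lebn] can
    recurse inside the type of sigma-finite measures. *)
Definition lebS n (m : {sigma_finite_measure set (n.-tuple R) -> \bar R}) :
  set (n.+1.-tuple R) -> \bar R :=
  pushforward_measure (leb \x m : {measure set _ -> \bar R}) (@measurable_tcons n).

HB.instance Definition _ n m := Measure.on (@lebS n m).

Lemma lebS_sigma_finite n m : sigma_finite setT (@lebS n m).
Proof.
apply: (@sigma_finite_pushforward _ _ _ _ (leb \x m) _ (@tuncons n)).
- exact: measurable_tcons.
- exact: measurable_tuncons.
- exact: tconsK.
- exact: product_sigma_finite.
Qed.

HB.instance Definition _ n m := @isSFinite.Build _ _ _ (@lebS n m)
  (sfinite_measure_sigma_finite (@lebS_sigma_finite n m)).
HB.instance Definition _ n m := @isSigmaFinite.Build _ _ _ (@lebS n m)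
  (@lebS_sigma_finite n m).

Fixpoint lebn n : {sigma_finite_measure set (n.-tuple R) -> \bar R} :=
  match n with
  | 0 => \d_([tuple] : 0.-tuple R)
  | n.+1 => @lebS n (lebn n)
  end.

Lemma lebn0_integral (F : 0.-tuple R -> \bar R) :
  measurable_fun setT F -> \int[lebn 0]_t F t = F [tuple].
Proof. by move=> mF; rewrite integral_dirac// diracT mul1e. Qed.

Lemma ge0_lebnS_integral n (F : n.+1.-tuple R -> \bar R) :
  measurable_fun setT F -> (forall t, 0 <= F t) ->
  \int[lebn n.+1]_t F t = \int[leb]_x \int[lebn n]_t F (tcons (x, t)).
Proof.
move=> mF F0; transitivity (\int[leb \x lebn n]_p F (tcons p)).
  exact: (ge0_integral_pushforwardT (leb \x lebn n) (@measurable_tcons n)).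
apply: (@fubini_tonelli1 _ _ _ _ _ leb (lebn n) (F \o @tcons n)) => [|p]; last exact: F0.
exact: (measurableT_comp mF (@measurable_tcons n)).
Qed.

Lemma lebnS_integrable n (F : n.+1.-tuple R -> \bar R) :
  (lebn n.+1).-integrable setT F ->
  (leb \x lebn n).-integrable setT (fun p => F (tcons p)).
Proof.
exact: (@integrable_pushforward_comp _ _ _ _ _ (leb \x lebn n) _ (@measurable_tcons n) F).
Qed.

Lemma lebnS_integral n (F : n.+1.-tuple R -> \bar R) :
  (lebn n.+1).-integrable setT F ->
  \int[lebn n.+1]_t F t = \int[leb]_x \int[lebn n]_t F (tcons (x, t)).
Proof.
move=> iF; rewrite [RHS](integral12_prod_meas1 (lebnS_integrable iF)).
exact: (@integral_pushforwardT _ _ _ _ _ (leb \x lebn n) _ (@measurable_tcons n) F).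
Qed.

End tuple_measure.

Section parametric_integrals.
Context d1 d2 (T1 : measurableType d1) (T2 : measurableType d2) (R : realType).
Variable m : {sigma_finite_measure set T2 -> \bar R}.

(** Tonelli's measurability statement concerns nonnegative functions; it is applied to the positive
    and negative parts, whose integrals define the signed one by subtraction. *)
Lemma measurable_parametric_integral (f : T1 * T2 -> \bar R) :
  measurable_fun setT f ->
  measurable_fun setT (fun x => \int[m]_y f (x, y))%E.
Proof.
move=> mf; rewrite (_ : (fun _ => _) = (fun x => \int[m]_y (f^\+)%E (x, y))
    \- (fun x => \int[m]_y (f^\-)%E (x, y)))%E.
  apply: emeasurable_funB; apply: measurable_fun_fubini_tonelli_F => //.
    exact: measurable_funepos.
  exact: measurable_funeneg.
apply/funext => x; rewrite integralE.
under eq_integral do rewrite funepos_comp/=.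
by under [X in (_ - X = _)%E]eq_integral do rewrite funeneg_comp/=.
Qed.

Lemma measurable_parametric_Rintegral (f : T1 * T2 -> R) :
  measurable_fun setT f ->
  measurable_fun setT (fun x => \int[m]_y f (x, y)).
Proof.
move=> mf; apply: measurableT_comp => //.
by apply: (@measurable_parametric_integral (EFin \o f)); exact/measurable_EFinP.
Qed.

End parametric_integrals.

(** * Iterated integrals as integrals over tuples *)

Section iterated_integrals.
Variable R : realType.
Local Notation leb := (@lebesgue_measure R).

(* [iRint] and [iEint] integrate the coordinate of largest index outermost, so tuples
   list the coordinates in reverse. *)
Definition rev_fun n (t : n.-tuple R) : nat -> R := nth 0 (rev t).

Lemma rev_fun_tcons n x (t : n.-tuple R) :
  rev_fun (tcons (x, t)) = fun i => if i == n then x else rev_fun t i.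
Proof.
apply/funext => i; rewrite /rev_fun /= rev_cons nth_rcons size_rev size_tuple.
case: ltngtP => // ni.
by rewrite nth_default// size_rev size_tuple ltnW.
Qed.

Lemma iEint_lebn n (F : (nat -> R) -> \bar R) :
  measurable_fun setT (F \o @rev_fun n) ->
  (forall v, 0 <= F v)%E ->
  iEint n F = (\int[lebn R n]_t F (rev_fun t))%E.
Proof.
elim: n F => [|n IH] F mF F0 /=.
  rewrite (lebn0_integral mF) /=; congr F.
  by apply/funext => i; rewrite /rev_fun nth_default.
rewrite (ge0_lebnS_integral mF)//=; apply: eq_integral => x _.
under [RHS]eq_integral do rewrite rev_fun_tcons.
rewrite IH//.
rewrite (_ : _ \o _ = (F \o @rev_fun n.+1) \o (fun t => tcons (x, t))).
  apply: measurableT_comp => //; apply: (measurableT_comp (@measurable_tcons R n)).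
  exact: pair1_measurable.
by apply/funext => t /=; rewrite rev_fun_tcons.
Qed.

(** The parameter [z] is there for the induction: at each step the outermost variable joins the
    parameters. *)
Lemma measurable_iRint d (T : measurableType d) n (F : T -> (nat -> R) -> R) :
  measurable_fun setT (fun p : T * n.-tuple R => F p.1 (rev_fun p.2)) ->
  measurable_fun setT (fun z => iRint n (F z)).
Proof.
elim: n d T F => [|n IH] d T F mF /=.
  rewrite (_ : (fun _ => _) = (fun p : T * 0.-tuple R => F p.1 (rev_fun p.2)) \o
      (fun z => (z, [tuple]))).
    by apply: measurableT_comp => //; exact: pair2_measurable.
  by apply/funext => z /=; congr (F z _); apply/funext => i; rewrite /rev_fun nth_default.
apply: (@measurable_parametric_Rintegral _ _ _ _ _ leb
  (fun p => iRint n (fun v => F p.1 (fun i => if i == n then p.2 else v i)))).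
apply: (@IH _ _ (fun (p : T * R) v => F p.1 (fun i => if i == n then p.2 else v i))).
rewrite (_ : (fun _ => _) = (fun p : T * n.+1.-tuple R => F p.1 (rev_fun p.2)) \o
    (fun q : (T * R) * n.-tuple R => (q.1.1, tcons (q.1.2, q.2)))).
  apply: measurableT_comp => //; apply/measurable_fun_pair => /=.
    exact: measurableT_comp.
  apply: (measurableT_comp (@measurable_tcons R n)) => /=.
  by apply/measurable_fun_pair => //=; exact: measurableT_comp.
by apply/funext => -[[z x] t] /=; rewrite rev_fun_tcons.
Qed.

(** Fubini makes the inner integrand integrable for almost every outer value only, so the induction
    hypothesis identifies the inner integrals almost everywhere. Passing to the outer integral then
    uses [measurable_iRint]. *)
Lemma iRint_lebn n (F : (nat -> R) -> R) :
  (lebn R n).-integrable setT (fun t => (F (rev_fun t))%:E) ->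
  iRint n F = \int[lebn R n]_t F (rev_fun t).
Proof.
elim: n F => [|n IH] F iF.
  rewrite /Rintegral lebn0_integral//; first by congr F; apply/funext => i; rewrite /rev_fun nth_default.
  exact: measurable_int iF.
rewrite /Rintegral (lebnS_integral iF) /=; congr fine.
have iF' := lebnS_integrable iF.
have mF : measurable_fun setT (fun t : n.+1.-tuple R => F (rev_fun t)).
  by apply/measurable_EFinP; exact: measurable_int iF.
apply: ae_eq_integral => //.
- apply/measurable_EFinP.
  apply: (@measurable_iRint _ _ n (fun x v => F (fun i => if i == n then x else v i))).
  rewrite (_ : (fun _ => _) = (fun t : n.+1.-tuple R => F (rev_fun t)) \o @tcons R n).
    exact: (measurableT_comp mF (@measurable_tcons R n)).
  by apply/funext => -[x t] /=; rewrite rev_fun_tcons.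
- exact: measurable_fubini_F iF'.
have := ae_integrable1 iF'; apply: filterS => x ix _.
rewrite IH.
  rewrite /Rintegral fineK.
    by apply: eq_integral => t _; rewrite rev_fun_tcons.
  apply: integrable_fin_num => //; apply: eq_integrable ix => // t _.
  by rewrite rev_fun_tcons.
by apply: eq_integrable ix => // t _; rewrite rev_fun_tcons.
Qed.

End iterated_integrals.

(** * Triangular affine substitution *)

Section triangular_substitution.
Variable R : realType.
Local Notation leb := (@lebesgue_measure R).

Lemma measurable_rev_fun n i : measurable_fun setT (fun t : n.-tuple R => rev_fun t i).
Proof.
have [ni|lin] := leqP n i.
  rewrite (_ : (fun _ => _) = cst 0)//; apply/funext => t.
  by rewrite /rev_fun nth_default// size_rev size_tuple.
have lt : (n - i.+1 < n)%N by rewrite ltn_subrL (leq_trans _ lin).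
rewrite (_ : (fun _ => _) = fun t => tnth t (Ordinal lt)); first exact: measurable_tnth.
apply/funext => t; rewrite /rev_fun nth_rev ?size_tuple//.
by rewrite (tnth_nth 0).
Qed.

Variables (a : nat -> R) (b : forall n, n.-tuple R -> R).

(** Coordinate [m] becomes [a m] times itself plus a function of the coordinates of smaller index.
    The head of the tuple has the largest index, which is why the recursion goes down the tail. *)
Fixpoint trig_map n : n.-tuple R -> n.-tuple R :=
  match n with
  | 0 => id
  | m.+1 => fun t => let p := tuncons t in
      tcons (a m * p.1 + b p.2, trig_map p.2)
  end.

Lemma trig_map_tcons n x (t : n.-tuple R) :
  trig_map (tcons (x, t)) = tcons (a n * x + b t, trig_map t).
Proof.
have -> : trig_map (tcons (x, t)) =
    let p := tuncons (tcons (x, t)) in tcons (a n * p.1 + b p.2, trig_map p.2) by [].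
by rewrite tconsK.
Qed.

Hypothesis a_neq0 : forall i, a i != 0.
Hypothesis mb : forall n, measurable_fun setT (@b n).

Lemma measurable_trig_map n : measurable_fun setT (@trig_map n).
Proof.
elim: n => [|n IH] //=.
apply: (measurableT_comp (@measurable_tcons R n)).
have m1 : measurable_fun setT (fun t : n.+1.-tuple R => (tuncons t).1).
  exact: (measurableT_comp measurable_fst (@measurable_tuncons R n)).
have m2 : measurable_fun setT (fun t : n.+1.-tuple R => (tuncons t).2).
  exact: (measurableT_comp measurable_snd (@measurable_tuncons R n)).
apply/measurable_fun_pair => /=; last exact: measurableT_comp IH m2.
apply: measurable_funD; first exact: measurable_funM.
exact: (measurableT_comp (@mb n) m2).
Qed.

(** After a Tonelli exchange the head coordinate is integrated innermost. With the tail fixed it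
    undergoes a one-dimensional affine map of slope [a n], so [|a n|] factors out and the tail is
    left to the induction. *)
Lemma ge0_integral_trig_map n (F : n.-tuple R -> \bar R) :
  measurable_fun setT F -> (forall t, 0 <= F t)%E ->
  (\int[lebn R n]_t F t =
   (\prod_(i < n) `|a i|)%:E * \int[lebn R n]_t F (trig_map t))%E.
Proof.
elim: n F => [|n IH] F mF F0; first by rewrite big_ord0 mul1e.
have mFt x : measurable_fun setT (fun t => F (tcons (x, t))).
  apply: (measurableT_comp mF); apply: (measurableT_comp (@measurable_tcons R n)).
  exact: pair1_measurable.
have mFx t : measurable_fun setT (fun x => F (tcons (x, t))).
  apply: (measurableT_comp mF); apply: (measurableT_comp (@measurable_tcons R n)).
  exact: pair2_measurable.
have mFp := measurableT_comp mF (@measurable_tcons R n).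
have F0p p : (0 <= (F \o @tcons R n) p)%E by exact: F0.
have mtrig := @measurable_trig_map n.
have mH := measurableT_comp (measurableT_comp mF (@measurable_trig_map n.+1))
  (@measurable_tcons R n).
have mG : measurable_fun setT (fun t => \int[leb]_x F (tcons (x, t)))%E.
  by apply: (@measurable_fun_fubini_tonelli_G _ _ _ _ _ leb (F \o @tcons R n)) => //= p.
have mGt : measurable_fun setT (fun t => \int[leb]_x F (tcons (x, trig_map t)))%E.
  exact: (measurableT_comp mG mtrig).
rewrite (ge0_lebnS_integral mF)// (ge0_lebnS_integral (F := fun t => F (trig_map t)))//;
  last by exact: (measurableT_comp mF (@measurable_trig_map n.+1)).
rewrite [LHS](@fubini_tonelli _ _ _ _ _ leb (lebn R n) (F \o @tcons R n))//.
rewrite [in RHS](@fubini_tonelli _ _ _ _ _ leb (lebn R n)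
  (fun p => F (trig_map (tcons p))))//.
rewrite big_ord_recr/= EFinM -muleA IH//; last first.
  by move=> t; apply: integral_ge0.
congr (_ * _)%E; rewrite -ge0_integralZl_EFin//; last 2 first.
- by move=> t _; apply: integral_ge0.
- have -> : (fun t => \int[leb]_x F (trig_map (tcons (x, t))))%E =
    fubini_G leb (fun p => F (trig_map (tcons p))) by [].
  exact: measurable_fun_fubini_tonelli_G.
apply: eq_integral => t _.
rewrite (@ge0_integral_affine _ (a n) (b t))//; congr (_ * _)%E.
by apply: eq_integral => x _; exact: (congr1 F (esym (trig_map_tcons x t))).
Qed.

Lemma rev_fun_tuncons n (t : n.+1.-tuple R) i :
  rev_fun t i = if i == n then (tuncons t).1 else rev_fun (tuncons t).2 i.
Proof. by rewrite -{1}(tunconsK t) rev_fun_tcons. Qed.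

End triangular_substitution.

Section column_vectors.
Variable R : realType.

Definition colt N (t : N.-tuple R) : 'cV[R]_N := \col_(i < N) rev_fun t i.

Lemma measurable_coltE N (i : 'I_N) j :
  measurable_fun setT (fun t : N.-tuple R => colt t i j).
Proof.
rewrite (_ : (fun _ => _) = fun t : N.-tuple R => rev_fun t i).
  exact: measurable_rev_fun.
by apply/funext => t; rewrite mxE.
Qed.

Section lower_trig.
Variables (l : nat -> nat -> R) (c : nat -> R).
Let b n (t : n.-tuple R) := \sum_(j < n) l n j * rev_fun t j + c n.
Let a i := l i i.

Let rev_fun_trig n (t : n.-tuple R) i : (i < n)%N ->
  rev_fun (trig_map a b t) i = \sum_(j < i.+1) l i j * rev_fun t j + c i.
Proof.
elim: n t => // n IH t; rewrite ltnS leq_eqVlt => /predU1P[->|lin] /=.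
  rewrite rev_fun_tcons eqxx big_ord_recr /= rev_fun_tuncons eqxx addrA.
  congr (_ + _); rewrite addrC; congr (_ + _).
  by apply: eq_bigr => j _; rewrite rev_fun_tuncons (ltn_eqF (ltn_ord j)).
rewrite rev_fun_tcons ltn_eqF// IH//; congr (_ + _).
apply: eq_bigr => j _; rewrite [in RHS]rev_fun_tuncons.
have jn : (j < n)%N by rewrite (leq_ltn_trans _ lin)// -ltnS.
by rewrite (ltn_eqF jn).
Qed.

Hypothesis l_neq0 : forall i, l i i != 0.

(** [H] stands for [G] after the affine map. The link is a hypothesis on coordinates below [n],
    because those are the only ones of the image that [trig_map] controls. *)
Lemma ge0_integral_trig_affine n (G : (nat -> R) -> \bar R) (H : (nat -> R) -> \bar R) :
  (forall u v : nat -> R, (forall i, (i < n)%N -> u i = \sum_(j < i.+1) l i j * v j + c i) ->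
     G u = H v) ->
  measurable_fun setT (G \o @rev_fun R n) -> (forall v, 0 <= G v)%E ->
  (\int[lebn R n]_t G (rev_fun t) =
   (\prod_(i < n) `|l i i|)%:E * \int[lebn R n]_t H (rev_fun t))%E.
Proof.
move=> GH mG G0; have mb m : measurable_fun setT (@b m).
  apply: measurable_funD => //; apply: measurable_sum => j.
  by apply: measurable_funM => //; exact: measurable_rev_fun.
have := ge0_integral_trig_map (a := a) l_neq0 mb mG (fun t => G0 _).
move=> /= ->; congr (_ * _)%E.
apply: eq_integral => t _; apply: GH => i; exact: rev_fun_trig.
Qed.

End lower_trig.

Lemma insub_ord N (i : 'I_N) : insub (i : nat) = Some i.
Proof. exact: valK. Qed.

Lemma ge0_integral_lower_trig N (L : 'M[R]_N) (c : 'cV[R]_N)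
    (F : 'cV[R]_N -> \bar R) :
  is_trig_mx L -> (forall i, L i i != 0) ->
  measurable_fun setT (F \o @colt N) -> (forall x, 0 <= F x)%E ->
  (\int[lebn R N]_t F (colt t) =
   `|\det L|%:E * \int[lebn R N]_t F (L *m colt t + c)%R)%E.
Proof.
move=> trigL L0 mF F0; rewrite det_trig// normr_prod.
(* The default value 1 keeps every [l i i] nonzero, also for indices outside the matrix. *)
pose l (i j : nat) : R := oapp (fun p => oapp (L p) 1 (insub j)) 1 (insub i).
pose c' (i : nat) : R := oapp (fun p => c p 0) 0 (insub i).
pose col (v : nat -> R) := \col_(i < N) v i.
have lE (i j : 'I_N) : l i j = L i j by rewrite /l !insub_ord.
rewrite (@ge0_integral_trig_affine l c' _ N (F \o col) (fun v => F (L *m col v + c)))//=.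
- by congr (_%:E * _)%E; apply: eq_bigr => i _; rewrite lE.
- by move=> i; rewrite /l; case: insubP => [p _ _|_] /=; rewrite ?oner_eq0.
- move=> u v uv; congr F; apply/matrixP => i j; rewrite !mxE ord1 uv//.
  rewrite /c' insub_ord /=; congr (_ + _).
  rewrite (big_ord_widen N (fun j => l i j * v j))// big_mkcond/=.
  apply: eq_bigr => k _; rewrite mxE lE ltnS; case: leqP => // ik.
  by move/is_trig_mxP : trigL => ->//; rewrite mul0r.
Qed.

Lemma ge0_integral_colt_opp N (F : 'cV[R]_N -> \bar R) :
  measurable_fun setT (F \o @colt N) -> (forall x, 0 <= F x)%E ->
  (\int[lebn R N]_t F (colt t) = \int[lebn R N]_t F (- colt t)%R)%E.
Proof.
move=> mF F0; rewrite (@ge0_integral_lower_trig N (-1)%:M 0)//.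
- rewrite det_scalar normrX normrN1 expr1n mul1e.
  by apply: eq_integral => t _; rewrite mul_scalar_mx scaleN1r addr0.
- by move=> i; rewrite mxE eqxx oppr_eq0 oner_eq0.
Qed.

Lemma ge0_integral_colt_addr N (c : 'cV[R]_N) (F : 'cV[R]_N -> \bar R) :
  measurable_fun setT (F \o @colt N) -> (forall x, 0 <= F x)%E ->
  (\int[lebn R N]_t F (colt t) = \int[lebn R N]_t F (colt t + c)%R)%E.
Proof.
move=> mF F0; rewrite (@ge0_integral_lower_trig N 1%:M c)//.
- rewrite det1 normr1 mul1e.
  by apply: eq_integral => t _; rewrite mul1mx.
- by move=> i; rewrite mxE eqxx oner_eq0.
Qed.

End column_vectors.

(** * Gaussian densities and the Chapman-Kolmogorov identity *)

Section posdef.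
Variable R : realType.

Definition qform n (M : 'M[R]_n) (x : 'cV[R]_n) : R := (x^T *m M *m x) 0 0.

Definition posdef n (M : 'M[R]_n) :=
  M^T = M /\ forall v : 'cV[R]_n, v != 0 -> 0 < qform M v.

Lemma qform_mulr n p (M : 'M[R]_n) (L : 'M[R]_(n, p)) x :
  qform (L^T *m M *m L) x = qform M (L *m x).
Proof. by rewrite /qform trmx_mul !mulmxA. Qed.

Lemma qformD n (M M' : 'M[R]_n) x : qform (M + M') x = qform M x + qform M' x.
Proof. by rewrite /qform mulmxDr mulmxDl mxE. Qed.

Lemma qform1 n (x : 'cV[R]_n) : qform 1%:M x = \sum_i x i 0 ^+ 2.
Proof.
by rewrite /qform mulmx1 mxE; apply: eq_bigr => i _; rewrite mxE expr2.
Qed.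

Definition dotv n (x y : 'cV[R]_n) : R := (x^T *m y) 0 0.

Lemma dotvC n (x y : 'cV[R]_n) : dotv x y = dotv y x.
Proof. by rewrite /dotv !mxE; apply: eq_bigr => i _; rewrite !mxE mulrC. Qed.

Lemma dotvDr n (x y z : 'cV[R]_n) : dotv x (y + z) = dotv x y + dotv x z.
Proof. by rewrite /dotv mulmxDr mxE. Qed.

Lemma dotvNr n (x y : 'cV[R]_n) : dotv x (- y) = - dotv x y.
Proof. by rewrite /dotv mulmxN mxE. Qed.

Lemma dotvDl n (x y z : 'cV[R]_n) : dotv (x + y) z = dotv x z + dotv y z.
Proof. by rewrite dotvC dotvDr !(dotvC z). Qed.

Lemma dotvNl n (x y : 'cV[R]_n) : dotv (- x) y = - dotv x y.
Proof. by rewrite dotvC dotvNr dotvC. Qed.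

Lemma dotv_mulr n p (M : 'M[R]_(n, p)) x y : dotv x (M *m y) = dotv (M^T *m x) y.
Proof. by rewrite /dotv trmx_mul trmxK mulmxA. Qed.

Lemma qformE n (M : 'M[R]_n) x : qform M x = dotv x (M *m x).
Proof. by rewrite /qform /dotv mulmxA. Qed.

Lemma qformB n (M : 'M[R]_n) x y : M^T = M ->
  qform M (x - y) = qform M x - 2 * dotv x (M *m y) + dotv y (M *m y).
Proof.
move=> symM; rewrite !qformE mulmxBr dotvDl !dotvDr !dotvNl !dotvNr.
have -> : dotv y (M *m x) = dotv x (M *m y) by rewrite dotv_mulr symM dotvC.
by ring.
Qed.

Lemma posdef_diag_gt0 n (M : 'M[R]_n) i : posdef M -> 0 < M i i.
Proof.
move=> [_ /(_ (delta_mx i 0))].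
rewrite /qform trmx_delta -rowE -colE !mxE; apply.
apply/eqP => /matrixP/(_ i 0); rewrite !mxE !eqxx => /eqP.
by rewrite oner_eq0.
Qed.

(** Among the vectors with lower block w, the form of S is least when the first coordinate is [u] =
    - a^-1 b^T w, and its value there is the Schur complement evaluated at w. *)
Lemma posdef_schur n (S : 'M[R]_(1 + n)) : posdef S ->
  posdef (drsubmx S - (S 0 0)^-1 *: (dlsubmx S *m (dlsubmx S)^T)).
Proof.
move=> pS; have a0 := posdef_diag_gt0 0 pS.
case: pS => symS pS; set b := dlsubmx S; set a := S 0 0.
have symD : (drsubmx S)^T = drsubmx S by rewrite trmx_drsub symS.
have Sb : ursubmx S = b^T by rewrite -[in LHS]symS /b trmx_dlsub.
have Sa : ulsubmx S = a%:M.
  rewrite [LHS]mx11_scalar /a; congr (_%:M); rewrite !mxE; congr (S _ _); exact/val_inj.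
split.
  by rewrite linearB/= linearZ/= trmx_mul trmxK symD.
move=> w w0; pose u : 'cV[R]_1 := - (a^-1 *: (b^T *m w)).
have /pS : col_mx u w != 0.
  by apply: contra_neq w0 => /(congr1 dsubmx); rewrite col_mxKd linear0.
congr (0 < _); rewrite /qform -{1}[S]submxK Sa Sb -/b.
rewrite tr_col_mx mul_row_block mul_row_col; congr (_ 0 0).
pose z := b^T *m w.
have -> : u^T = - (a^-1 *: z^T) by rewrite /u linearN/= linearZ.
have -> : w^T *m (drsubmx S - a^-1 *: (b *m b^T)) *m w =
    w^T *m drsubmx S *m w - a^-1 *: (z^T *m z).
  rewrite mulmxBr mulmxBl -scalemxAr -scalemxAl; congr (_ - _ *: _).
  by rewrite /z trmx_mul trmxK !mulmxA.
have -> : w^T *m b = z^T by rewrite /z trmx_mul trmxK.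
rewrite /u -/z !mulmxDl !(mulmxN, mulNmx) mul_mx_scalar.
rewrite -!(scalemxAl, scalemxAr) scalerA.
rewrite divff ?gt_eqF// !scale1r opprK -!mulmxA -/z.
by rewrite subrr add0r addrC.
Qed.

(** Induction through the Schur complement: if [L] factors the complement and r is the square root
    of the corner entry, the block matrix with first column (r, b / r) and lower block [L] factors
    S. The triangular shape is what the substitution rule requires. *)
Lemma cholesky n (S : 'M[R]_n) : posdef S ->
  exists L : 'M[R]_n, [/\ is_trig_mx L, forall i, 0 < L i i & S = L *m L^T].
Proof.
elim: n S => [|n IH] S pS.
  by exists 0; split; [exact: mx0_is_trig|case|rewrite mul0mx flatmx0].
have a0 := posdef_diag_gt0 0 pS.
have [L [trigL Lpos SL]] := IH _ (posdef_schur pS).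
case: (pS) => symS _; pose S1 : 'M[R]_(1 + n) := S.
pose b := dlsubmx S1; pose r := Num.sqrt (S1 0 0).
have r0 : 0 < r by rewrite sqrtr_gt0.
have r2 : r ^+ 2 = S1 0 0 by rewrite sqr_sqrtr// ltW.
have symS1 : S1^T = S1 by exact: symS.
have Sb : ursubmx S1 = b^T by rewrite -[in LHS]symS1 /b trmx_dlsub.
have Sa : ulsubmx S1 = (r ^+ 2)%:M.
  rewrite [LHS]mx11_scalar r2; congr (_%:M); rewrite !mxE.
  by congr (S _ _); exact/val_inj.
pose M : 'M[R]_(1 + n) := block_mx r%:M 0 (r^-1 *: b) L.
have trigM : is_trig_mx M by rewrite is_trig_block_mx// eqxx scalar_mx_is_trig.
have Mpos (i : 'I_(1 + n)) : 0 < M i i.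
  case: (split_ordP i) => j ->; first by rewrite block_mxEul mxE eqxx.
  by rewrite block_mxEdr.
suff SE : S1 = M *m M^T by exists M.
rewrite -[LHS]submxK Sa Sb -/b /M tr_block_mx mulmx_block.
rewrite !(tr_scalar_mx, trmx0, mulmx0, mul0mx, addr0) !linearZ/= -SL -scalar_mxM -expr2.
rewrite mul_scalar_mx mul_mx_scalar !scalerA divff ?gt_eqF// scale1r.
rewrite mulVf ?gt_eqF// scale1r; congr block_mx.
by rewrite -scalemxAl scalerA -r2 -expr2 exprVn subrKC.
Qed.

Lemma posdef_det_gt0 n (S : 'M[R]_n) : posdef S -> 0 < \det S.
Proof.
move=> /cholesky[L [trigL L0 ->]]; rewrite det_mulmx det_tr -expr2.
by rewrite exprn_gt0// det_trig// prodr_gt0.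
Qed.

Lemma posdef_unit n (S : 'M[R]_n) : posdef S -> S \in unitmx.
Proof. by move=> /posdef_det_gt0 d; rewrite unitmxE unitfE gt_eqF. Qed.

Lemma posdef_inv n (S : 'M[R]_n) : posdef S -> posdef (invmx S).
Proof.
move=> pS; have uS := posdef_unit pS; case: pS => symS pS.
split; first by rewrite trmx_inv symS.
move=> v v0; have /pS : invmx S *m v != 0.
  by apply: contra_neq v0 => /(congr1 (mulmx S)); rewrite mulKVmx// mulmx0.
by rewrite -qform_mulr trmx_inv symS mulVmx// mul1mx.
Qed.

Lemma posdef_congr n (S E : 'M[R]_n) : E \in unitmx -> posdef S ->
  posdef (E *m S *m E^T).
Proof.
move=> uE [symS pS]; split; first by rewrite !trmx_mul trmxK symS mulmxA.
move=> v v0; have /pS : E^T *m v != 0.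
  apply: contra_neq v0 => /(congr1 (mulmx (invmx E^T))).
  by rewrite mulKmx ?unitmx_tr// mulmx0.
by rewrite -qform_mulr trmxK.
Qed.

Lemma posdefD n (S S' : 'M[R]_n) : posdef S -> posdef S' -> posdef (S + S').
Proof.
move=> [symS pS] [symS' pS']; split; first by rewrite linearD/= symS symS'.
by move=> v v0; rewrite qformD addr_gt0// ?pS ?pS'.
Qed.

Section completing_the_square.
Variables (n : nat) (S T E : 'M[R]_n).
Hypotheses (pS : posdef S) (pT : posdef T) (uE : E \in unitmx).

(** For independent Gaussians Y, Z with parameters S, T, the parameter of E Y + Z is [W], and [H] is
    the inverse parameter (the precision) of Y given E Y + Z. *)
Let W := T + E *m S *m E^T.
Let H := invmx S + E^T *m invmx T *m E.

Lemma posdef_square_sum : posdef H.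
Proof.
apply: posdefD; first exact: posdef_inv.
by rewrite -{2}[E]trmxK; apply: posdef_congr; rewrite ?unitmx_tr//; exact: posdef_inv.
Qed.

Lemma posdef_square_out : posdef W.
Proof. by apply: posdefD => //; exact: posdef_congr. Qed.

Let uS := posdef_unit pS.
Let uT := posdef_unit pT.
Let uH := posdef_unit posdef_square_sum.
Let uW := posdef_unit posdef_square_out.

(** Both sides expand to E^T + E^T T^-1 E S E^T. Determinants of this identity give
    [det_square_sum]; cancelling [H] gives the Woodbury formula inside [complete_square]. *)
Let HSE : H *m (S *m E^T) = E^T *m invmx T *m W.
Proof.
by rewrite /H /W [LHS]mulmxDl [RHS]mulmxDr mulKmx// mulmxKV// !mulmxA.
Qed.

Lemma det_square_sum : \det H = \det W / (\det S * \det T).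
Proof.
have /(congr1 determinant) := HSE; rewrite !det_mulmx det_tr det_inv.
have dE : \det E != 0 by move: uE; rewrite unitmxE unitfE.
have dS : \det S != 0 by rewrite gt_eqF// posdef_det_gt0.
have dT : \det T != 0 by rewrite gt_eqF// posdef_det_gt0.
move=> h; apply: (mulIf (mulf_neq0 dS dE)); rewrite h.
by field; rewrite dS dT.
Qed.

Lemma complete_square (y z : 'cV[R]_n) :
  qform (invmx S) y + qform (invmx T) (z - E *m y) =
  qform H (y - invmx H *m E^T *m invmx T *m z) + qform (invmx W) z.
Proof.
have [symS _] := posdef_inv pS; have [symT _] := posdef_inv pT.
have [symH _] := posdef_square_sum.
set C := invmx T in symT *; pose K := E^T *m C.
have KT : K^T = C *m E by rewrite trmx_mul trmxK symT.
(* The Woodbury formula for the inverse of [W], checked after multiplication by [W] on the right. *)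
have CW : C = K^T *m invmx H *m K + invmx W.
  rewrite -[LHS](mulmxK uW) -[RHS](mulmxK uW); congr (_ *m _).
  have KW : K *m W = H *m (S *m E^T) by rewrite HSE.
  rewrite mulmxDl mulVmx// -(mulmxA (_ *m invmx H)) KW -mulmxA mulKmx// KT /W mulmxDr -/C mulVmx// addrC.
  by rewrite !mulmxA.
rewrite -!mulmxA [E^T *m _]mulmxA -/K (qformB _ _ symT) (qformB _ _ symH).
rewrite mulKVmx// /H qformD.
have -> : dotv z (C *m (E *m y)) = dotv y (K *m z).
  by rewrite [RHS](dotv_mulr K) [RHS]dotvC KT mulmxA.
have -> : dotv (E *m y) (C *m (E *m y)) = qform (E^T *m C *m E) y.
  by rewrite qform_mulr qformE.
have -> : dotv (invmx H *m (K *m z)) (K *m z) = qform C z - qform (invmx W) z.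
  by rewrite [in qform C z]CW qformD addrK qform_mulr qformE dotvC.
by ring.
Qed.

End completing_the_square.

End posdef.

Section measurable_columns.
Context d (T : measurableType d) (R : realType).
Implicit Types N : nat.

Definition measurable_col N (h : T -> 'cV[R]_N) :=
  forall i, measurable_fun setT (fun x => h x i 0).

Lemma measurable_colD N (h g : T -> 'cV[R]_N) :
  measurable_col h -> measurable_col g -> measurable_col (fun x => h x + g x).
Proof.
move=> mh mg i; under eq_fun do rewrite mxE.
exact: measurable_funD (mh i) (mg i).
Qed.

Lemma measurable_colN N (h : T -> 'cV[R]_N) :
  measurable_col h -> measurable_col (fun x => - h x).
Proof.
by move=> mh i; under eq_fun do rewrite mxE; exact: measurableT_comp (mh i).
Qed.

Lemma measurable_col_cst N (c : 'cV[R]_N) : measurable_col (fun=> c).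
Proof. by move=> i; exact: measurable_cst. Qed.

Lemma measurable_col_mulmx N p (M : 'M[R]_(p, N)) (h : T -> 'cV[R]_N) :
  measurable_col h -> measurable_col (fun x => M *m h x).
Proof.
move=> mh i; under eq_fun do rewrite mxE.
by apply: measurable_sum => j; apply: measurable_funM => //; exact: mh.
Qed.

Lemma measurable_dotv N (h g : T -> 'cV[R]_N) :
  measurable_col h -> measurable_col g ->
  measurable_fun setT (fun x => dotv (h x) (g x)).
Proof.
move=> mh mg; under eq_fun do rewrite /dotv mxE.
apply: measurable_sum => j; apply: measurable_funM; last exact: mg.
by under eq_fun do rewrite mxE; exact: mh.
Qed.

Lemma measurable_qform N (M : 'M[R]_N) (h : T -> 'cV[R]_N) :
  measurable_col h -> measurable_fun setT (fun x => qform M (h x)).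
Proof.
move=> mh; under eq_fun do rewrite qformE.
by apply: measurable_dotv => //; exact: measurable_col_mulmx.
Qed.

End measurable_columns.

(** * Normalisation and composition of Gaussian densities *)

Section gaussian_density.
Variable R : realType.
Local Notation leb := (@lebesgue_measure R).

Lemma measurable_col_colt d (T : measurableType d) N (h : T -> N.-tuple R) :
  measurable_fun setT h -> measurable_col (fun x => colt (h x)).
Proof.
by move=> mh i; exact: (measurableT_comp (@measurable_coltE R N i 0) mh).
Qed.

(** [colt] is a bijection from tuples to columns. [tup] inverts it along [h], with the order of the
    coordinates reversed, and is measurable because [h] is so entry by entry. *)
Lemma measurable_comp_col d (T : measurableType d) d' (U : measurableType d') N
    (F : 'cV[R]_N -> U) (h : T -> 'cV[R]_N) :
  measurable_fun setT (F \o @colt R N) -> measurable_col h ->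
  measurable_fun setT (fun x => F (h x)).
Proof.
move=> mF mh.
pose tup x : N.-tuple R := [tuple h x (rev_ord i) 0 | i < N].
have mtup : measurable_fun setT tup.
  apply/measurable_fun_tnthP => i; rewrite (_ : _ \o _ = fun x => h x (rev_ord i) 0)//.
  by apply/funext => x /=; rewrite tnth_mktuple.
rewrite (_ : (fun _ => _) = (F \o @colt R N) \o tup); first exact: measurableT_comp mF mtup.
apply/funext => x /=; congr F; apply/matrixP => i j; rewrite ord1 mxE /rev_fun.
rewrite nth_rev ?size_tuple// -(tnth_nth 0 (tup x) (rev_ord i)) tnth_mktuple.
by rewrite rev_ordK.
Qed.

Lemma integral_expR_sqr (a : R) : 0 < a ->
  (\int[leb]_x (expR (- (a * x ^+ 2)))%:E = (Num.sqrt (pi / a))%:E)%E.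
Proof.
move=> a0; have r0 : 0 < Num.sqrt a by rewrite sqrtr_gt0.
have := @integralT_gauss R.
have mg : measurable_fun setT (fun x : R => (gauss_fun x)%:E).
  by apply/measurable_EFinP; exact: measurable_gauss_fun.
rewrite (@ge0_integral_scale_shift _ (Num.sqrt a) 0)//; last first.
  by move=> x; rewrite lee_fin gauss_fun_ge0.
under eq_integral do rewrite /gauss_fun addr0 exprMn sqr_sqrtr ?(ltW a0)//.
move=> /(congr1 (fun x => (Num.sqrt a)^-1%:E * x)%E).
rewrite muleA -EFinM mulVf ?gt_eqF// mul1e => ->.
by rewrite -EFinM sqrtrM ?pi_ge0// sqrtrV ?(ltW a0)// mulrC.
Qed.

Lemma measurable_gauss_fun_colt N (a : R) :
  measurable_fun setT (fun t : N.-tuple R => expR (- (a * qform 1%:M (colt t)))).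
Proof.
do 2 apply: measurableT_comp => //; apply: measurable_funM => //.
by apply: measurable_qform; exact: measurable_col_colt.
Qed.

Lemma qform1_colt N (t : N.-tuple R) :
  qform 1%:M (colt t) = \sum_(i < N) rev_fun t i ^+ 2.
Proof. by rewrite qform1; apply: eq_bigr => i _; rewrite mxE. Qed.

Lemma integral_gauss_colt N (a : R) : 0 < a ->
  (\int[lebn R N]_t (expR (- (a * qform 1%:M (colt t))))%:E =
   (Num.sqrt (pi / a) ^+ N)%:E)%E.
Proof.
move=> a0; elim: N => [|N IH].
  have mF : measurable_fun setT
      (fun t : 0.-tuple R => (expR (- (a * qform 1%:M (colt t))))%:E).
    by apply/measurable_EFinP; exact: measurable_gauss_fun_colt.
  by rewrite (lebn0_integral mF) qform1 big_ord0 mulr0 oppr0 expR0.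
have mF : measurable_fun setT
    (fun t : N.+1.-tuple R => (expR (- (a * qform 1%:M (colt t))))%:E).
  by apply/measurable_EFinP; exact: measurable_gauss_fun_colt.
rewrite (ge0_lebnS_integral mF) => [|t]; last by rewrite lee_fin expR_ge0.
transitivity (\int[leb]_x ((expR (- (a * x ^+ 2)))%:E * (Num.sqrt (pi / a) ^+ N)%:E))%E.
  apply: eq_integral => x _; rewrite -IH -ge0_integralZl_EFin ?expR_ge0//.
  - apply: eq_integral => t _; rewrite -EFinM -expRD; congr (expR _)%:E.
    rewrite !qform1_colt -opprD -mulrDr addrC; congr (- (_ * _)).
    rewrite big_ord_recr; congr (_ + _); last by rewrite rev_fun_tcons eqxx.
    by apply: eq_bigr => i _; rewrite rev_fun_tcons (ltn_eqF (ltn_ord i)).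
  - by apply/measurable_EFinP; exact: measurable_gauss_fun_colt.
rewrite ge0_integralZr//.
- by rewrite integral_expR_sqr// -EFinM exprS.
- apply/measurable_EFinP; do 2 apply: measurableT_comp => //.
  by apply: measurable_funM => //; exact: exprn_measurable.
Qed.

(** Centred Gaussian density of covariance 2 S, in the normalisation of the heat kernel; [pker] is
    the case S = t K(t), recentred. *)
Definition gauss_den N (S : 'M[R]_N) (y : 'cV[R]_N) : R :=
  (4 * pi) `^ (- (N%:R / 2)) * (\det S) `^ (- (1 / 2)) *
  expR (- (qform (invmx S) y / 4)).

Lemma gauss_den_ge0 N (S : 'M[R]_N) y : 0 <= gauss_den S y.
Proof. by rewrite /gauss_den !mulr_ge0 ?powR_ge0 ?expR_ge0. Qed.

Lemma measurable_gauss_den d (T : measurableType d) N (S : 'M[R]_N)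
    (h : T -> 'cV[R]_N) :
  measurable_col h -> measurable_fun setT (fun x => gauss_den S (h x)).
Proof.
move=> mh; apply: measurable_funM => //; do 2 apply: measurableT_comp => //.
by apply: measurable_funM => //; exact: measurable_qform.
Qed.

Lemma qform_cholesky N (L : 'M[R]_N) z : L \in unitmx ->
  qform (invmx (L *m L^T)) (L *m z) = qform 1%:M z.
Proof.
move=> uL; rewrite -qform_mulr; congr qform.
have uLT : L^T \in unitmx by rewrite unitmx_tr.
have uLL : L *m L^T \in unitmx by rewrite unitmx_mul uL.
rewrite -[LHS](mulmxK uLT) -[RHS](mulmxK uLT); congr (_ *m _).
by rewrite mul1mx -!mulmxA mulVmx// mulmx1.
Qed.

(** The case S = 1 of [gauss_den], written without determinant and inverse. *)
Definition std_gauss N (z : 'cV[R]_N) : R :=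
  (4 * pi) `^ (- (N%:R / 2)) * expR (- (4^-1 * qform 1%:M z)).

Lemma std_gauss_ge0 N (z : 'cV[R]_N) : 0 <= std_gauss z.
Proof. by rewrite mulr_ge0 ?powR_ge0 ?expR_ge0. Qed.

Lemma measurable_std_gauss N :
  measurable_fun setT (fun t : N.-tuple R => std_gauss (colt t)).
Proof. by apply: measurable_funM => //; exact: measurable_gauss_fun_colt. Qed.

Lemma powR_half_nat (x : R) N : 0 < x -> x `^ (N%:R / 2) = Num.sqrt x ^+ N.
Proof.
by move=> x0; rewrite mulrC powRrM powR12_sqrt ?(ltW x0)// powR_mulrn// sqrtr_ge0.
Qed.

Lemma integral_std_gauss N : (\int[lebn R N]_t (std_gauss (colt t))%:E = 1)%E.
Proof.
rewrite /std_gauss; under eq_integral do rewrite EFinM.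
rewrite ge0_integralZl_EFin ?powR_ge0//; first last.
- by apply/measurable_EFinP; exact: measurable_gauss_fun_colt.
have pi4 : 0 < 4 * pi :> R by rewrite mulr_gt0 ?pi_gt0.
rewrite integral_gauss_colt ?invr_gt0// invrK (mulrC pi) -EFinM.
rewrite powRN powR_half_nat// mulVf// expf_neq0//.
by rewrite gt_eqF// sqrtr_gt0.
Qed.

Lemma gauss_den_cholesky N (L : 'M[R]_N) z : L \in unitmx ->
  `|\det L| * gauss_den (L *m L^T) (L *m z) = std_gauss z.
Proof.
move=> uL; rewrite /gauss_den qform_cholesky// /std_gauss.
have dL : 0 < `|\det L| by rewrite normr_gt0 -unitfE -unitmxE.
rewrite det_mulmx det_tr -expr2 -real_normK ?num_real//.
have -> : (`|\det L| ^+ 2) `^ (- (1 / 2)) = `|\det L|^-1.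
  by rewrite powRN div1r powR12_sqrt ?sqr_ge0// sqrtr_sqr normr_id.
by rewrite [qform _ _ / 4]mulrC; field; rewrite gt_eqF.
Qed.

Lemma ge0_integral_gauss_den N (L : 'M[R]_N) (m : 'cV[R]_N) (F : 'cV[R]_N -> \bar R) :
  is_trig_mx L -> (forall i, 0 < L i i) ->
  measurable_fun setT (F \o @colt R N) -> (forall x, 0 <= F x)%E ->
  (\int[lebn R N]_t ((gauss_den (L *m L^T) (colt t - m))%:E * F (colt t)) =
   \int[lebn R N]_t ((std_gauss (colt t))%:E * F (L *m colt t + m)%R))%E.
Proof.
move=> trigL L0 mF F0.
have L0' i : L i i != 0 by rewrite gt_eqF.
have uL : L \in unitmx.
  by rewrite unitmxE unitfE det_trig//; apply/prodf_neq0 => i _.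
have mG : measurable_fun setT (fun t : N.-tuple R =>
    (gauss_den (L *m L^T) (colt t - m))%:E * F (colt t))%E.
  apply: emeasurable_funM => //; apply/measurable_EFinP.
  apply: measurable_gauss_den; apply: measurable_colD; last exact: measurable_col_cst.
  exact: measurable_col_colt.
rewrite (@ge0_integral_lower_trig _ N L m
  (fun y => (gauss_den (L *m L^T) (y - m))%:E * F y)%E)//; last first.
  by move=> y; rewrite mule_ge0// lee_fin gauss_den_ge0.
have mh : measurable_col (fun t : N.-tuple R => L *m colt t + m).
  apply: measurable_colD; last exact: measurable_col_cst.
  by apply: measurable_col_mulmx; exact: measurable_col_colt.
rewrite -ge0_integralZl_EFin//.
- apply: eq_integral => t _; rewrite addrK muleA -EFinM.
  by rewrite gauss_den_cholesky.
- by move=> t _; rewrite mule_ge0// lee_fin gauss_den_ge0.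
- exact: (@measurable_comp_col _ _ _ _ N
    (fun y => (gauss_den (L *m L^T) (y - m))%:E * F y)%E _ mG mh).
Qed.

Lemma integral_gauss_den N (S : 'M[R]_N) (m : 'cV[R]_N) : posdef S ->
  (\int[lebn R N]_t (gauss_den S (colt t - m))%:E = 1)%E.
Proof.
move=> /cholesky[L [trigL L0 ->]].
have := @ge0_integral_gauss_den N L m (fun=> 1%E) trigL L0 _ _.
under eq_integral do rewrite mule1.
move=> ->//; last exact: measurable_cst.
by under eq_integral do rewrite mule1; exact: integral_std_gauss.
Qed.

(** A joint density written as conditional times marginal: [complete_square] matches the exponents
    and [det_square_sum] the normalising factors. *)
Lemma gauss_den_mul N (S T E : 'M[R]_N) (y z : 'cV[R]_N) :
  posdef S -> posdef T -> E \in unitmx ->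
  let H := invmx S + E^T *m invmx T *m E in
  gauss_den S y * gauss_den T (z - E *m y) =
  gauss_den (invmx H) (y - invmx H *m E^T *m invmx T *m z) *
  gauss_den (T + E *m S *m E^T) z.
Proof.
move=> pS pT uE H; rewrite /gauss_den; set c := _ `^ _.
have dS := posdef_det_gt0 pS; have dT := posdef_det_gt0 pT.
have pH := posdef_square_sum pS pT uE; have dH := posdef_det_gt0 pH.
have dW := posdef_det_gt0 (posdef_square_out pS pT uE).
have E4 (a b u v : R) : c * a * expR (- (u / 4)) * (c * b * expR (- (v / 4))) =
    c * c * (a * b) * expR (- ((u + v) / 4)).
  by rewrite mulrDl opprD expRD; ring.
rewrite !E4.
rewrite (complete_square pS pT uE) invmxK; congr (_ * _ * _).
rewrite -!powRM ?ltW// ?det_inv ?invr_gt0//; congr (_ `^ _).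
rewrite (det_square_sum pS pT uE).
by field; rewrite !gt_eqF.
Qed.

(** After translation by [a], [gauss_den_mul] pulls out a factor independent of the integration
    variable, and the remaining conditional density has mass 1. *)
Lemma chapman_kolmogorov N (S T E : 'M[R]_N) (a z : 'cV[R]_N) :
  posdef S -> posdef T -> E \in unitmx ->
  (\int[lebn R N]_t ((gauss_den S (colt t - a))%:E * (gauss_den T (z - E *m colt t))%:E) =
   (gauss_den (T + E *m S *m E^T) (z - E *m a))%:E)%E.
Proof.
move=> pS pT uE.
have pH := posdef_square_sum pS pT uE; set H := invmx S + _ in pH.
pose F (y : 'cV[R]_N) : \bar R :=
  ((gauss_den S (y - a))%:E * (gauss_den T (z - E *m y))%:E)%E.
have mc := @measurable_col_colt _ _ N _ (@measurable_id _ (N.-tuple R) setT).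
have mF : measurable_fun setT (F \o @colt R N).
  apply: emeasurable_funM; apply/measurable_EFinP; apply: measurable_gauss_den.
    by apply: measurable_colD => //; exact: measurable_col_cst.
  apply: measurable_colD; first exact: measurable_col_cst.
  by apply: measurable_colN; exact: measurable_col_mulmx.
rewrite [LHS](@ge0_integral_colt_addr _ N a F)// => [|y]; last first.
  by rewrite mule_ge0// lee_fin gauss_den_ge0.
set c := invmx H *m E^T *m invmx T *m (z - E *m a).
transitivity (\int[lebn R N]_t ((gauss_den (invmx H) (colt t - c))%:E *
    (gauss_den (T + E *m S *m E^T) (z - E *m a))%:E))%E.
  apply: eq_integral => t _; rewrite /F addrK -!EFinM; congr _%:E.
  rewrite -gauss_den_mul//; congr (_ * gauss_den _ _).
  by rewrite mulmxDr opprD addrA addrAC.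
rewrite ge0_integralZr//.
- by rewrite integral_gauss_den ?mul1e//; exact: posdef_inv.
- apply/measurable_EFinP; apply: measurable_gauss_den.
  by apply: measurable_colD => //; exact: measurable_col_cst.
- by move=> t _; rewrite lee_fin gauss_den_ge0.
- by rewrite lee_fin gauss_den_ge0.
Qed.

End gaussian_density.

(** * Gaussian averages *)

Section weighted_average.
Context d (T : measurableType d) (R : realType) (m : {measure set T -> \bar R}).
Variable w : T -> R.
Hypotheses (w_ge0 : forall t, 0 <= w t) (mw : measurable_fun setT w).
Hypothesis w1 : (\int[m]_t (w t)%:E = 1)%E.
Implicit Types (f g : T -> R) (M : R).

Lemma integrable_weight : m.-integrable setT (EFin \o w).
Proof.
apply/integrableP; split; first exact/measurable_EFinP.
rewrite (eq_integral (fun t => (w t)%:E)) ?w1 ?ltry// => t _ /=.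
by rewrite ger0_norm.
Qed.

Lemma integrable_weighted f M : measurable_fun setT f -> (forall t, `|f t| <= M) ->
  m.-integrable setT (fun t => (w t * f t)%:E).
Proof.
move=> mf fM; have iw : m.-integrable setT (fun t => (M * w t)%:E).
  by apply: (eq_integrable measurableT (fun t => M%:E * (EFin \o w) t)%E) => //;
    exact: integrableZl integrable_weight.
apply: le_integrable iw => //.
  by apply/measurable_EFinP; exact: measurable_funM.
move=> t _ /=; rewrite lee_fin !normrM (ger0_norm (w_ge0 t)) mulrC ler_wpM2r//.
by rewrite (le_trans (fM t))// ler_norm.
Qed.

Lemma weighted_cst c : \int[m]_t (w t * c) = c.
Proof.
rewrite RintegralZr//; last exact: integrable_weight.
by rewrite /Rintegral w1 mul1r.
Qed.

Lemma weighted_bound f M : measurable_fun setT f -> (forall t, `|f t| <= M) ->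
  `|\int[m]_t (w t * f t)| <= M.
Proof.
move=> mf fM; have iF := integrable_weighted mf fM.
apply: (le_trans (le_normr_Rintegral measurableT iF)).
rewrite -[leRHS]weighted_cst; apply: le_Rintegral => //.
- exact: integrable_norm.
- apply: (@integrable_weighted (fun=> M) `|M|) => //; exact: measurable_cst.
- by move=> t _; rewrite normrM (ger0_norm (w_ge0 t)) ler_wpM2l.
Qed.

(** Adding [M] makes the integrand nonnegative and changes the average by exactly [M]. This
    transfers the substitution rules for nonnegative functions to bounded signed ones. *)
Lemma weighted_ge0E f M : measurable_fun setT f -> (forall t, `|f t| <= M) ->
  (\int[m]_t (w t * f t))%:E = (\int[m]_t ((w t)%:E * (f t + M)%:E) - M%:E)%E.
Proof.
move=> mf fM; rewrite -[M in (- M%:E)%E]weighted_cst /Rintegral.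
have iF := integrable_weighted mf fM.
have iM : m.-integrable setT (fun t => (w t * M)%:E).
  by apply: (@integrable_weighted (fun=> M) `|M|) => //; exact: measurable_cst.
rewrite !fineK; first last.
- exact: integrable_fin_num.
- exact: integrable_fin_num.
have -> : (\int[m]_t ((w t)%:E * (f t + M)%:E) =
    \int[m]_t ((w t * f t)%:E + (w t * M)%:E))%E.
  by apply: eq_integral => t _; rewrite -EFinM mulrDr.
rewrite integralD//= addeK//; exact: integrable_fin_num.
Qed.

End weighted_average.

(** * Composition and small-variance expansion of Gaussian averages *)

Section gaussian_average.
Variable R : realType.
Implicit Types N : nat.

Definition gavg N (S : 'M[R]_N) (f : 'cV[R]_N -> R) (a : 'cV[R]_N) : R :=
  \int[lebn R N]_t (gauss_den S (colt t - a) * f (colt t)).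

Definition bounded_by N (f : 'cV[R]_N -> R) M :=
  measurable_fun setT (fun t : N.-tuple R => f (colt t)) /\ forall x, `|f x| <= M.

Let mcolt N := @measurable_col_colt R _ _ N _ (@measurable_id _ (N.-tuple R) setT).

Let mden N (S : 'M[R]_N) a :
  measurable_fun setT (fun t : N.-tuple R => gauss_den S (colt t - a)).
Proof.
by apply: measurable_gauss_den; apply: measurable_colD.
Qed.

Lemma gavg_integrable N (S : 'M[R]_N) f M a : posdef S -> bounded_by f M ->
  (lebn R N).-integrable setT (fun t => (gauss_den S (colt t - a) * f (colt t))%:E).
Proof.
move=> pS [mf fM].
apply: (integrable_weighted _ _ (integral_gauss_den a pS) mf (fun t => fM _)) => [t|].
  exact: gauss_den_ge0.
exact: mden.
Qed.

Lemma gavg_bound N (S : 'M[R]_N) f M a : posdef S -> bounded_by f M ->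
  `|gavg S f a| <= M.
Proof.
move=> pS [mf fM].
apply: (weighted_bound _ _ (integral_gauss_den a pS) mf (fun t => fM _)) => [t|].
  exact: gauss_den_ge0.
exact: mden.
Qed.

Lemma gavg_std N (L : 'M[R]_N) f M a : is_trig_mx L -> (forall i, 0 < L i i) ->
  posdef (L *m L^T) -> bounded_by f M ->
  gavg (L *m L^T) f a =
  \int[lebn R N]_t (std_gauss (colt t) * f (L *m colt t + a)).
Proof.
move=> trigL L0 pS [mf fM].
have mfa : measurable_fun setT (fun t : N.-tuple R => f (L *m colt t + a)).
  apply: (measurable_comp_col mf); apply: measurable_colD; last exact: measurable_col_cst.
  exact: measurable_col_mulmx.
apply: EFin_inj.
rewrite /gavg (weighted_ge0E (fun t => gauss_den_ge0 _ _) (mden _ a)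
  (integral_gauss_den a pS) mf (fun t => fM _)).
rewrite (weighted_ge0E (fun t => std_gauss_ge0 (colt t)) (@measurable_std_gauss R N)
  (integral_std_gauss R N) mfa (fun t => fM _)).
rewrite (@ge0_integral_gauss_den _ N L a (fun y => (f y + M)%:E))//.
  by apply/measurable_EFinP; apply: measurable_funD.
move=> x; rewrite lee_fin -lerBlDr sub0r; have := fM x.
by rewrite ler_norml => /andP[].
Qed.

Lemma std_gauss_opp N (z : 'cV[R]_N) : std_gauss (- z) = std_gauss z.
Proof.
by rewrite /std_gauss !qform1; congr (_ * expR (- (_ * _)));
  apply: eq_bigr => i _; rewrite mxE sqrrN.
Qed.

Lemma integral_std_gauss_opp N (f : 'cV[R]_N -> R) M : bounded_by f M ->
  \int[lebn R N]_t (std_gauss (colt t) * f (colt t)) =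
  \int[lebn R N]_t (std_gauss (colt t) * f (- colt t)).
Proof.
move=> [mf fM].
have mfN : measurable_fun setT (fun t : N.-tuple R => f (- colt t)).
  by apply: (measurable_comp_col mf); exact: measurable_colN.
have m1 := @measurable_std_gauss R N.
apply: EFin_inj.
rewrite (weighted_ge0E (fun t => std_gauss_ge0 (colt t)) m1
  (integral_std_gauss R N) mf (fun t => fM _)).
rewrite (weighted_ge0E (fun t => std_gauss_ge0 (colt t)) m1
  (integral_std_gauss R N) mfN (fun t => fM _)).
rewrite (@ge0_integral_colt_opp _ N (fun y => (std_gauss y)%:E * (f y + M)%:E)%E).
- apply: (congr1 (fun x => x - M%:E)%E).
  by apply: eq_integral => t _; rewrite std_gauss_opp.
- apply: emeasurable_funM; apply/measurable_EFinP => //.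
  exact: measurable_funD.
move=> x; rewrite mule_ge0// lee_fin ?std_gauss_ge0// -lerBlDr sub0r; have := fM x.
by rewrite ler_norml => /andP[].
Qed.

Lemma measurable_gavg d (T : measurableType d) N (S : 'M[R]_N) f
    (h : T -> 'cV[R]_N) :
  measurable_fun setT (fun t : N.-tuple R => f (colt t)) -> measurable_col h ->
  measurable_fun setT (fun x => gavg S f (h x)).
Proof.
move=> mf mh; apply: (@measurable_parametric_Rintegral _ _ _ _ _ (lebn R N)
  (fun p => gauss_den S (colt p.2 - h p.1) * f (colt p.2))).
apply: measurable_funM; last exact: measurableT_comp mf measurable_snd.
apply: measurable_gauss_den; apply: measurable_colD.
  exact: measurable_col_colt.
by apply: measurable_colN => i; exact: measurableT_comp (mh i) measurable_fst.
Qed.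

(** Fubini, legitimate because the integrand is dominated by M times a joint probability density;
    the integral over the intermediate point is then [chapman_kolmogorov]. *)
Lemma gavg_gavg N (S T E : 'M[R]_N) f M a : posdef S -> posdef T -> E \in unitmx ->
  bounded_by f M ->
  gavg S (fun y => gavg T f (E *m y)) a = gavg (T + E *m S *m E^T) f (E *m a).
Proof.
move=> pS pT uE [mf fM]; have pW := posdef_square_out pS pT uE.
pose H (p : N.-tuple R * N.-tuple R) :=
  gauss_den S (colt p.1 - a) * (gauss_den T (colt p.2 - E *m colt p.1) * f (colt p.2)).
have mS1 : measurable_fun setT (fun p : N.-tuple R * N.-tuple R => gauss_den S (colt p.1 - a)).
  exact: (measurableT_comp (mden S a) measurable_fst).
have mT1 : measurable_fun setT (fun p : N.-tuple R * N.-tuple R =>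
    gauss_den T (colt p.2 - E *m colt p.1)).
  apply: measurable_gauss_den; apply: measurable_colD; first exact: measurable_col_colt.
  apply: measurable_colN; apply: measurable_col_mulmx; exact: measurable_col_colt.
have mf1 : measurable_fun setT (fun p : N.-tuple R * N.-tuple R => f (colt p.2)).
  exact: (measurableT_comp mf measurable_snd).
have mH : measurable_fun setT H by do 2 apply: measurable_funM => //.
have iT y : (lebn R N).-integrable setT
    (fun t => (gauss_den T (colt t - E *m y) * f (colt t))%:E).
  by apply: gavg_integrable.
have iH : (lebn R N \x lebn R N)%E.-integrable setT (EFin \o H).
  apply/integrable12ltyP; first exact/measurable_EFinP.
  apply: (@le_lt_trans _ _ (\int[lebn R N]_y (gauss_den S (colt y - a) * M)%:E)%E).
    apply: ge0_le_integral => //.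
    - by move=> y _; apply: integral_ge0.
    - apply: (@measurable_fun_fubini_tonelli_F _ _ _ _ _ _ (abse \o (EFin \o H))).
        by apply: measurableT_comp => //; exact/measurable_EFinP.
      by move=> p; exact: abse_ge0.
    - by apply/measurable_EFinP; apply: measurable_funM => //; exact: mden.
    move=> y _ /=.
    apply: (@le_trans _ _ (\int[lebn R N]_z ((gauss_den S (colt y - a) * M)%:E *
        (gauss_den T (colt z - E *m colt y))%:E))%E).
      have M0 : 0 <= M by rewrite (le_trans _ (fM 0)).
      apply: ge0_le_integral => //.
      - apply/measurable_EFinP; apply: measurableT_comp => //.
        exact: (measurable_fun_pair2 y mH).
      - apply: emeasurable_funM; first exact: measurable_cst.
        apply/measurable_EFinP; exact: mden.
      - move=> z _; rewrite /H /= lee_fin normrM (ger0_norm (gauss_den_ge0 S _)).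
        rewrite normrM (ger0_norm (gauss_den_ge0 T _)).
        by rewrite -[leRHS]mulrA ler_wpM2l ?gauss_den_ge0// mulrC ler_wpM2r ?gauss_den_ge0.
    rewrite ge0_integralZl_EFin//.
    - by rewrite integral_gauss_den// mule1.
    - by move=> z _; rewrite lee_fin gauss_den_ge0.
    - by apply/measurable_EFinP; exact: mden.
    - by rewrite mulr_ge0 ?gauss_den_ge0// (le_trans _ (fM 0)).
  under eq_integral do rewrite mulrC EFinM.
  rewrite ge0_integralZl_EFin//.
  - by rewrite integral_gauss_den// mule1 ltry.
  - by move=> z _; rewrite lee_fin gauss_den_ge0.
  - by apply/measurable_EFinP; exact: mden.
  - by rewrite (le_trans _ (fM 0)).
rewrite /gavg /Rintegral; congr fine.
transitivity (\int[lebn R N]_y \int[lebn R N]_z (H (y, z))%:E)%E.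
  apply: eq_integral => y _; rewrite /H/= EFinM fineK; last exact: integrable_fin_num.
  by rewrite -integralZl.
rewrite (Fubini iH); apply: eq_integral => z _.
rewrite EFinM -chapman_kolmogorov//.
have iz : (lebn R N).-integrable setT (fun y =>
    ((gauss_den S (colt y - a))%:E * (gauss_den T (colt z - E *m colt y))%:E)%E).
  apply/integrableP; split.
    apply: emeasurable_funM; apply/measurable_EFinP; first exact: mden.
    exact: (measurable_fun_pair1 z mT1).
  under eq_integral do rewrite gee0_abs ?mule_ge0 ?lee_fin ?gauss_den_ge0//.
  by rewrite chapman_kolmogorov// ltry.
rewrite -integralZr//; apply: eq_integral => y _.
by rewrite /H /= !EFinM muleA.
Qed.

(** Lagrange's identity: the double sum of (a_i b_j - a_j b_i)^2 is twice the gap between the two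
    sides. *)
Lemma sum_sqr_cauchy_schwarz n (a b : 'I_n -> R) :
  (\sum_i a i * b i) ^+ 2 <= (\sum_i a i ^+ 2) * (\sum_i b i ^+ 2).
Proof.
have : 0 <= \sum_i \sum_j (a i * b j - a j * b i) ^+ 2.
  by apply: sumr_ge0 => i _; apply: sumr_ge0 => j _; exact: sqr_ge0.
have -> : \sum_i \sum_j (a i * b j - a j * b i) ^+ 2 =
    \sum_i \sum_j (a i ^+ 2 * b j ^+ 2) + \sum_i \sum_j (b i ^+ 2 * a j ^+ 2) -
    2 * \sum_i \sum_j (a i * b i * (a j * b j)).
  rewrite mulr_sumr -big_split -sumrB; apply: eq_bigr => i _.
  rewrite mulr_sumr -big_split -sumrB; apply: eq_bigr => j _.
  by rewrite /=; ring.
have D (f g : 'I_n -> R) : \sum_i \sum_j (f i * g j) = (\sum_i f i) * (\sum_i g i).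
  by rewrite big_distrlr.
rewrite !D expr2.
move: (\sum_i a i * b i) (\sum_i a i ^+ 2) (\sum_i b i ^+ 2) => A B C.
by lra.
Qed.

Lemma qform1_mulmx_le N (L : 'M[R]_N) z :
  qform 1%:M (L *m z) <= \tr (L *m L^T) * qform 1%:M z.
Proof.
rewrite !qform1 /mxtrace mulr_suml; apply: ler_sum => i _; rewrite mxE.
apply: le_trans (sum_sqr_cauchy_schwarz _ _) _; apply: ler_wpM2r.
  by apply: sumr_ge0 => j _; exact: sqr_ge0.
by rewrite mxE; apply: ler_sum => j _; rewrite mxE expr2.
Qed.

(** An upper bound is enough. From q / 8 <= e^(q/8) follows q e^(-q/4) <= 8 e^(-q/8), and the right
    side is again a Gaussian integral. *)
Lemma std_gauss_second_moment N : exists c : R, 0 <= c /\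
  (\int[lebn R N]_t (std_gauss (colt t) * qform 1%:M (colt t))%:E <= c%:E)%E.
Proof.
have pi4 : (0 : R) <= (4 * pi) `^ (- (N%:R / 2)) by exact: powR_ge0.
exists ((4 * pi) `^ (- (N%:R / 2)) * 8 * Num.sqrt (pi / 8^-1) ^+ N).
split; first by rewrite !mulr_ge0// exprn_ge0// sqrtr_ge0.
rewrite EFinM -integral_gauss_colt ?invr_gt0//.
rewrite -ge0_integralZl_EFin ?mulr_ge0//; last first.
  by apply/measurable_EFinP; exact: measurable_gauss_fun_colt.
apply: ge0_le_integral => //.
- by move=> t _; rewrite lee_fin mulr_ge0 ?std_gauss_ge0// qform1 sumr_ge0// => i _;
    exact: sqr_ge0.
- apply/measurable_EFinP; apply: measurable_funM; first exact: measurable_std_gauss.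
  exact: measurable_qform.
- apply: emeasurable_funM; first exact: measurable_cst.
  by apply/measurable_EFinP; exact: measurable_gauss_fun_colt.
move=> t _; rewrite -EFinM lee_fin /std_gauss; set q := qform _ _.
rewrite -!mulrA ler_wpM2l//.
have -> : expR (- (4^-1 * q)) = expR (- (8^-1 * q)) * expR (- (8^-1 * q)).
  by rewrite -expRD; congr expR; field.
rewrite mulrC mulrA mulrC [8 * _]mulrC ler_wpM2l ?expR_ge0//.
have := expR_ge1Dx (8^-1 * q).
have := expR_gt0 (8^-1 * q); rewrite expRN.
set e := expR _ => e0 e1.
by rewrite ler_pdivrMr//; lra.
Qed.

(** Averaging over z and -z turns twice the error into the mean of a second difference, so no
    first-order term appears. It is bounded by C |L z|^2, whose mean is controlled by tr(L L^T) = tr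
    S. The constant depends on the dimension only. *)
Lemma gavg_second_difference N : exists c : R, 0 <= c /\
  forall (S : 'M[R]_N) f M C a, posdef S -> bounded_by f M ->
  0 <= C -> (forall z, `|f (a + z) + f (a - z) - 2 * f a| <= C * qform 1%:M z) ->
  `|gavg S f a - f a| <= c * C * \tr S.
Proof.
have [c [c0 Hc]] := std_gauss_second_moment N.
exists c; split=> // S f M C a /[dup] pS /cholesky[L [trigL L0 SE]] [mf fM] C0 fC.
rewrite SE in pS *.
have bL : bounded_by (fun y => f (L *m y + a)) M.
  split=> //; apply: (measurable_comp_col mf); apply: measurable_colD; last exact: measurable_col_cst.
  exact: measurable_col_mulmx.
have bLN : bounded_by (fun y => f (- (L *m y) + a)) M.
  split=> //; apply: (measurable_comp_col mf); apply: measurable_colD; last exact: measurable_col_cst.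
  by apply: measurable_colN; exact: measurable_col_mulmx.
have m1 := @measurable_std_gauss R N.
have g0 (t : N.-tuple R) := std_gauss_ge0 (colt t).
have iL := integrable_weighted g0 m1 (integral_std_gauss R N) bL.1 (fun t => bL.2 _).
have iLN := integrable_weighted g0 m1 (integral_std_gauss R N) bLN.1 (fun t => bLN.2 _).
have mc : measurable_fun setT (fun t : N.-tuple R => 2 * f a) by exact: measurable_cst.
have ifa := integrable_weighted g0 m1 (integral_std_gauss R N) mc (fun t => lexx _).
have E : 2 * (gavg (L *m L^T) f a - f a) = \int[lebn R N]_t (std_gauss (colt t) *
    (f (a + L *m colt t) + f (a - L *m colt t) - 2 * f a)).
  have G1 := gavg_std a trigL L0 pS (conj mf fM).
  have G2 : gavg (L *m L^T) f a =
      \int[lebn R N]_t (std_gauss (colt t) * f (- (L *m colt t) + a)).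
    rewrite G1 (integral_std_gauss_opp bL); apply: eq_Rintegral => t _.
    by rewrite mulmxN.
  have -> : 2 * (gavg (L *m L^T) f a - f a) =
      gavg (L *m L^T) f a + gavg (L *m L^T) f a - 2 * f a by ring.
  rewrite {1}G1 G2.
  rewrite -[X in _ - X](weighted_cst g0 m1 (integral_std_gauss R N)).
  rewrite -RintegralD// -RintegralB//; last exact: integrableD iL iLN.
  apply: eq_Rintegral => t _; rewrite (addrC (L *m _)) (addrC (- _)).
  by rewrite mulrBr mulrDr.
have mD : measurable_fun setT (fun t : N.-tuple R =>
    f (a + L *m colt t) + f (a - L *m colt t) - 2 * f a).
  under eq_fun do rewrite (addrC a) (addrC a).
  by apply: measurable_funB => //; apply: measurable_funD; [exact: bL.1|exact: bLN.1].
have bD (t : N.-tuple R) :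
    `|f (a + L *m colt t) + f (a - L *m colt t) - 2 * f a| <= 4 * M.
  apply: le_trans (ler_normB _ _) _; rewrite normrM ger0_norm//.
  have := ler_normD (f (a + L *m colt t)) (f (a - L *m colt t)).
  have := fM (a + L *m colt t); have := fM (a - L *m colt t); have := fM a.
  by move: (`|f a|) => *; lra.
have iD := integrable_weighted g0 m1 (integral_std_gauss R N) mD bD.
have tr0 : 0 <= \tr (L *m L^T).
  by apply: sumr_ge0 => i _; rewrite mxE; apply: sumr_ge0 => j _; rewrite mxE -expr2 sqr_ge0.
have : `|2 * (gavg (L *m L^T) f a - f a)| <= c * C * \tr (L *m L^T).
  rewrite E -lee_fin EFin_normr_Rintegral//.
  apply: le_trans (le_abse_integral _ measurableT (measurable_int _ iD)) _.
  apply: (@le_trans _ _ (\int[lebn R N]_t ((C * \tr (L *m L^T))%:E *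
      (std_gauss (colt t) * qform 1%:M (colt t))%:E))%E).
    apply: ge0_le_integral => //.
    - apply/measurable_EFinP; apply: measurableT_comp => //; exact: measurable_funM.
    - apply: emeasurable_funM; first exact: measurable_cst.
      by apply/measurable_EFinP; apply: measurable_funM => //; exact: measurable_qform.
    move=> t _ /=; rewrite lee_fin normrM (ger0_norm (g0 t)) mulrCA ler_wpM2l//.
    by rewrite (le_trans (fC _))// -mulrA ler_wpM2l// qform1_mulmx_le.
  rewrite ge0_integralZl_EFin//.
  - rewrite -mulrA (mulrC c) [leRHS]EFinM; apply: lee_wpmul2l => //.
    by rewrite lee_fin mulr_ge0.
  - by move=> t _; rewrite lee_fin mulr_ge0// qform1 sumr_ge0// => i _; exact: sqr_ge0.
  - by apply/measurable_EFinP; apply: measurable_funM => //; exact: measurable_qform.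
  - by rewrite mulr_ge0.
rewrite normrM ger0_norm// mulr_natl mulr2n; apply: le_trans.
by rewrite lerDl.
Qed.

End gaussian_average.

Lemma cvg_sumr (R : realType) (T I : Type) (F : set_system T) (FF : Filter F)
    (r : seq I) (f : I -> T -> R) (l : I -> R) :
  (forall i, f i x @[x --> F] --> l i) ->
  (\sum_(i <- r) f i x) @[x --> F] --> \sum_(i <- r) l i.
Proof.
move=> fl; elim: r => [|i r IH].
  by rewrite big_nil; under eq_fun do rewrite big_nil; exact: cvg_cst.
by rewrite big_cons; under eq_fun do rewrite big_cons; exact: cvgD (fl i) IH.
Qed.

Lemma cvg_mx_entrywise (R : realType) (T : Type) (F : set_system T) (FF : Filter F) m n
    (f : T -> 'M[R]_(m, n)) (l : 'M[R]_(m, n)) :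
  (forall i j, f x i j @[x --> F] --> l i j) -> f x @[x --> F] --> l.
Proof.
move=> fl A [P lP sPA].
have H : \forall x \near F, forall i j, P i j (f x i j).
  apply: (@filter_forall _ _ (fun i x => forall j, P i j (f x i j))) => i.
  apply: (@filter_forall _ _ (fun j x => P i j (f x i j))) => j.
  exact: (fl i j _ (lP i j)).
by apply: filterS H => x; exact: sPA.
Qed.

(** * Matrix exponential and covariance *)

Section matrix_exponential.
Variables (R : realType) (N : nat).
Implicit Types (B C D : 'M[R]_N) (t : R).

Lemma exprZmx B t k : (t *: B) ^+ k = t ^+ k *: B ^+ k.
Proof.
elim: k => [|k IH]; first by rewrite !expr0 scale1r.
rewrite !exprS IH -[LHS]/(_ *m _) -[B * _]/(B *m _).
by rewrite -scalemxAl -scalemxAr scalerA.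
Qed.

Definition mxsum_norm (C : 'M[R]_N) := \sum_i \sum_j `|C i j|.

Lemma mxsum_norm_ge0 C : 0 <= mxsum_norm C.
Proof. by apply: sumr_ge0 => i _; apply: sumr_ge0. Qed.

Lemma row_le_mxsum_norm C i : \sum_j `|C i j| <= mxsum_norm C.
Proof.
rewrite /mxsum_norm [leRHS](bigD1 i)//= lerDl.
by apply: sumr_ge0 => k _; apply: sumr_ge0.
Qed.

Lemma mulmx_entry_le C D d : (forall i j, `|D i j| <= d) ->
  forall i j, `|(C *m D) i j| <= mxsum_norm C * d.
Proof.
move=> Dd i j; rewrite mxE; apply: le_trans (ler_norm_sum _ _ _) _.
apply: (@le_trans _ _ (\sum_k `|C i k| * d)).
  by apply: ler_sum => k _; rewrite normrM ler_wpM2l.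
rewrite -mulr_suml ler_wpM2r ?row_le_mxsum_norm//.
by apply: le_trans (Dd i j).
Qed.

Lemma exprmx_entry_le B k i j : `|(B ^+ k) i j| <= mxsum_norm B ^+ k.
Proof.
elim: k i j => [|k IH] i j.
  by rewrite !expr0 mxE; case: eqP; rewrite ?normr1 ?normr0.
by rewrite !exprS; exact: mulmx_entry_le.
Qed.

(** Power series coefficients, in t, of the entry (i, j) of C e^(tB) D. With the constant factors
    included, differentiation just replaces C by C B, so the scalar theorem on power series applies
    to every product that occurs. *)
Definition expmx_coeff B C D i j : R ^nat :=
  fun k => (k`!%:R)^-1 * (C *m B ^+ k *m D) i j.

Lemma expmx_coeff_diffs B C D i j :
  pseries_diffs (expmx_coeff B C D i j) = expmx_coeff B (C *m B) D i j.
Proof.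
apply/funext => k; rewrite /pseries_diffs /expmx_coeff mulrA factS natrM invfM.
rewrite mulVKf// exprS -[B * _]/(B *m _); congr (_ * _).
by rewrite !mulmxA.
Qed.

Lemma is_cvg_expmx_coeff B C D i j t : cvgn (pseries (expmx_coeff B C D i j) t).
Proof.
apply: normed_cvg.
pose g := mxsum_norm C * mxsum_norm D.
pose b := mxsum_norm B * `|t|.
have g0 : 0 <= g by rewrite mulr_ge0// mxsum_norm_ge0.
have b0 : 0 <= b by rewrite mulr_ge0// mxsum_norm_ge0.
apply: (@series_le_cvg _ _ (fun k => g * exp_coeff b k)) => //.
- by move=> k; exact: normr_ge0.
- by move=> k /=; rewrite mulr_ge0// /exp_coeff divr_ge0// exprn_ge0.
- move=> k /=; rewrite /expmx_coeff /exp_coeff /= !normrM normrX ger0_norm ?invr_ge0//.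
  have -> : g * (b ^+ k / k`!%:R) = k`!%:R^-1 * (g * mxsum_norm B ^+ k) * `|t| ^+ k.
    by rewrite /b exprMn; ring.
  rewrite ler_wpM2r ?exprn_ge0// ler_wpM2l ?invr_ge0//.
  have h1 i' j' : `|(C *m B ^+ k) i' j'| <= mxsum_norm C * mxsum_norm B ^+ k.
    by apply: mulmx_entry_le => *; exact: exprmx_entry_le.
  (* Transposition turns right multiplication by [D] into left multiplication by [D^T], so
     [mulmx_entry_le] serves a second time. *)
  rewrite -[_ *m D]trmxK trmx_mul mxE /g mulrAC mulrC.
  have -> : mxsum_norm D = mxsum_norm D^T.
    rewrite /mxsum_norm exchange_big; apply: eq_bigr => p _.
    by apply: eq_bigr => q _; rewrite mxE.
  by apply: mulmx_entry_le => p q; rewrite mxE.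
rewrite (_ : series _ = g *: (series (exp_coeff b) : R^o ^nat)).
  by apply: is_cvgZr; exact: is_cvg_series_exp_coeff.
apply/funext => n; rewrite /series /=.
by rewrite -[RHS]/(g * \sum_(0 <= k < n) exp_coeff b k) mulr_sumr.
Qed.

Lemma cvg_expmx_entry B t i j :
  (fun n => (\sum_(k < n) (k`!%:R)^-1 *: (t *: B) ^+ k) i j) @ \oo -->
  expmx (t *: B) i j.
Proof.
pose F n := \sum_(k < n) (k`!%:R)^-1 *: (t *: B) ^+ k.
have FE p q : (fun n => F n p q) = pseries (expmx_coeff B 1%:M 1%:M p q) t.
  apply/funext => n; rewrite /pseries /series/= big_mkord summxE.
  apply: eq_bigr => k _; rewrite exprZmx /expmx_coeff mul1mx mulmx1 !mxE.
  by rewrite mulrCA mulrC.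
have -> : expmx (t *: B) =
    \matrix_(p, q) limn (pseries (expmx_coeff B 1%:M 1%:M p q) t).
  apply/cvg_lim => //; apply: cvg_mx_entrywise => p q.
  by rewrite mxE [X in X @ _ --> _]FE; exact: is_cvg_expmx_coeff.
by rewrite mxE [X in X @ _ --> _]FE; exact: is_cvg_expmx_coeff.
Qed.

Lemma mulmx_expmx_entry B C D t i j :
  (C *m expmx (t *: B) *m D) i j = limn (pseries (expmx_coeff B C D i j) t).
Proof.
apply/esym/cvg_lim => //.
rewrite (_ : pseries _ _ = fun n => \sum_q (\sum_p
    C i p * (\sum_(k < n) (k`!%:R)^-1 *: (t *: B) ^+ k) p q) * D q j).
  rewrite mxE; apply: cvg_sumr => q; apply: cvgM; last exact: cvg_cst.
  rewrite mxE; apply: cvg_sumr => p; apply: cvgM; first exact: cvg_cst.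
  exact: cvg_expmx_entry.
apply/funext => n.
transitivity ((C *m (\sum_(k < n) (k`!%:R)^-1 *: (t *: B) ^+ k) *m D) i j); last first.
  by rewrite mxE; apply: eq_bigr => q _; rewrite mxE.
rewrite mulmx_sumr mulmx_suml summxE /pseries /series /= big_mkord.
apply: eq_bigr => k _; rewrite exprZmx -!(scalemxAl, scalemxAr) !mxE /expmx_coeff mxE.
by rewrite mulrCA mulrC mulrA.
Qed.

Lemma is_derive_mulmx_expmx B C D t i j :
  is_derive t 1 (fun r => (C *m expmx (r *: B) *m D) i j)
    ((C *m B *m expmx (t *: B) *m D) i j).
Proof.
rewrite (_ : (fun r => _) = fun r => limn (pseries (expmx_coeff B C D i j) r)).
  rewrite mulmx_expmx_entry -expmx_coeff_diffs.
  apply: (@pseries_snd_diffs _ _ (`|t| + 1)).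
  - exact: is_cvg_expmx_coeff.
  - by rewrite expmx_coeff_diffs; exact: is_cvg_expmx_coeff.
  - by rewrite !expmx_coeff_diffs; exact: is_cvg_expmx_coeff.
  - by rewrite [ltRHS]ger0_norm ?addr_ge0// ltrDl.
by apply/funext => r; rewrite mulmx_expmx_entry.
Qed.

Lemma expmx_comm B t : B *m expmx (t *: B) = expmx (t *: B) *m B.
Proof.
apply/matrixP => i j.
rewrite -[B *m expmx _]mulmx1 -[expmx _ *m B]mul1mx mulmxA.
rewrite !mulmx_expmx_entry; congr (limn (pseries _ _)).
apply/funext => k; rewrite /expmx_coeff mulmx1 mul1mx.
by rewrite -[B *m _]/(B * _) -[_ *m B]/(_ * B) -exprS -exprSr.
Qed.

Lemma expmx0 B : expmx (0 *: B) = 1%:M.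
Proof.
apply/matrixP => i j; have := mulmx_expmx_entry B 1%:M 1%:M 0 i j.
rewrite mul1mx mulmx1 => ->; apply/cvg_lim => //.
apply: cvg_near_cst.
exists 1%N => // n /= n1; rewrite /pseries /series /=.
rewrite big_ltn// big_nat big1 ?addr0; last first.
  by move=> k /andP[k0 _]; rewrite expr0n gtn_eqF// mulr0.
by rewrite /expmx_coeff !expr0 invr1 !mul1r mulr1 mul1mx mulmx1.
Qed.

Lemma is_derive_expmx B t i j :
  is_derive t 1 (fun r => expmx (r *: B) i j) ((B *m expmx (t *: B)) i j).
Proof.
have := is_derive_mulmx_expmx B 1%:M 1%:M t i j.
rewrite mul1mx mulmx1; congr is_derive.
by apply/funext => r; rewrite mul1mx mulmx1.
Qed.

Lemma is_derive_expmx_shift B s t i j :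
  is_derive t 1 (fun r => expmx ((r + s) *: B) i j) ((B *m expmx ((t + s) *: B)) i j).
Proof.
have d1 := is_derive_expmx B (t + s) i j.
have d2 : is_derive t 1 (fun r : R => r + s) 1.
  by apply: is_derive_eq; rewrite addr0.
have := @is_derive1_comp _ (fun r => expmx (r *: B) i j) (fun r => r + s) t _ _ d1 d2.
by rewrite mulr1.
Qed.

Lemma is_derive_mulmx m n p (F : R -> 'M[R]_(m, n)) (G : R -> 'M[R]_(n, p))
    (F' : 'M[R]_(m, n)) (G' : 'M[R]_(n, p)) t :
  (forall i j, is_derive t 1 (fun r => F r i j) (F' i j)) ->
  (forall i j, is_derive t 1 (fun r => G r i j) (G' i j)) ->
  forall i j, is_derive t 1 (fun r => (F r *m G r) i j) ((F' *m G t + F t *m G') i j).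
Proof.
move=> dF dG i j.
have := is_derive_sum (fun k => is_deriveM (dF i k) (dG k j)).
rewrite (_ : \sum_(k < n) _ = fun r => (F r *m G r) i j); last first.
  by apply/funext => r; rewrite fct_sumE mxE.
move=> h; apply: is_derive_eq h _; rewrite !mxE -big_split; apply: eq_bigr => k _ /=.
by rewrite [LHS]addrC; congr (_ + _); exact: mulrC.
Qed.

(** The left side has zero derivative in r, hence equals its value at r = 0. This one identity
    yields both the inverse e^(-rB) and the group law. *)
Lemma expmx_cancel B r s : expmx (r *: (- B)) *m expmx ((r + s) *: B) = expmx (s *: B).
Proof.
apply/matrixP => i j.
pose F r := (expmx (r *: - B) *m expmx ((r + s) *: B)) i j.
suff -> : (expmx (r *: - B) *m expmx ((r + s) *: B)) i j = F 0.
  by rewrite /F expmx0 mul1mx add0r.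
apply: (@is_derive_0_is_cst _ F) => x.
have := is_derive_mulmx (is_derive_expmx (- B) x) (is_derive_expmx_shift B s x) i j.
rewrite expmx_comm mulmxN mulNmx -mulmxA addNr mxE.
exact.
Qed.

Lemma expmxNK B r : expmx (r *: (- B)) *m expmx (r *: B) = 1%:M.
Proof. by rewrite -(expmx0 B) -(expmx_cancel B r 0) addr0. Qed.

Lemma expmx_unit B r : expmx (r *: B) \in unitmx.
Proof. by case: (mulmx1_unit (expmxNK B r)). Qed.

Lemma expmxD B r s : expmx ((r + s) *: B) = expmx (r *: B) *m expmx (s *: B).
Proof. by rewrite -(expmx_cancel B r s) mulmxA (mulmx1C (expmxNK B r)) mul1mx. Qed.

End matrix_exponential.

Lemma Rintegral_sumr d (T : measurableType d) (R : realType)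
    (m : {measure set T -> \bar R}) (D : set T) (I : Type) (s : seq I) (f : I -> T -> R) :
  measurable D -> (forall i, m.-integrable D (EFin \o f i)) ->
  m.-integrable D (fun x => (\sum_(i <- s) f i x)%:E) /\
  \int[m]_(x in D) (\sum_(i <- s) f i x) = \sum_(i <- s) \int[m]_(x in D) f i x.
Proof.
move=> mD fi; elim: s => [|i s [IH1 IH2]].
  split; last by rewrite big_nil; under eq_Rintegral do rewrite big_nil;
    rewrite Rintegral_cst// mul0r.
  by under eq_fun do rewrite big_nil; exact: integrable0.
split; last by rewrite big_cons -IH2 -RintegralD//; apply: eq_Rintegral => x _;
  rewrite big_cons.
under eq_fun do rewrite big_cons EFinD; exact: (integrableD mD (fi i) IH1).
Qed.

(** * The covariance matrix t K(t) *)

Section covariance.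
Variables (R : realType) (N : nat) (Q B : 'M[R]_N).
Local Notation leb := (@lebesgue_measure R).

Definition covd (r : R) : 'M[R]_N := expmx (r *: B) *m Q *m (expmx (r *: B))^T.

Lemma covd_shift s r : covd (s + r) = expmx (s *: B) *m covd r *m (expmx (s *: B))^T.
Proof. by rewrite /covd expmxD trmx_mul !mulmxA. Qed.

Lemma continuous_covd i j : continuous (fun r => covd r i j).
Proof.
move=> t; apply/differentiable_continuous/derivable1_diffP.
have d1 i' j' := is_derive_expmx B t i' j'.
have dT i' j' : is_derive t 1 (fun r => (expmx (r *: B))^T i' j')
    ((B *m expmx (t *: B))^T i' j').
  rewrite mxE (_ : (fun r => _) = fun r => expmx (r *: B) j' i')//.
  by apply/funext => r; rewrite mxE.
have dQ i' j' : is_derive t 1 (fun r : R => Q i' j') ((0 : 'M[R]_N) i' j').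
  by rewrite mxE; exact: is_derive_cst.
by have [] := is_derive_mulmx (is_derive_mulmx d1 dQ) dT i j.
Qed.

Lemma integrable_covd a b i j : leb.-integrable `[a, b] (fun r => (covd r i j)%:E).
Proof.
apply: continuous_compact_integrable; first exact: segment_compact.
by apply: continuous_subspaceT => x; exact: continuous_covd.
Qed.

Definition cov t : 'M[R]_N := \matrix_(i, j) \int[leb]_(r in `[0, t]) covd r i j.

Lemma KmxE t : t != 0 -> t *: Kmx Q B t = cov t.
Proof. by move=> t0; apply/matrixP => i j; rewrite !mxE mulVKf. Qed.

Lemma integral_shift b (f : R -> \bar R) : measurable_fun setT f ->
  (\int[leb]_x f x = \int[leb]_x f (x + b)%R)%E.
Proof.
move=> mf; rewrite [LHS]integralE [RHS]integralE.
have H (g : R -> \bar R) : measurable_fun setT g -> (forall x, 0 <= g x)%E ->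
    (\int[leb]_x g x = \int[leb]_x g (x + b)%R)%E.
  move=> mg g0; rewrite (@ge0_integral_scale_shift _ 1 b g)// mul1e.
  by apply: eq_integral => x _; rewrite mul1r.
congr (_ - _)%E.
  transitivity (\int[leb]_x (f^\+)%E (x + b)%R)%E; last first.
    by apply: eq_integral => x _; rewrite !funeposE.
  by apply: H => //; exact: measurable_funepos.
transitivity (\int[leb]_x (f^\-)%E (x + b)%R)%E; last first.
  by apply: eq_integral => x _; rewrite !funenegE.
by apply: H => //; exact: measurable_funeneg.
Qed.

Lemma integral_shift_itv (a c b : R) (f : R -> \bar R) : measurable_fun `[a, c] f ->
  (\int[leb]_(x in `[(a + b)%R, (c + b)%R]) f (x - b)%R =
   \int[leb]_(x in `[a, c]) f x)%E.
Proof.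
move=> mf; rewrite [LHS]integral_mkcond [RHS]integral_mkcond.
rewrite [RHS](@integral_shift (- b)); last first.
  exact: (measurable_restrictT f (measurable_itv _)).1.
apply: eq_integral => x _; rewrite !patchE.
have -> : (x - b \in `[a, c]%classic) = (x \in `[(a + b)%R, (c + b)%R]%classic) => //.
apply/idP/idP; rewrite !inE /= !in_itv/= => /andP[h1 h2]; apply/andP; split; lra.
Qed.

(** Cut the integral at s and shift its upper part, where [covd_shift] takes the flow out of the
    integrand. The result has the shape T + E S E^T of [gavg_gavg]. *)
Lemma covD t s : 0 <= t -> 0 <= s ->
  cov (t + s) = cov s + expmx (s *: B) *m cov t *m (expmx (s *: B))^T.
Proof.
move=> t0 s0; apply/matrixP => i j; rewrite [RHS]mxE [LHS]mxE [cov s i j]mxE.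
set E := expmx (s *: B).
apply/eqP; rewrite addrC -subr_eq; apply/eqP.
rewrite (@Rintegral_itvB _ _ (BLeft 0) (BRight (t + s)) s); last 3 first.
- exact: integrable_covd.
- by rewrite bnd_simp.
- by rewrite bnd_simp lerDr.
rewrite Rintegral_itv_obnd_cbnd; last first.
  apply: integrableS (integrable_covd s (t + s) i j) => //.
  by apply: subset_itvr; rewrite bnd_simp.
transitivity (\int[leb]_(r in `[0, t]) (E *m covd r *m E^T) i j).
  apply: (congr1 fine).
  rewrite -(@integral_shift_itv 0 t s (fun r => ((E *m covd r *m E^T) i j)%:E)).
    rewrite add0r; apply: eq_integral => x _.
    by rewrite /E -covd_shift addrC subrK.
  apply: (measurable_funS measurableT) => //; apply/measurable_EFinP.
  apply: continuous_measurable_fun => x.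
  rewrite (_ : (fun r => _) = fun r => covd (s + r) i j); last first.
    by apply/funext => r; rewrite /E covd_shift.
  apply: (continuous_comp (g := fun r => covd r i j)); last exact: continuous_covd.
  by apply: cvgD; [exact: cvg_cst|exact: cvg_id].
have iq p q r : leb.-integrable `[0, t] (EFin \o (fun x => E i p * covd x p q * r)).
  have : leb.-integrable `[0, t] (fun x => ((r * E i p)%:E * (covd x p q)%:E)%E).
    by apply: integrableZl => //; exact: integrable_covd.
  by apply: eq_integrable => // x _ /=; rewrite -EFinM; congr (_%:E); ring.
have ip q r : leb.-integrable `[0, t]
    (EFin \o (fun x => (\sum_p E i p * covd x p q) * r)).
  have [+ _] := @Rintegral_sumr _ _ _ leb _ _ (index_enum 'I_N)
    (fun p x => E i p * covd x p q * r) (measurable_itv _) (fun p => iq p q r).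
  by apply: eq_integrable => // x _ /=; rewrite mulr_suml.
transitivity (\int[leb]_(r in `[0, t]) (\sum_q (\sum_p E i p * covd r p q) * E^T q j)).
  by apply: eq_Rintegral => r _; rewrite mxE; apply: eq_bigr => q _; rewrite mxE.
rewrite (Rintegral_sumr _ _ (fun q => ip q (E^T q j))).2//.
rewrite mxE; apply: eq_bigr => q _; rewrite [(E *m cov t) i q]mxE.
transitivity (\int[leb]_(r in `[0, t]) (\sum_p E i p * covd r p q * E^T q j)).
  by apply: eq_Rintegral => r _; rewrite mulr_suml.
rewrite (Rintegral_sumr _ _ (fun p => iq p q (E^T q j))).2// mulr_suml.
apply: eq_bigr => p _; rewrite RintegralZr//; last first.
  by apply: eq_integrable (iq p q 1) => // x _ /=; rewrite mulr1.
rewrite RintegralZl//; last exact: integrable_covd.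
by rewrite [cov t p q]mxE.
Qed.

Lemma cov_trace_le : exists C : R, 0 <= C /\
  forall h, 0 <= h -> h <= 1 -> \tr (cov h) <= C * h.
Proof.
have bnd i : exists M : R, forall r, r \in `[0, 1]%R -> covd r i i <= M.
  have [|c _ cM] := @EVT_max R (fun r => covd r i i) 0 1 ler01.
    by apply: continuous_subspaceT => x; exact: continuous_covd.
  by exists (covd c i i).
have [M MP] := choice bnd.
exists (\sum_i `|M i|); split; first exact: sumr_ge0.
move=> h h0 h1; rewrite mulr_suml; apply: ler_sum => i _; rewrite mxE.
apply: (@le_trans _ _ (\int[leb]_(r in `[0, h]) `|M i|)).
  apply: le_Rintegral => //.
  - exact: integrable_covd.
  - apply: continuous_compact_integrable; first exact: segment_compact.
    by apply: continuous_subspaceT => x; exact: cvg_cst.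
  move=> r /=; rewrite in_itv/= => /andP[r0 rh].
  apply: le_trans (MP i r _) (ler_norm _).
  by rewrite in_itv/= r0 (le_trans rh).
rewrite Rintegral_cst//; have hE := @lebesgue_measure_itv R `[0, h].
suff -> : fine (leb `[0, h]) = h by [].
rewrite [X in fine X]hE /= lte_fin; case: ltP => //=; first by rewrite oppr0 addr0.
by move=> h0'; apply/esym/eqP; rewrite eq_le h0'.
Qed.

End covariance.

(** * Schwartz functions *)

Section curves.
Variable R : realType.

Lemma is_derive_mx m n (g : R -> 'M[R]_(m, n)) (dg : 'M[R]_(m, n)) (x : R) :
  (forall i j, is_derive x 1 (fun r => g r i j) (dg i j)) -> is_derive x 1 g dg.
Proof.
move=> H; have cv : h^-1 *: (g (h *: 1 + x) - g x) @[h --> 0^'] --> dg.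
  apply: cvg_mx_entrywise => i j; have [dgij <-] := H i j.
  rewrite (_ : (fun h => _) = fun h => h^-1 *: (g (h *: 1 + x) i j - g x i j)).
    exact: dgij.
  by apply/funext => h; rewrite !mxE.
by apply: DeriveDef; [apply/cvg_ex; exists dg|exact/cvg_lim].
Qed.

Lemma is_derive_comp_curve N (f : 'cV[R]_N -> R) (g : R -> 'cV[R]_N) (dg : 'cV[R]_N) (x : R) :
  differentiable f (g x) -> is_derive x 1 g dg ->
  is_derive x 1 (f \o g) ('D_dg f (g x)).
Proof.
move=> df [dgx <-]; have dg' : differentiable g x by apply/derivable1_diffP.
apply: DeriveDef; first by apply/derivable1_diffP; exact: differentiable_comp.
rewrite deriveE; last exact: differentiable_comp.
by rewrite diff_comp//= -deriveE// -deriveE.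
Qed.

Lemma MVT_le (F dF : R -> R) (a b C : R) : a <= b ->
  (forall x : R, is_derive x 1 F (dF x)) ->
  (forall x : R, a <= x -> x <= b -> `|dF x| <= C) ->
  `|F b - F a| <= C * (b - a).
Proof.
rewrite le_eqVlt => /predU1P[->|ab] dFP dFC; first by rewrite !subrr normr0 mulr0.
have [|c + ->] := MVT ab (fun x _ => dFP x).
  apply: continuous_subspaceT => x.
  by apply/differentiable_continuous/derivable1_diffP; have [] := dFP x.
rewrite in_itv/= => /andP[ac cb]; rewrite normrM (ger0_norm (_ : 0 <= b - a)).
  by rewrite ler_wpM2r ?dFC ?ltW// subr_gt0.
by rewrite subr_ge0 ltW.
Qed.

End curves.

(** * Difference bounds for Schwartz functions *)

Section schwartz.
Variables (R : realType) (N : nat) (f : 'cV[R]_N -> R).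
Hypothesis hf : Schwartz f.
Local Notation e i := (ecoord R i).

Lemma ecoord_sum (v : 'cV[R]_N) : v = \sum_i v i 0 *: ecoord R i.
Proof.
rewrite [LHS]matrix_sum_delta; apply: eq_bigr => i _.
by rewrite big_ord1.
Qed.

Lemma derive_ecoord (g : 'cV[R]_N -> R) x v : differentiable g x ->
  'D_v g x = \sum_i v i 0 * 'D_(ecoord R i) g x.
Proof.
move=> dg; rewrite deriveE// {1}(ecoord_sum v) linear_sum /=.
by apply: eq_bigr => i _; rewrite linearZ /= -deriveE.
Qed.

Lemma schwartz_differentiable x : differentiable f x.
Proof. exact: (hf.1 [::]). Qed.

Lemma schwartz_derive_differentiable i x : differentiable ('D_(ecoord R i) f) x.
Proof. exact: (hf.1 [:: i]). Qed.

(** Finitely many seminorms are involved, so the sum of their bounds serves for all. The weighted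
    bound on x_j times a first derivative is the one that will control the unbounded drift. *)
Lemma schwartz_bounds : exists M : R, [/\ 0 <= M, forall x, `|f x| <= M,
  forall i (x : 'cV[R]_N), `|'D_(ecoord R i) f x| <= M,
  forall i j (x : 'cV[R]_N), `|x j 0 * 'D_(ecoord R i) f x| <= M &
  forall i j (x : 'cV[R]_N), `|'D_(ecoord R j) ('D_(ecoord R i) f) x| <= M].
Proof.
have p0 (x : 'cV[R]_N) : \prod_(i < N) x i 0 ^+ (fun=> 0%N) i = 1.
  by rewrite big1.
have [M0 H0] := hf.2 (fun=> 0%N) [::].
have [M1 H1] := choice (fun i => hf.2 (fun=> 0%N) [:: i]).
have [M2 H2] := choice (fun ij : 'I_N * 'I_N => hf.2 (fun=> 0%N) [:: ij.2; ij.1]).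
have [M3 H3] := choice (fun ij : 'I_N * 'I_N =>
  (* The multi-index that is 1 at one coordinate reduces the monomial to that coordinate. *)
  hf.2 (fun i => (i == ij.2) : nat) [:: ij.1]).
have le_sum (I : finType) (F : I -> R) i : `|F i| <= \sum_j `|F j|.
  by rewrite (bigD1 i)//= lerDl sumr_ge0.
pose S1 := \sum_i `|M1 i|; pose S2 := \sum_i `|M2 i|; pose S3 := \sum_i `|M3 i|.
have S10 : 0 <= S1 by exact: sumr_ge0.
have S20 : 0 <= S2 by exact: sumr_ge0.
have S30 : 0 <= S3 by exact: sumr_ge0.
have n0 := normr_ge0 M0.
exists (`|M0| + S1 + S2 + S3); split.
- by rewrite !addr_ge0.
- move=> x; have := H0 x; rewrite p0 mul1r => h; have := ler_norm M0; rewrite /= in h.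
  by move=> ?; lra.
- move=> i x; have := H1 i x; rewrite p0 mul1r /= => h; have := ler_norm (M1 i).
  by have := le_sum _ M1 i; rewrite -/S1 => ? ?; lra.
- move=> i j x; have := H3 (i, j) x; rewrite /= (bigD1 j)//= eqxx expr1.
  rewrite big1 ?mulr1 => [h|k /negbTE -> //].
  have := ler_norm (M3 (i, j)).
  by have := le_sum _ M3 (i, j); rewrite -/S3 => ? ?; lra.
- move=> i j x; have := H2 (i, j) x; rewrite p0 mul1r /= => h; have := ler_norm (M2 (i, j)).
  by have := le_sum _ M2 (i, j); rewrite -/S2 => ? ?; lra.
Qed.

Lemma is_derive_line (g : 'cV[R]_N -> R) (a z : 'cV[R]_N) (r : R) :
  (forall x, differentiable g x) ->
  is_derive r 1 (fun r => g (a + r *: z)) ('D_z g (a + r *: z)).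
Proof.
move=> dg; apply: (@is_derive_comp_curve _ _ g (fun r => a + r *: z)) => //.
apply: is_derive_mx => i j.
rewrite (_ : (fun r => _) = fun r => a i j + r * z i j); last first.
  by apply/funext => y; rewrite !mxE.
have h := is_deriveD (is_derive_cst (a i j) r 1) (is_deriveZ (z i j) (is_derive_id r (1 : R))).
rewrite (_ : (fun r => _) = cst (a i j) + z i j \*: id); last first.
  by apply/funext => y; rewrite mulrC.
apply: is_derive_eq h _; by rewrite add0r -[LHS]/(_ * _) mulr1.
Qed.

Lemma schwartz_lipschitz : exists M : R, 0 <= M /\
  forall x z, `|f (x + z) - f x| <= M * \sum_i `|z i 0|.
Proof.
have [M [M0 _ M1 _ _]] := schwartz_bounds; exists M; split=> // x z.
have := @MVT_le _ (fun r => f (x + r *: z)) (fun r => 'D_z f (x + r *: z)) 0 1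
  (M * \sum_i `|z i 0|) ler01.
rewrite scale1r scale0r addr0 subr0 mulr1; apply.
  by move=> r; apply: is_derive_line; exact: schwartz_differentiable.
move=> r _ _; rewrite derive_ecoord; last exact: schwartz_differentiable.
apply: le_trans (ler_norm_sum _ _ _) _; rewrite mulr_sumr; apply: ler_sum => i _.
by rewrite normrM mulrC ler_wpM2r.
Qed.

(** Two mean value bounds: r |-> f(a + r z) + f(a - r z) has derivative D_z f(a + r z) - D_z f(a - r
    z), itself a difference of D_z f over a segment of length at most 2. The second derivatives
    bring in the square of the l1 norm [S] of z, which Cauchy-Schwarz compares with |z|^2. *)
Lemma schwartz_second_difference : exists C : R, 0 <= C /\
  forall a z, `|f (a + z) + f (a - z) - 2 * f a| <= C * qform 1%:M z.
Proof.
have [M [M0 _ _ _ M2]] := schwartz_bounds.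
exists (2 * M * N%:R); split; first by rewrite !mulr_ge0.
move=> a z; pose S := \sum_i `|z i 0|.
have S0 : 0 <= S by exact: sumr_ge0.
have S2 : S ^+ 2 <= N%:R * qform 1%:M z.
  have := sum_sqr_cauchy_schwarz (fun=> 1) (fun i => `|z i 0|).
  under eq_bigr do rewrite mul1r.
  under [X in _ <= X * _ -> _]eq_bigr do rewrite expr1n.
  rewrite sumr_const card_ord qform1.
  by under [X in _ <= _ * X -> _]eq_bigr do rewrite real_normK ?num_real//.
pose h i y := 'D_(ecoord R i) f y.
have dh i y : differentiable (h i) y by exact: schwartz_derive_differentiable.
have dDz (y : 'cV[R]_N) (r : R) : is_derive r 1 (fun r => 'D_z f (y + r *: z))
    (\sum_i z i 0 * 'D_z (h i) (y + r *: z)).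
  rewrite (_ : (fun r => _) = \sum_i (z i 0 \*: (fun r => h i (y + r *: z)))).
    apply: is_derive_sum => i; apply: is_deriveZ; exact: is_derive_line.
  apply/funext => r'; rewrite derive_ecoord; last exact: schwartz_differentiable.
  by rewrite fct_sumE.
have bDz y : `|\sum_i z i 0 * 'D_z (h i) y| <= M * S ^+ 2.
  apply: le_trans (ler_norm_sum _ _ _) _.
  have -> : M * S ^+ 2 = \sum_i `|z i 0| * (M * S).
    by rewrite -mulr_suml -/S; ring.
  apply: ler_sum => i _; rewrite normrM ler_wpM2l// derive_ecoord//.
  apply: le_trans (ler_norm_sum _ _ _) _; rewrite mulr_sumr; apply: ler_sum => j _.
  by rewrite normrM mulrC ler_wpM2r// M2.
have step r : 0 <= r -> r <= 1 ->
    `|'D_z f (a + r *: z) - 'D_z f (a - r *: z)| <= 2 * (M * S ^+ 2).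
  move=> r0 r1; have r02 : - r <= r by lra.
  have := MVT_le r02 (dDz a) (fun r _ _ => bDz _); rewrite scaleNr => /le_trans; apply.
  rewrite mulrC ler_wpM2r ?mulr_ge0 ?exprn_ge0//; lra.
have dN (r : R) : is_derive r 1 (fun r => f (a - r *: z)) (- 'D_z f (a - r *: z)).
  have := @is_derive_line f a (- z) r schwartz_differentiable.
  rewrite (_ : (fun r => _) = fun r => f (a - r *: z)); last first.
    by apply/funext => y; rewrite scalerN.
  move=> hN; apply: is_derive_eq hN _; rewrite !derive_ecoord; try exact: schwartz_differentiable.
  by rewrite -sumrN; apply: eq_bigr => i _; rewrite mxE mulNr scalerN.
have := @MVT_le _ (fun r => f (a + r *: z) + f (a - r *: z))
  (fun r => 'D_z f (a + r *: z) - 'D_z f (a - r *: z)) 0 1 (2 * (M * S ^+ 2)) ler01.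
rewrite !scale1r !scale0r !subr0 !addr0 mulr1 => H.
have -> : 2 * f a = f a + f a by ring.
apply: le_trans (H _ _) _.
- by move=> r; exact: is_deriveD (is_derive_line _ _ _ schwartz_differentiable) (dN r).
- by move=> r; exact: step.
by rewrite -!mulrA ler_wpM2l// ler_wpM2l.
Qed.

(** Along y(r) = e^(rB) x the derivative of f is the sum of the B_ij y_j D_i f(y). Its growth in y
    is absorbed by the weighted derivative bound, so the estimate is uniform in x. *)
Lemma schwartz_drift (B : 'M[R]_N) : exists C : R, 0 <= C /\
  forall h x, 0 <= h -> `|f (expmx (h *: B) *m x) - f x| <= C * h.
Proof.
have [M [M0 _ _ M3 _]] := schwartz_bounds.
exists (mxsum_norm B * M); split; first by rewrite mulr_ge0// mxsum_norm_ge0.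
move=> h x h0.
pose y (r : R) := expmx (r *: B) *m x.
have dy (r : R) : is_derive r 1 y (B *m y r).
  apply: is_derive_mx => i j.
  have d0 i' j' : is_derive r 1 (fun=> x i' j') ((0 : 'cV[R]_N) i' j').
    by rewrite mxE; exact: is_derive_cst.
  have := is_derive_mulmx (is_derive_expmx B r) d0 i j.
  by rewrite mulmx0 addr0 -mulmxA.
have := @MVT_le _ (f \o y) (fun r => 'D_(B *m y r) f (y r)) 0 h
  (mxsum_norm B * M) h0.
have y0 : y 0 = x by rewrite /y expmx0 mul1mx.
rewrite subr0 /= y0; apply.
  move=> r; apply: is_derive_comp_curve => //; exact: schwartz_differentiable.
move=> r _ _; rewrite derive_ecoord; last exact: schwartz_differentiable.
apply: le_trans (ler_norm_sum _ _ _) _; rewrite mulr_suml; apply: ler_sum => i _.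
rewrite mxE mulr_suml; apply: le_trans (ler_norm_sum _ _ _) _.
rewrite mulr_suml; apply: ler_sum => j _.
by rewrite -mulrA normrM ler_wpM2l.
Qed.

End schwartz.

(** * The semigroup *)

Section discretisation.
Variable R : realType.

Lemma measurable_countable_case d (T : measurableType d) (C : countType) (h : T -> C)
    (F : C -> T -> R) :
  (forall c, measurable (h @^-1` [set c])) -> (forall c, measurable_fun setT (F c)) ->
  measurable_fun setT (fun x => F (h x) x).
Proof.
move=> mh mF _ Y mY; rewrite setTI.
rewrite (_ : _ @^-1` _ = \bigcup_c ((h @^-1` [set c]) `&` (F c @^-1` Y))).
  apply: countable_bigcupT_measurable => // c; apply: measurableI => //.
  by rewrite -[X in measurable X]setTI; exact: mF.
apply/seteqP; split=> x /=; first by move=> ?; exists (h x).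
by move=> [c _ [/= <-]].
Qed.

Definition grid (n : nat) (x : R) : int := Num.floor (n.+1%:R * x).

Lemma measurable_grid d (T : measurableType d) n (g : T -> R) (z : int) :
  measurable_fun setT g -> measurable ((grid n \o g) @^-1` [set z]).
Proof.
move=> mg.
have mg' : measurable_fun setT (fun x => n.+1%:R * g x) by exact: measurable_funM.
rewrite (_ : _ @^-1` _ = (fun x => n.+1%:R * g x) @^-1` `[z%:~R, (z + 1)%:~R[%classic).
  by rewrite -[X in measurable X]setTI; apply: mg' => //; exact: measurable_itv.
apply/seteqP; split=> x /=; rewrite /grid in_itv /=.
  by move=> <-; exact: floor_itv.
by move=> h; exact: floor_def.
Qed.

Lemma grid_dist n (x : R) : `|(grid n x)%:~R / n.+1%:R - x| <= n.+1%:R^-1.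
Proof.
have /andP[h1 h2] := floor_itv (n.+1%:R * x); rewrite -/(grid n x) in h1 h2.
have n0 : 0 < n.+1%:R :> R by [].
have -> : (grid n x)%:~R / n.+1%:R - x = ((grid n x)%:~R - n.+1%:R * x) / n.+1%:R :> R.
  by field; rewrite gt_eqF.
rewrite normrM (ger0_norm (_ : 0 <= n.+1%:R^-1)) ?invr_ge0// ler_piMl ?invr_ge0//.
rewrite distrC ger0_norm ?subr_ge0//.
by move: h2; rewrite intrD; lra.
Qed.

Lemma cvg_grid (a c : R) (v : nat -> R) : (forall n, `|v n - a| <= c * n.+1%:R^-1) ->
  v n @[n --> \oo] --> a.
Proof.
move=> H; have : c * n.+1%:R^-1 @[n --> \oo] --> c * 0.
  by apply: cvgM; [exact: cvg_cst|exact: cvg_harmonic].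
rewrite mulr0 => /cvgrPdist_le h; apply/cvgrPdist_le => e /h.
apply: filterS => n; rewrite sub0r normrN distrC => hn.
by rewrite (le_trans (H n))// (le_trans (ler_norm _)).
Qed.

(** The function is the pointwise limit of its values at the points of the grid of mesh 1 / (n + 1);
    these approximations take countably many values on measurable cells. *)
Lemma measurable_lipschitz_colt N (f : 'cV[R]_N -> R) M :
  (forall x z, `|f (x + z) - f x| <= M * \sum_i `|z i 0|) -> 0 <= M ->
  measurable_fun setT (fun t : N.-tuple R => f (colt t)).
Proof.
move=> fM M0.
pose h n (t : N.-tuple R) : {ffun 'I_N -> int} := [ffun i => grid n (colt t i 0)].
pose F n (c : {ffun 'I_N -> int}) (_ : N.-tuple R) : R :=
  f (\col_i ((c i)%:~R / n.+1%:R)).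
apply: (@measurable_fun_cvg _ _ _ _ (fun n t => F n (h n t) t)).
  move=> n; apply: measurable_countable_case => c; last exact: measurable_cst.
  rewrite (_ : _ @^-1` _ = \bigcap_i ((grid n \o (fun t => colt t i 0)) @^-1` [set c i])).
    apply: fin_bigcap_measurable => // i _; apply: measurable_grid.
    exact: measurable_coltE.
  apply/seteqP; split=> t /=.
    by move=> <- i _ /=; rewrite ffunE.
  by move=> H; apply/ffunP => i; rewrite ffunE; exact: H.
move=> t _; apply: (@cvg_grid _ (M * N%:R)) => n.
pose z : 'cV[R]_N := \col_i ((h n t i)%:~R / n.+1%:R - colt t i 0).
have -> : F n (h n t) t = f (colt t + z).
  by congr f; apply/matrixP => i j; rewrite ord1 ![in RHS]mxE subrKC mxE.
apply: le_trans (fM _ _) _; rewrite -mulrA ler_wpM2l//.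
apply: (@le_trans _ _ (\sum_(i < N) n.+1%:R^-1)).
  by apply: ler_sum => i _; rewrite mxE ffunE; exact: grid_dist.
by rewrite sumr_const card_ord mulr_natl.
Qed.

(** A Caratheodory argument: rounding only the time variable gives jointly measurable
    approximations, which converge by the Lipschitz bound. *)
Lemma measurable_lipschitz_time d (T : measurableType d) (u : R -> T -> R) C :
  0 <= C -> (forall t, measurable_fun setT (u t)) ->
  (forall x t t', `|u t x - u t' x| <= C * `|t - t'|) ->
  measurable_fun setT (fun p : R * T => u p.1 p.2).
Proof.
move=> C0 mu uC.
apply: (@measurable_fun_cvg _ _ _ _
  (fun n p => (fun c (p : R * T) => u (c%:~R / n.+1%:R) p.2) (grid n p.1) p)).
  move=> n; apply: (@measurable_countable_case _ (R * T)%type int (fun p : R * T => grid n p.1)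
    (fun c p => u (c%:~R / n.+1%:R) p.2)).
    by move=> c; exact: (measurable_grid n c measurable_fst).
  by move=> c; exact: (measurableT_comp (mu _) measurable_snd).
move=> [t x] _; apply: (@cvg_grid _ C) => n /=.
by apply: le_trans (uC _ _ _) _; rewrite ler_wpM2l// grid_dist.
Qed.

End discretisation.

(** * The semigroup law and Lipschitz continuity in time *)

Section semigroup.
Variables (R : realType) (N : nat) (Q B : 'M[R]_N).
Hypothesis hQsym : Q^T = Q.
Hypothesis hK : forall t : R, 0 < t ->
  forall v : 'cV[R]_N, v != 0 -> 0 < (v^T *m Kmx Q B t *m v) 0 0.

Lemma posdef_cov t : 0 < t -> posdef (cov Q B t).
Proof.
move=> t0; split.
  apply/matrixP => i j; rewrite !mxE; apply: eq_Rintegral => r _.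
  have : (covd Q B r)^T = covd Q B r by rewrite !trmx_mul trmxK hQsym mulmxA.
  by move=> /matrixP/(_ i j); rewrite mxE.
move=> v v0; rewrite -KmxE ?gt_eqF// /qform -scalemxAr -scalemxAl mxE mulr_gt0//.
exact: hK.
Qed.

Lemma pkerE X Y t : 0 < t ->
  pker Q B X Y t = gauss_den (cov Q B t) (Y - expmx (t *: B) *m X).
Proof.
move=> t0; have pS := posdef_cov t0; rewrite /pker /gauss_den -KmxE ?gt_eqF//.
congr (_ * _ * expR (- _)); rewrite /mt2; set d := Y - _.
have uK : Kmx Q B t \in unitmx.
  have := posdef_unit pS; rewrite -KmxE ?gt_eqF//.
  by rewrite unitmxZ// unitfE gt_eqF.
rewrite invmxZ; last by rewrite unitmxZ// unitfE gt_eqF.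
rewrite -[X in X / _ = _]/(dotv (invmx (Kmx Q B t) *m d) d) dotvC qformE.
rewrite -scalemxAl [X in _ = X / _]/dotv -scalemxAr mxE.
by rewrite -[(d^T *m _) 0 0]/(dotv d _); field; rewrite gt_eqF.
Qed.

Lemma PtE t f M X : 0 < t -> bounded_by f M ->
  Pt Q B t f X = gavg (cov Q B t) f (expmx (t *: B) *m X).
Proof.
move=> t0 bf; rewrite /Pt /intRN.
have E v : pker Q B X v t * f v =
    gauss_den (cov Q B t) (v - expmx (t *: B) *m X) * f v by rewrite pkerE.
rewrite iRint_lebn.
  by apply: eq_Rintegral => v _; exact: E.
apply: eq_integrable (gavg_integrable (expmx (t *: B) *m X) (posdef_cov t0) bf) => //.
by move=> v _; rewrite -E.
Qed.

Lemma Pt_bounded t f M : 0 < t -> bounded_by f M -> bounded_by (Pt Q B t f) M.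
Proof.
move=> t0 bf; split => [|X]; last by rewrite (PtE _ t0 bf) gavg_bound//; exact: posdef_cov.
under eq_fun do rewrite (PtE _ t0 bf).
apply: measurable_gavg; first exact: bf.1.
by apply: measurable_col_mulmx; exact: measurable_col_colt.
Qed.

(** [gavg_gavg] with E = e^(sB): the covariances combine by [covD] and the centres by [expmxD]. *)
Lemma PtD t s f M X : 0 < t -> 0 < s -> bounded_by f M ->
  Pt Q B t (Pt Q B s f) X = Pt Q B (t + s) f X.
Proof.
move=> t0 s0 bf; rewrite (PtE _ t0 (Pt_bounded s0 bf)) (PtE _ (addr_gt0 t0 s0) bf).
rewrite (_ : Pt Q B s f = fun y => gavg (cov Q B s) f (expmx (s *: B) *m y)).
  rewrite (gavg_gavg _ (posdef_cov t0) (posdef_cov s0) (expmx_unit B s) bf).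
  by rewrite (covD Q B (ltW t0) (ltW s0)) mulmxA -expmxD (addrC s).
by apply/funext => y; rewrite (PtE _ s0 bf).
Qed.

Lemma gavgB (S : 'M[R]_N) f g M M' a : posdef S -> bounded_by f M -> bounded_by g M' ->
  gavg S f a - gavg S g a = gavg S (fun x => f x - g x) a.
Proof.
move=> pS bf bg; rewrite /gavg -RintegralB//.
- by apply: eq_Rintegral => t _; rewrite mulrBr.
- exact: gavg_integrable bf.
- exact: gavg_integrable bg.
Qed.

Variable f : 'cV[R]_N -> R.
Hypothesis hf : Schwartz f.

Lemma schwartz_bounded : exists M, bounded_by f M.
Proof.
have [M [_ M1 _ _ _]] := schwartz_bounds hf.
have [L [L0 fL]] := schwartz_lipschitz hf.
exists M; split=> //; exact: measurable_lipschitz_colt fL L0.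
Qed.

Lemma Pt_sub_le : exists C, 0 <= C /\ forall h X, 0 < h -> `|Pt Q B h f X - f X| <= C * h.
Proof.
have [M bf] := schwartz_bounded.
have M0 : 0 <= M by rewrite (le_trans _ (bf.2 0)).
have [c [c0 Hc]] := gavg_second_difference R N.
have [C2 [C20 H2]] := schwartz_second_difference hf.
have [C3 [C30 H3]] := cov_trace_le Q B.
have [C4 [C40 H4]] := schwartz_drift hf B.
(* The summand 2 M serves h > 1, where the sup bound 2 M is at most 2 M h; the other one serves h <=
   1, the range of the trace estimate. *)
exists (2 * M + (c * C2 * C3 + C4)); split.
  by rewrite !addr_ge0// !mulr_ge0.
move=> h X h0; rewrite mulrDl.
have [h1|h1] := leP h 1; last first.
  apply: (@le_trans _ _ (2 * M)).
    apply: le_trans (ler_normB _ _) _; have := bf.2 X.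
    by have := (Pt_bounded h0 bf).2 X; lra.
  rewrite -[leLHS]addr0 lerD//; first by rewrite ler_peMr ?mulr_ge0// ltW.
  by apply: mulr_ge0; [rewrite addr_ge0// !mulr_ge0|exact: ltW].
rewrite -[leLHS]add0r lerD//; first by rewrite !mulr_ge0// ltW.
rewrite (PtE _ h0 bf); set Y := expmx _ *m X.
have -> : gavg (cov Q B h) f Y - f X = (gavg (cov Q B h) f Y - f Y) + (f Y - f X) by ring.
apply: le_trans (ler_normD _ _) _; rewrite mulrDl lerD//; last by apply: H4; exact: ltW.
apply: le_trans (Hc _ _ _ _ _ (posdef_cov h0) bf C20 (H2 Y)) _.
by rewrite -!mulrA !ler_wpM2l// H3// ltW.
Qed.

(** The semigroup law gives P_(t+h) f - P_t f = P_t (P_h f - f), and a Gaussian average does not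
    increase the sup norm, so the estimate at time 0 propagates. *)
Lemma Pt_lipschitz : exists C, 0 <= C /\ forall t t' X, 0 < t -> 0 < t' ->
  `|Pt Q B t f X - Pt Q B t' f X| <= C * `|t - t'|.
Proof.
have [M bf] := schwartz_bounded.
have [C [C0 HC]] := Pt_sub_le; exists C; split=> //.
have H t h X : 0 < t -> 0 < h -> `|Pt Q B (t + h) f X - Pt Q B t f X| <= C * h.
  move=> t0 h0; rewrite -(PtD _ t0 h0 bf) (PtE _ t0 bf) (PtE _ t0 (Pt_bounded h0 bf)).
  rewrite (gavgB _ (posdef_cov t0) (Pt_bounded h0 bf) bf).
  apply: gavg_bound; first exact: posdef_cov.
  split=> [|x]; last exact: HC.
  apply: measurable_funB; [exact: (Pt_bounded h0 bf).1|exact: bf.1].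
move=> t t' X t0 t'0; wlog tt' : t t' t0 t'0 / t <= t'.
  move=> W; have [tt'|/ltW tt'] := leP t t'; first exact: W.
  by rewrite distrC [X in _ <= C * X]distrC; exact: W.
move: tt'; rewrite le_eqVlt => /predU1P[->|tt']; first by rewrite !subrr !normr0 mulr0.
rewrite distrC [X in _ <= C * X]distrC [X in _ <= C * X]gtr0_norm ?subr_gt0//.
have := H t (t' - t) X t0; rewrite addrCA subrr addr0; apply.
by rewrite subr_gt0.
Qed.

End semigroup.

(** * Power and Gamma integrals *)

(* An opaque-to-inference copy of [is_derive]: stating hypotheses with the class itself
   would make [rewrite] try to solve them by instance search. *)
Definition deriv_at (R : realType) (F : R -> R) (x v : R) : Prop := is_derive x 1 F v.

(** * Fundamental theorem of calculus for improper integrals *)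

Section exhaustion.
Variable R : realType.
Local Notation leb := (@lebesgue_measure R).
Implicit Types (f g F : R -> R).

(** The ordinary theorem on each compact interval, then monotone convergence for [f] and [g]
    separately. Writing the derivative as a difference of nonnegative functions covers both uses:
    [g] = 0 for an explicit antiderivative, [g] nonzero for integration by parts. *)
Lemma FTC_exhaust f g F (D : set R) (a b : nat -> R) l :
  (forall n, a n < b n) ->
  (forall n m, (n <= m)%N -> a m <= a n) -> (forall n m, (n <= m)%N -> b n <= b m) ->
  D = \bigcup_n `[a n, b n]%classic ->
  (forall x, D x -> 0 <= f x) -> (forall x, D x -> 0 <= g x) ->
  (forall x, D x -> {for x, continuous f}) -> (forall x, D x -> {for x, continuous g}) ->
  (forall x, D x -> deriv_at F x (f x - g x)) ->
  F (b n) - F (a n) @[n --> \oo] --> l ->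
  (\int[leb]_(x in D) (g x)%:E < +oo)%E ->
  (\int[leb]_(x in D) (f x)%:E = \int[leb]_(x in D) (g x)%:E + l%:E)%E.
Proof.
move=> ab a_ b_ DE f0 g0 cf cg dF Fl goo.
have sub n x : a n <= x <= b n -> D x by move=> h; rewrite DE; exists n.
have cW (h : R -> R) n : (forall x, D x -> {for x, continuous h}) ->
    {within `[a n, b n], continuous h}.
  move=> ch; apply: continuous_in_subspaceT => x; rewrite inE /= in_itv/= => xab.
  by apply: ch; exact: sub xab.
have mh (h : R -> R) n : (forall x, D x -> {for x, continuous h}) ->
    measurable_fun `[a n, b n] (fun x => (h x)%:E).
  move=> ch; apply/measurable_EFinP; apply: subspace_continuous_measurable_fun => //.
  exact: cW.
have ih (h : R -> R) n : (forall x, D x -> {for x, continuous h}) ->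
    leb.-integrable `[a n, b n] (fun x => (h x)%:E).
  move=> ch; apply: continuous_compact_integrable; first exact: segment_compact.
  exact: cW.
have E n : (\int[leb]_(x in `[a n, b n]) (f x)%:E =
    \int[leb]_(x in `[a n, b n]) (g x)%:E + (F (b n) - F (a n))%:E)%E.
  have cfg x : D x -> {for x, continuous (fun x => f x - g x)}.
    by move=> Dx; apply: cvgB; [exact: cf|exact: cg].
  have dFab x : x \in `[a n, b n] -> deriv_at F x (f x - g x).
    by rewrite in_itv/= => /sub; exact: dF.
  have cF x : x \in `[a n, b n] -> {for x, continuous F}.
    by move=> /dFab[dx _]; apply/differentiable_continuous/derivable1_diffP.
  have <- : (\int[leb]_(x in `[a n, b n]) (f x - g x)%:E = (F (b n) - F (a n))%:E)%E.
    rewrite EFinB; apply: continuous_FTC2 => //; first exact: cW.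
    - split.
      + by move=> x /subset_itv_oo_cc /dFab[].
      + by apply: cvg_at_right_filter; apply: cF; rewrite in_itv/= lexx ltW.
      + by apply: cvg_at_left_filter; apply: cF; rewrite in_itv/= lexx ltW.
    - by move=> x /subset_itv_oo_cc /dFab[_]; rewrite derive1E.
  rewrite -integralD//=; [|exact: ih..].
  by apply: eq_integral => x _; rewrite -EFinD; congr (_%:E); ring.
have cvgI (h : R -> R) : (forall x, D x -> 0 <= h x) -> (forall x, D x -> {for x, continuous h}) ->
    (\int[leb]_(x in `[a n, b n]) (h x)%:E)%E @[n --> \oo] -->
    (\int[leb]_(x in D) (h x)%:E)%E.
  move=> h0 ch; rewrite DE; apply: ge0_nondecreasing_set_cvg_integral => //.
  - move=> n m nm; apply/subsetPset => x /=; rewrite !in_itv/= => /andP[h1 h2].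
    by rewrite (le_trans (a_ _ _ nm))// (le_trans h2)// b_.
  - by move=> n; exact: mh.
  - by move=> n x /=; rewrite in_itv/= lee_fin => /sub; exact: h0.
have c1 := cvgI f f0 cf; have c2 := cvgI g g0 cg.
apply: (cvg_unique _ c1) => //.
rewrite (_ : (fun n => _) = (fun n => \int[leb]_(x in `[a n, b n]) (g x)%:E +
    (F (b n) - F (a n))%:E)%E); last by apply/funext => n; exact: E.
apply: cvgeD => //; first by rewrite fin_num_adde_defl.
by apply/fine_cvgP; split; [exact: nearW|exact: Fl].
Qed.

Lemma cvg_at_right_seq F (a c l : R) : 0 < c -> F x @[x --> a^'+] --> l ->
  F (a + c * n.+1%:R^-1) @[n --> \oo] --> l.
Proof.
move=> c0 Fl; apply: (cvg_comp _ _ _ Fl) => A [e /= e0 eA].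
have h : c * n.+1%:R^-1 @[n --> \oo] --> c * 0.
  by apply: cvgM; [exact: cvg_cst|exact: cvg_harmonic].
rewrite mulr0 in h; move/cvgrPdist_lt/(_ _ e0) : h.
apply: filterS => n; rewrite sub0r normrN => hn; apply: eA => /=.
  by rewrite opprD addNKr normrN.
by rewrite ltrDl mulr_gt0.
Qed.

Lemma cvg_at_left_seq F (b c l : R) : 0 < c -> F x @[x --> b^'-] --> l ->
  F (b - c * n.+1%:R^-1) @[n --> \oo] --> l.
Proof.
move=> c0 Fl; apply: (cvg_comp _ _ _ Fl) => A [e /= e0 eA].
have h : c * n.+1%:R^-1 @[n --> \oo] --> c * 0.
  by apply: cvgM; [exact: cvg_cst|exact: cvg_harmonic].
rewrite mulr0 in h; move/cvgrPdist_lt/(_ _ e0) : h.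
apply: filterS => n; rewrite sub0r normrN => hn; apply: eA => /=.
  by rewrite opprB addrC subrK.
by rewrite ltrBlDr ltrDl mulr_gt0.
Qed.

Lemma invS_le n m : (n <= m)%N -> m.+1%:R^-1 <= n.+1%:R^-1 :> R.
Proof. by move=> nm; rewrite lef_pV2 ?posrE// ler_nat. Qed.

Lemma invS_small (e : R) : 0 < e -> exists n, n.+1%:R^-1 < e.
Proof.
move=> e0; have := @cvg_harmonic R => /cvgrPdist_lt/(_ _ e0)[n _ /(_ n (leqnn n))].
by rewrite sub0r normrN => h; exists n; exact: le_lt_trans (ler_norm _) h.
Qed.

Lemma FTC_oo f g F (a b la lb : R) : a < b ->
  (forall x, a < x < b -> 0 <= f x) -> (forall x, a < x < b -> 0 <= g x) ->
  (forall x, a < x < b -> {for x, continuous f}) ->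
  (forall x, a < x < b -> {for x, continuous g}) ->
  (forall x, a < x < b -> deriv_at F x (f x - g x)) ->
  F x @[x --> a^'+] --> la -> F x @[x --> b^'-] --> lb ->
  (\int[leb]_(x in `]a, b[) (g x)%:E < +oo)%E ->
  (\int[leb]_(x in `]a, b[) (f x)%:E = \int[leb]_(x in `]a, b[) (g x)%:E + (lb - la)%:E)%E.
Proof.
move=> ab f0 g0 cf cg dF Fa Fb goo.
(* With a third of the length, the interval [a + c / (n + 1), b - c / (n + 1)] is nondegenerate
   already for n = 0. *)
pose c := (b - a) / 3; have c0 : 0 < c by rewrite divr_gt0// subr_gt0.
have ci n : c * n.+1%:R^-1 <= c.
  by rewrite ler_piMr ?(ltW c0)// invf_le1// ler1n.
have cp n : 0 < c * n.+1%:R^-1 by rewrite mulr_gt0.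
have bE : b = a + 3 * c by rewrite /c; field.
clearbody c.
apply: (@FTC_exhaust f g F _ (fun n => a + c * n.+1%:R^-1) (fun n => b - c * n.+1%:R^-1)) => //.
- by move=> n /=; have := ci n; have := cp n; move: (c * _) => y; lra.
- by move=> n m nm; rewrite lerD2l ler_pM2l// invS_le.
- by move=> n m nm; rewrite lerD2l lerN2 ler_pM2l// invS_le.
- apply/seteqP; split=> x /=.
    rewrite in_itv/= => /andP[ax xb].
    have [|n hn] := @invS_small (Num.min (x - a) (b - x) / c).
      by rewrite divr_gt0// lt_min !subr_gt0 ax.
    exists n => //=; rewrite in_itv/=.
    move: hn; rewrite ltr_pdivlMr// lt_min mulrC; move: (c * _) => y /andP[h1 h2].
    by apply/andP; split; lra.
  move=> [n _] /=; rewrite !in_itv/= => /andP[h1 h2]; have := cp n; move: h1 h2.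
  by move: (c * _) => y h1 h2 h; apply/andP; split; lra.
by apply: cvgB; [exact: cvg_at_left_seq Fb|exact: cvg_at_right_seq Fa].
Qed.

Lemma FTC_oy f g F (a la lb : R) :
  (forall x, a < x -> 0 <= f x) -> (forall x, a < x -> 0 <= g x) ->
  (forall x, a < x -> {for x, continuous f}) ->
  (forall x, a < x -> {for x, continuous g}) ->
  (forall x, a < x -> deriv_at F x (f x - g x)) ->
  F x @[x --> a^'+] --> la -> F x @[x --> +oo] --> lb ->
  (\int[leb]_(x in `]a, +oo[) (g x)%:E < +oo)%E ->
  (\int[leb]_(x in `]a, +oo[) (f x)%:E =
   \int[leb]_(x in `]a, +oo[) (g x)%:E + (lb - la)%:E)%E.
Proof.
move=> f0 g0 cf cg dF Fa Fb goo.
have i1 n : n.+1%:R^-1 <= 1 :> R by rewrite invf_le1// ler1n.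
(* At n = 0 the left end is a + 1, so the right end starts at a + 2. *)
apply: (@FTC_exhaust f g F _ (fun n => a + 1 * n.+1%:R^-1) (fun n => n%:R + (a + 2))) => //.
- move=> n /=; have := i1 n; have : 0 <= n%:R :> R by [].
  by rewrite mul1r; move: (n.+1%:R^-1) (n%:R) => y z; lra.
- by move=> n m nm; rewrite lerD2l ler_pM2l// invS_le.
- by move=> n m nm; rewrite lerD2r ler_nat.
- apply/seteqP; split=> x /=.
    rewrite in_itv/= andbT => ax.
    have [|n hn] := @invS_small (x - a); first by rewrite subr_gt0.
    have [m hm] : exists m : nat, x - (a + 2) <= m%:R.
      exists (Num.truncn `|x - (a + 2)|).+1; apply: le_trans (ler_norm _) _.
      by apply/ltW; exact: truncnS_gt.
    exists (maxn n m) => //=; rewrite in_itv/= mul1r.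
    have := invS_le (leq_maxl n m); have : m%:R <= (maxn n m)%:R :> R.
      by rewrite ler_nat leq_maxr.
    move: hn hm; move: (n.+1%:R^-1) ((maxn n m).+1%:R^-1) (m%:R) ((maxn n m)%:R).
    by move=> y z y' z' *; apply/andP; split; lra.
  move=> [n _] /=; rewrite !in_itv/= andbT => /andP[h1 _].
  by apply: lt_le_trans h1; rewrite ltrDl mulr_gt0.
- by move=> x /=; rewrite in_itv/= andbT; exact: f0.
- by move=> x /=; rewrite in_itv/= andbT; exact: g0.
- by move=> x /=; rewrite in_itv/= andbT; exact: cf.
- by move=> x /=; rewrite in_itv/= andbT; exact: cg.
- by move=> x /=; rewrite in_itv/= andbT; exact: dF.
apply: cvgB; last by apply: cvg_at_right_seq.
apply: (cvg_comp (fun n : nat => n%:R + (a + 2)) F _ Fb).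
apply/cvgryPge => A; have /cvgryPge/(_ (A - (a + 2))) := @cvgr_idn R.
by apply: filterS => n; rewrite lerBlDr.
Qed.

End exhaustion.

(** * Integrals of powers *)

Section power_integrals.
Variable R : realType.
Local Notation leb := (@lebesgue_measure R).
Implicit Types (a b c d e s x : R).

Lemma continuous_powR a x : 0 < x -> {for x, continuous (fun y => y `^ a)}.
Proof.
move=> x0; apply/differentiable_continuous/derivable1_diffP.
by have [] := is_derive1_powR a x0.
Qed.

Lemma powRN_cvg_pinfty a : 0 < a -> x `^ (- a) @[x --> +oo] --> (0 : R).
Proof.
move=> a0; apply/cvgrPdist_le => e e0; near=> x.
have x0 : 0 < x by near: x; exact: nbhs_pinfty_gt.
rewrite sub0r normrN ger0_norm ?powR_ge0// powRN -[leRHS]invrK lef_pV2 ?posrE ?powR_gt0 ?invr_gt0//.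
have -> : e^-1 = ((e^-1) `^ (a^-1)) `^ a.
  by rewrite -powRrM mulVf ?gt_eqF// powRr1// invr_ge0 ltW.
rewrite ge0_ler_powR ?nnegrE ?powR_ge0 ?(ltW a0) ?(ltW x0)//.
Unshelve. all: by end_near. Qed.

Lemma shift_cvg_at_right (f : R -> R) (d l : R) : f x @[x --> 0^'+] --> l ->
  f (x - d) @[x --> d^'+] --> l.
Proof.
move=> fl; apply: (cvg_comp (fun x => x - d) f _ fl) => A [e /= e0 eA].
exists e => //= x; rewrite /= => xe dx; apply: eA => /=; last by rewrite subr_gt0.
by rewrite sub0r normrN -normrN opprB.
Qed.

Lemma is_derive_sub_cst (d x : R) : is_derive x 1 (fun y : R => y - d) 1.
Proof. by apply: is_derive_eq; rewrite subr0. Qed.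

Lemma is_derive_powR_shift a d x : d < x ->
  is_derive x 1 (fun y => (y - d) `^ a) (a * (x - d) `^ (a - 1)).
Proof.
move=> dx; have d1 : is_derive (x - d) 1 (fun y : R => y `^ a) (a * (x - d) `^ (a - 1)).
  by apply: is_derive1_powR; rewrite subr_gt0.
have := @is_derive1_comp _ (fun y => y `^ a) (fun y => y - d) x _ _ d1 (is_derive_sub_cst d x).
by rewrite mulr1.
Qed.

Lemma integral_powR_near0 s d : 0 < s -> 0 < d ->
  (\int[leb]_(x in `]0%R, d[) (x `^ (s - 1))%:E = (d `^ s / s)%:E)%E.
Proof.
move=> s0 d0.
rewrite (@FTC_oo _ (fun x => x `^ (s - 1)) (fun=> 0) (fun x => s^-1 * x `^ s) 0 d
  (s^-1 * 0) (s^-1 * d `^ s) d0).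
- by rewrite integral0 add0e mulr0 subr0 mulrC.
- by move=> x _; exact: powR_ge0.
- by [].
- by move=> x /andP[x0 _]; exact: continuous_powR.
- by move=> x _; exact: cvg_cst.
- move=> x /andP[x0 _]; rewrite subr0.
  have := is_deriveZ s^-1 (is_derive1_powR s x0).
  by move=> h; apply: is_derive_eq h _; rewrite -[LHS]/(_ * _) mulKf ?gt_eqF.
- by apply: cvgM; [exact: cvg_cst|exact: powR_cvg0].
- apply: cvg_at_left_filter; apply: cvgM; first exact: cvg_cst.
  exact: continuous_powR.
- by rewrite integral0.
Qed.

Lemma integral_powR_tail s e : 0 < s -> 0 < e ->
  (\int[leb]_(x in `]e, +oo[) (x `^ (- 1 - s))%:E = (e `^ (- s) / s)%:E)%E.
Proof.
move=> s0 e0.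
rewrite (@FTC_oy _ (fun x => x `^ (- 1 - s)) (fun=> 0) (fun x => (- s^-1) * x `^ (- s)) e
  ((- s^-1) * e `^ (- s)) ((- s^-1) * 0)).
- by rewrite integral0 add0e mulr0 sub0r mulNr opprK mulrC.
- by move=> x _; exact: powR_ge0.
- by [].
- by move=> x x0; apply: continuous_powR; exact: lt_trans x0.
- by move=> x _; exact: cvg_cst.
- move=> x ex; rewrite subr0; have x0 := lt_trans e0 ex.
  have h := is_deriveZ (- s^-1) (is_derive1_powR (- s) x0).
  apply: is_derive_eq h _; rewrite -[LHS]/(_ * _) mulrA mulrNN mulVf ?gt_eqF// mul1r.
  by congr (_ `^ _); ring.
- apply: cvg_at_right_filter; apply: cvgM; first exact: cvg_cst.
  exact: continuous_powR.
- by apply: cvgM; [exact: cvg_cst|exact: powRN_cvg_pinfty].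
- by rewrite integral0.
Qed.

(* Bernoulli: (1 - d/x)^s >= 1 - d/x. *)
Lemma powR_sub_le s d x : 0 < s -> s <= 1 -> 0 <= d -> d <= x -> 0 < x ->
  x `^ s - (x - d) `^ s <= d * x `^ (s - 1).
Proof.
move=> s0 s1 d0 dx x0; pose y := (x - d) / x.
have y0 : 0 <= y by rewrite divr_ge0 ?subr_ge0// ltW.
have y1 : y <= 1 by rewrite ler_pdivrMr// mul1r; lra.
have yx : x - d = y * x by rewrite /y divfK ?gt_eqF.
have ys : y <= y `^ s.
  have [->|yn0] := eqVneq y 0; first exact: powR_ge0.
  have yp : 0 < y by rewrite lt_neqAle eq_sym yn0.
  by apply: ger1_powR; rewrite ?yp.
have -> : x - d = y * x by [].
rewrite powRM ?(ltW x0)//.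
have xs : x `^ s = x * x `^ (s - 1) by rewrite mulr_powRB1// ltW.
have dE : d = x - y * x by rewrite -yx; ring.
rewrite [X in _ <= X * _]dE mulrBl -xs lerD2l lerN2 -mulrA -xs.
by rewrite ler_wpM2r// powR_ge0.
Qed.

Lemma powR_sub_ge0 s d x : 0 < s -> 0 <= d -> d <= x -> 0 <= x `^ s - (x - d) `^ s.
Proof.
move=> s0 d0 dx; rewrite subr_ge0 ge0_ler_powR ?(ltW s0)// ?nnegrE; lra.
Qed.

(** The antiderivative ((x - d)^s - x^s) / s tends to 0 at infinity, since [powR_sub_le] bounds its
    size by d x^(s-1) / s; only the boundary term at d remains. *)
Lemma integral_powR_shift_diff s d : 0 < s -> s < 1 -> 0 < d ->
  (\int[leb]_(x in `]d, +oo[) ((x - d) `^ (s - 1) - x `^ (s - 1))%:E = (d `^ s / s)%:E)%E.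
Proof.
move=> s0 s1 d0.
rewrite (@FTC_oy _ (fun x => (x - d) `^ (s - 1) - x `^ (s - 1)) (fun=> 0)
  (fun x => s^-1 * ((x - d) `^ s - x `^ s)) d (s^-1 * (0 - d `^ s)) (s^-1 * 0)).
- by rewrite integral0 add0e mulr0 sub0r sub0r mulrN opprK mulrC.
- move=> x dx; have x0 := lt_trans d0 dx; have xd0 : 0 < x - d by rewrite subr_gt0.
  rewrite subr_ge0 -[s - 1]opprB !powRN lef_pV2 ?posrE ?powR_gt0//.
  by rewrite ge0_ler_powR ?nnegrE ?subr_ge0 ?(ltW s1) ?(ltW x0) ?(ltW dx)// gerBl ltW.
- by [].
- move=> x dx; have x0 := lt_trans d0 dx.
  have cd : {for x, continuous (fun y => (y - d) `^ (s - 1))}.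
    apply/differentiable_continuous/derivable1_diffP.
    by have [] := is_derive_powR_shift (s - 1) dx.
  by apply: cvgB; [exact: cd|exact: continuous_powR].
- by move=> x _; exact: cvg_cst.
- move=> x dx; rewrite subr0; have x0 := lt_trans d0 dx.
  have h := is_deriveZ s^-1 (is_deriveB (is_derive_powR_shift s dx) (is_derive1_powR s x0)).
  apply: is_derive_eq h _; rewrite -[LHS]/(_ * _) -mulrBr mulKf// gt_eqF//.
- apply: cvgM; first exact: cvg_cst.
  apply: cvgB.
    exact: (@shift_cvg_at_right (fun y => y `^ s) d 0 (powR_cvg0 s0)).
  by apply: cvg_at_right_filter; exact: continuous_powR.
- apply: cvgM; first exact: cvg_cst.
  apply: (@squeeze_cvgr _ _ _ _ (fun x => - (d * x `^ (- (1 - s)))) (fun=> 0)).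
  + near=> x; have x0 : 0 < x by near: x; exact: nbhs_pinfty_gt.
    have dx : d <= x by near: x; apply: nbhs_pinfty_ge; exact: num_real.
    have := powR_sub_le s0 (ltW s1) (ltW d0) dx x0.
    have := powR_sub_ge0 s0 (ltW d0) dx.
    by rewrite opprB => h1 h2; apply/andP; split; lra.
  + rewrite -[X in _ --> X]oppr0 -(mulr0 d); apply: cvgN; apply: cvgM; first exact: cvg_cst.
    by apply: powRN_cvg_pinfty; rewrite subr_gt0.
  + exact: cvg_cst.
- by rewrite integral0.
Unshelve. all: by end_near. Qed.

(** An incomplete Beta integral that is elementary because the exponents add up to -2: - (x - r)^s
    r^(-s) / (s x) is an antiderivative. *)
Lemma integral_powR_beta s e x : 0 < s -> 0 < e -> e < x ->
  (\int[leb]_(r in `]e, x[) (r `^ (- 1 - s) * (x - r) `^ (s - 1))%:E =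
   ((x - e) `^ s * e `^ (- s) / (s * x))%:E)%E.
Proof.
move=> s0 e0 ex; have x0 := lt_trans e0 ex.
have dx r : r < x -> is_derive r 1 (fun r => (x - r) `^ s) (- (s * (x - r) `^ (s - 1))).
  move=> rx; have d1 : is_derive (x - r) 1 (fun y : R => y `^ s) (s * (x - r) `^ (s - 1)).
    by apply: is_derive1_powR; rewrite subr_gt0.
  have d2 : is_derive r 1 (fun y : R => x - y) (- 1).
    by have := is_deriveB (is_derive_cst x r (1 : R)) (is_derive_id r (1 : R)); rewrite sub0r.
  have := @is_derive1_comp _ (fun y => y `^ s) (fun y => x - y) r _ _ d1 d2.
  by rewrite mulrN1.
pose c := - (s * x)^-1.
rewrite (@FTC_oo _ (fun r => r `^ (- 1 - s) * (x - r) `^ (s - 1)) (fun=> 0)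
  (fun r => c * ((x - r) `^ s * r `^ (- s))) e x
  (c * ((x - e) `^ s * e `^ (- s))) (c * (0 * x `^ (- s))) ex).
- by rewrite integral0 add0e mul0r mulr0 sub0r /c mulNr opprK mulrC.
- by move=> r _; rewrite mulr_ge0 ?powR_ge0.
- by [].
- move=> r /andP[er rx]; have r0 := lt_trans e0 er.
  apply: cvgM; first exact: continuous_powR.
  apply: (@continuous_comp _ _ _ (fun y => x - y) (fun y => y `^ (s - 1))).
    by apply: cvgB; [exact: cvg_cst|exact: cvg_id].
  by apply: continuous_powR; rewrite subr_gt0.
- by move=> r _; exact: cvg_cst.
- move=> r /andP[er rx]; rewrite subr0; have r0 := lt_trans e0 er.
  have h := is_deriveZ c (is_deriveM (dx r rx) (is_derive1_powR (- s) r0)).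
  apply: is_derive_eq h _.
  have -> : - s - 1 = - 1 - s by ring.
  have E1 : r `^ (- s) = r * r `^ (- 1 - s).
    rewrite -{2}(powRr1 (ltW r0)) -powRD ?(gt_eqF r0) ?implybT//.
    by congr (_ `^ _); ring.
  have E2 : (x - r) `^ s = (x - r) * (x - r) `^ (s - 1).
    by rewrite mulr_powRB1// subr_ge0 ltW.
  rewrite -[LHS]/(c * ((x - r) `^ s * (- s * r `^ (- 1 - s)) +
    r `^ (- s) * - (s * (x - r) `^ (s - 1)))) E1 E2 /c.
  by field; rewrite !gt_eqF.
- apply: cvg_at_right_filter; apply: cvgM; first exact: cvg_cst.
  apply: cvgM; last exact: continuous_powR.
  apply: (@continuous_comp _ _ _ (fun y => x - y) (fun y => y `^ s)).
    by apply: cvgB; [exact: cvg_cst|exact: cvg_id].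
  by apply: continuous_powR; rewrite subr_gt0.
- apply: cvgM; first exact: cvg_cst.
  apply: cvgM; last by apply: cvg_at_left_filter; exact: continuous_powR.
  apply: (cvg_comp (fun y => x - y) (fun y => y `^ s) _ (powR_cvg0 s0)) => A [d /= d0 dA].
  exists d => //= y; rewrite /= => xy yx; apply: dA => /=; last by rewrite subr_gt0.
  by rewrite sub0r normrN.
- by rewrite integral0.
Qed.

End power_integrals.

(** * Gamma integrals *)

Section gamma_integrals.
Variable R : realType.
Local Notation leb := (@lebesgue_measure R).
Implicit Types (a s x t : R).

Lemma is_derive_expRN t : is_derive t 1 (fun y : R => expR (- y)) (- expR (- t)).
Proof.
have d1 : is_derive t 1 (fun y : R => - y) (-1) by exact: is_deriveNid.
have := @is_derive1_comp _ expR (fun y => - y) t _ _ (is_derive_expR (- t)) d1.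
by rewrite mulrN1.
Qed.

Lemma continuous_expRN t : {for t, continuous (fun y : R => expR (- y))}.
Proof.
apply/differentiable_continuous/derivable1_diffP.
by have [] := is_derive_expRN t.
Qed.

Lemma integral_expRN_tail (c : R) : (\int[leb]_(t in `]c, +oo[) (expR (- t))%:E = (expR (- c))%:E)%E.
Proof.
rewrite (@FTC_oy _ (fun t => expR (- t)) (fun=> 0) (fun t => - expR (- t)) c
  (- expR (- c)) (- 0)).
- by rewrite integral0 add0e oppr0 sub0r opprK.
- by move=> x _; exact: expR_ge0.
- by [].
- by move=> x _; exact: continuous_expRN.
- by move=> x _; exact: cvg_cst.
- move=> x _; rewrite subr0 /deriv_at; have h := is_deriveN (is_derive_expRN x).
  by apply: is_derive_eq h _; rewrite opprK.
- by apply: cvg_at_right_filter; apply: cvgN; exact: continuous_expRN.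
- by apply: cvgN; exact: cvgr_expR.
- by rewrite integral0.
Qed.

Lemma powR_expRN_cvg_pinfty s : s < 1 -> t `^ s * expR (- t) @[t --> +oo] --> (0 : R).
Proof.
(* The majorant comes from t / 2 <= e^(t/2), that is t^2 <= 4 e^t. *)
move=> s1; apply: (@squeeze_cvgr _ _ _ _ (fun=> 0) (fun t => 4 * t `^ (- (2 - s)))).
- near=> t; have t0 : 0 < t by near: t; exact: nbhs_pinfty_gt.
  rewrite mulr_ge0 ?powR_ge0 ?expR_ge0//=.
  have -> : - (2 - s) = s - 2%:R by ring.
  rewrite powRB ?(gt_eqF t0) ?implybT// mulrCA ler_wpM2l ?powR_ge0//.
  rewrite powR_mulrn ?(ltW t0)// expRN ler_pdivlMr ?exprn_gt0// mulrC ler_pdivrMr ?expR_gt0//.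
  have h := expR_ge1Dx (t / 2).
  have -> : expR t = expR (t / 2) ^+ 2 by rewrite -expRM_natl; congr expR; field.
  by nra.
- exact: cvg_cst.
rewrite -(mulr0 (4 : R)); apply: cvgM; first exact: cvg_cst.
by apply: powRN_cvg_pinfty; lra.
Unshelve. all: by end_near. Qed.

Lemma measurable_gamma_integrand a (D : set R) :
  measurable_fun D (fun t => (t `^ a * expR (- t))%:E).
Proof.
apply: (@measurable_funS _ _ _ _ setT) => //; apply/measurable_EFinP.
apply: measurable_funM; first exact: measurable_powR.
by apply: measurableT_comp => //; exact: measurable_oppr.
Qed.

(** Split at 1: before it the power alone is an integrable majorant, after it the exponential
    alone. *)
Lemma gamma_integral_lty a : 0 < a -> a < 1 ->
  (\int[leb]_(t in `]0%R, +oo[) (t `^ (a - 1) * expR (- t))%:E < +oo)%E.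
Proof.
move=> a0 a1.
rewrite (@itv_bndbnd_setU _ _ _ (BRight 1)) ?bnd_simp//.
rewrite ge0_integral_setU//; first last.
- apply/disj_setPS => x [/=]; rewrite !in_itv/= => /andP[_ x1] /andP[x1' _].
  by move: (lt_le_trans x1' x1); rewrite ltxx.
- by move=> x _; rewrite lee_fin mulr_ge0 ?powR_ge0 ?expR_ge0.
- exact: measurable_gamma_integrand.
apply: lte_add_pinfty.
- rewrite -integral_itv_bndo_bndc; last exact: measurable_gamma_integrand.
  apply: (@le_lt_trans _ _ (\int[leb]_(t in `]0%R, 1%R[) (t `^ (a - 1))%:E)%E).
    apply: ge0_le_integral => //.
    + by move=> x _; rewrite lee_fin mulr_ge0 ?powR_ge0 ?expR_ge0.
    + exact: measurable_gamma_integrand.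
    + by apply: measurable_funTS; apply/measurable_EFinP; exact: measurable_powR.
    move=> x /=; rewrite in_itv/= lee_fin => /andP[x0 _].
    by rewrite ler_piMr ?powR_ge0// -[leRHS]expR0 ler_expR oppr_le0 ltW.
  by rewrite integral_powR_near0// ltry.
apply: (@le_lt_trans _ _ (\int[leb]_(t in `]1%R, +oo[) (expR (- t))%:E)%E).
  apply: ge0_le_integral => //.
  + by move=> x _; rewrite lee_fin mulr_ge0 ?powR_ge0 ?expR_ge0.
  + exact: measurable_gamma_integrand.
  + apply: measurable_funTS; apply/measurable_EFinP; apply: measurableT_comp => //.
  move=> x /=; rewrite in_itv/= lee_fin andbT => x1.
  rewrite ler_piMl ?expR_ge0// -[leRHS](powRr0 x); apply: ler_powR; first exact: ltW.
  by rewrite subr_le0 ltW.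
by rewrite integral_expRN_tail ltry.
Qed.

Lemma gamma_integral_gt0 a : 0 < a -> a < 1 ->
  (0 < \int[leb]_(t in `]0%R, +oo[) (t `^ (a - 1) * expR (- t))%:E)%E.
Proof.
(* The value of the integrand at 2, a lower bound on ]1, 2[ because both factors decrease when a <
   1. *)
move=> a0 a1; pose c : R := 2 `^ (a - 1) * expR (- 2).
have c0 : 0 < c by rewrite mulr_gt0 ?powR_gt0 ?expR_gt0.
apply: (@lt_le_trans _ _ (\int[leb]_(t in `]1%R, 2%R[) (c%:E))%E).
  rewrite integral_cst//= lebesgue_measure_itv/= lte_fin ltr1n -EFinB.
  by apply: mule_gt0; rewrite lte_fin//; lra.
apply: (@le_trans _ _ (\int[leb]_(t in `]1%R, 2%R[) (t `^ (a - 1) * expR (- t))%:E)%E).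
  apply: ge0_le_integral => //.
  - by move=> x _; rewrite lee_fin ltW.
  - exact: measurable_gamma_integrand.
  move=> x /=; rewrite in_itv/= lee_fin => /andP[x1 x2].
  rewrite ler_pM ?powR_ge0 ?expR_ge0//; last by rewrite ler_expR lerN2 ltW.
  rewrite -[a - 1]opprB !powRN lef_pV2 ?posrE ?powR_gt0//; last by rewrite (lt_trans _ x1).
  by rewrite ge0_ler_powR ?subr_ge0 ?(ltW a1) ?nnegrE ?(ltW x2)// (le_trans _ (ltW x1)).
apply: ge0_subset_integral => //.
- exact: measurable_gamma_integrand.
- by move=> x _; rewrite lee_fin mulr_ge0 ?powR_ge0 ?expR_ge0.
move=> x /=; rewrite !in_itv/= => /andP[x1 _]; rewrite andbT.
by rewrite (lt_trans _ x1).
Qed.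

Lemma GammaE a : 0 < a -> a < 1 ->
  (\int[leb]_(t in `]0%R, +oo[) (t `^ (a - 1) * expR (- t))%:E = (Gamma a)%:E)%E.
Proof.
move=> a0 a1; rewrite /Gamma /Rintegral fineK// ge0_fin_numE ?gamma_integral_lty//.
by apply/ltW; exact: gamma_integral_gt0.
Qed.

Lemma Gamma_gt0 a : 0 < a -> a < 1 -> 0 < Gamma a.
Proof. by move=> a0 a1; rewrite -lte_fin -GammaE// gamma_integral_gt0. Qed.

Lemma GammaS s : 0 < s -> s < 1 -> Gamma (1 + s) = s * Gamma s.
Proof.
move=> s0 s1; rewrite {1}/Gamma /Rintegral.
have -> : 1 + s - 1 = s by ring.
have gE : (\int[leb]_(t in `]0%R, +oo[) (s * (t `^ (s - 1) * expR (- t)))%:E =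
    (s * Gamma s)%:E)%E.
  under eq_integral do rewrite EFinM.
  rewrite ge0_integralZl_EFin ?(ltW s0)//.
  - by rewrite GammaE.
  - by move=> x _; rewrite lee_fin mulr_ge0 ?powR_ge0 ?expR_ge0.
  - exact: measurable_gamma_integrand.
rewrite (@FTC_oy _ (fun t => t `^ s * expR (- t)) (fun t => s * (t `^ (s - 1) * expR (- t)))
  (fun t => - (t `^ s * expR (- t))) 0 (- (0 * expR (- 0))) (- 0)).
- by rewrite gE mul0r oppr0 subrr adde0.
- by move=> x _; rewrite mulr_ge0 ?powR_ge0 ?expR_ge0.
- by move=> x _; rewrite !mulr_ge0 ?powR_ge0 ?expR_ge0 ?ltW.
- by move=> x x0; apply: cvgM; [exact: continuous_powR|exact: continuous_expRN].
- move=> x x0; apply: cvgM; first exact: cvg_cst.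
  by apply: cvgM; [exact: continuous_powR|exact: continuous_expRN].
- move=> x x0; have h := is_deriveN (is_deriveM (is_derive1_powR s x0) (is_derive_expRN x)).
  apply: is_derive_eq h _.
  rewrite -[LHS]/(- (x `^ s * - expR (- x) + expR (- x) * (s * x `^ (s - 1)))).
  by ring.
- apply: cvgN; apply: cvgM; first exact: powR_cvg0.
  by apply: cvg_at_right_filter; exact: continuous_expRN.
- by apply: cvgN; exact: powR_expRN_cvg_pinfty.
- by rewrite gE ltry.
Qed.

(** The Marchaud integral of the exponential, by parts against - r^(-s) / s. The boundary term
    vanishes at 0 because 1 - e^(-r) <= r leaves r^(1-s), and at infinity because r^(-s) tends to
    0. *)
Lemma integral_powR_1BexpRN s : 0 < s -> s < 1 ->
  (\int[leb]_(r in `]0%R, +oo[) (r `^ (- 1 - s) * (1 - expR (- r)))%:E =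
   (Gamma (1 - s) / s)%:E)%E.
Proof.
move=> s0 s1.
have s10 : 0 < 1 - s by rewrite subr_gt0.
have s11 : 1 - s < 1 by rewrite ltrBlDr ltrDl.
have e1 x : 0 < x -> 0 <= 1 - expR (- x).
  by move=> x0; rewrite subr_ge0 -[leRHS]expR0 ler_expR oppr_le0 ltW.
have gE : (\int[leb]_(r in `]0%R, +oo[) (s^-1 * (r `^ (1 - s - 1) * expR (- r)))%:E =
    (Gamma (1 - s) / s)%:E)%E.
  under eq_integral do rewrite EFinM.
  rewrite ge0_integralZl_EFin ?invr_ge0 ?(ltW s0)//.
  - by rewrite GammaE// -EFinM mulrC.
  - by move=> x _; rewrite lee_fin mulr_ge0 ?powR_ge0 ?expR_ge0.
  - exact: measurable_gamma_integrand.
rewrite (@FTC_oy _ (fun r => r `^ (- 1 - s) * (1 - expR (- r)))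
  (fun r => s^-1 * (r `^ (1 - s - 1) * expR (- r)))
  (fun r => - s^-1 * (r `^ (- s) * (1 - expR (- r)))) 0 (- s^-1 * 0) (- s^-1 * 0)).
- by rewrite gE mulr0 subrr adde0.
- by move=> x x0; rewrite mulr_ge0 ?powR_ge0 ?e1.
- by move=> x _; rewrite !mulr_ge0 ?powR_ge0 ?expR_ge0 ?invr_ge0 ?ltW.
- move=> x x0; apply: cvgM; first exact: continuous_powR.
  by apply: cvgB; [exact: cvg_cst|exact: continuous_expRN].
- move=> x x0; apply: cvgM; first exact: cvg_cst.
  by apply: cvgM; [exact: continuous_powR|exact: continuous_expRN].
- move=> x x0; have d1 := is_deriveB (is_derive_cst (1 : R) x (1 : R)) (is_derive_expRN x).
  have h := is_deriveZ (- s^-1) (is_deriveM (is_derive1_powR (- s) x0) d1).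
  apply: is_derive_eq h _.
  rewrite -[LHS]/(- s^-1 * (x `^ (- s) * (0 - - expR (- x)) +
    (1 - expR (- x)) * (- s * x `^ (- s - 1)))).
  have -> : - s - 1 = - 1 - s by ring.
  have -> : 1 - s - 1 = - s by ring.
  by field; rewrite gt_eqF.
- apply: cvgM; first exact: cvg_cst.
  apply: (@squeeze_cvgr _ _ _ _ (fun=> 0) (fun r => r `^ (1 - s))).
  + near=> r; have r0 : 0 < r by near: r; exact: nbhs_right_gt.
    rewrite mulr_ge0 ?powR_ge0 ?e1//=.
    rewrite powRD ?(gt_eqF r0) ?implybT// mulrC ler_wpM2r ?powR_ge0// powRr1 ?(ltW r0)//.
    by have := expR_ge1Dx (- r); lra.
  + exact: cvg_cst.
  + exact: powR_cvg0.
- apply: cvgM; first exact: cvg_cst.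
  apply: (@squeeze_cvgr _ _ _ _ (fun=> 0) (fun r => r `^ (- s))).
  + near=> r; have r0 : 0 < r by near: r; exact: nbhs_pinfty_gt.
    rewrite mulr_ge0 ?powR_ge0 ?e1//= ler_piMr ?powR_ge0// gerBl expR_ge0//.
  + exact: cvg_cst.
  + exact: powRN_cvg_pinfty.
- by rewrite gE ltry.
Unshelve. all: by end_near. Qed.

End gamma_integrals.

(** * Marchaud inversion on the line *)

Section real_fubini.
Context d1 d2 (T1 : measurableType d1) (T2 : measurableType d2) (R : realType).
Variables (m1 : {sigma_finite_measure set T1 -> \bar R})
  (m2 : {sigma_finite_measure set T2 -> \bar R}).
Variable f : T1 * T2 -> R.
Hypothesis fi : (m1 \x m2)%E.-integrable setT (EFin \o f).

Let mf : measurable_fun setT f.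
Proof. by apply/measurable_EFinP; exact: measurable_int fi. Qed.

Lemma Rintegral12_prod :
  \int[m1]_x (\int[m2]_y f (x, y)) = \int[(m1 \x m2)%E]_p f p.
Proof.
rewrite /Rintegral -(integral12_prod_meas1 fi); congr fine.
apply: ae_eq_integral => //.
- by apply/measurable_EFinP; exact: measurable_parametric_Rintegral.
- exact: measurable_fubini_F fi.
have := ae_integrable1 fi; apply: filterS => x ix _.
by rewrite fineK//; exact: integrable_fin_num.
Qed.

Lemma Rintegral21_prod :
  \int[m2]_y (\int[m1]_x f (x, y)) = \int[(m1 \x m2)%E]_p f p.
Proof.
rewrite /Rintegral -(integral21_prod_meas1 fi); congr fine.
apply: ae_eq_integral => //.
- apply/measurable_EFinP.
  apply: (@measurable_parametric_Rintegral _ _ _ _ _ _ (fun p => f (p.2, p.1))).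
  by apply: (measurableT_comp mf); apply/measurable_fun_pair.
- exact: measurable_fubini_G fi.
have := ae_integrable2 fi; apply: filterS => x ix _.
by rewrite fineK//; exact: integrable_fin_num.
Qed.

Lemma Rintegral_fubini :
  \int[m1]_x (\int[m2]_y f (x, y)) = \int[m2]_y (\int[m1]_x f (x, y)).
Proof. by rewrite Rintegral12_prod Rintegral21_prod. Qed.

End real_fubini.

Lemma integrable_prod_mul d1 d2 (T1 : measurableType d1) (T2 : measurableType d2)
    (R : realType) (m1 : {sigma_finite_measure set T1 -> \bar R})
    (m2 : {sigma_finite_measure set T2 -> \bar R}) (a : T1 -> R) (b : T2 -> R)
    (c : T1 * T2 -> R) (M : R) :
  m1.-integrable setT (EFin \o a) -> m2.-integrable setT (EFin \o b) ->
  measurable_fun setT c -> (forall p, `|c p| <= M) ->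
  (m1 \x m2)%E.-integrable setT (fun p => (a p.1 * b p.2 * c p)%:E).
Proof.
move=> ia ib mc cM.
have ma : measurable_fun setT a by apply/measurable_EFinP; exact: measurable_int ia.
have mb : measurable_fun setT b by apply/measurable_EFinP; exact: measurable_int ib.
have mab : measurable_fun setT (fun p : T1 * T2 => a p.1 * b p.2).
  apply: measurable_funM; first exact: (measurableT_comp ma measurable_fst).
  exact: (measurableT_comp mb measurable_snd).
have iab : (m1 \x m2)%E.-integrable setT (fun p => (a p.1 * b p.2)%:E).
  apply/integrable12ltyP; first exact/measurable_EFinP.
  have /integrableP[_ oa] := ia; have /integrableP[_ ob] := ib.
  have b_ge0 : (0 <= \int[m2]_y `|(b y)%:E|)%E by exact: integral_ge0.
  have bfin : (\int[m2]_y `|(b y)%:E|)%E \is a fin_num by rewrite ge0_fin_numE.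
  rewrite (eq_integral (fun x => `|(a x)%:E| * \int[m2]_y `|(b y)%:E|)%E).
    rewrite ge0_integralZr//; last by apply: measurableT_comp => //; exact/measurable_EFinP.
    have a_ge0 : (0 <= \int[m1]_x `|(a x)%:E|)%E by exact: integral_ge0.
    by apply: lte_mul_pinfty => //; rewrite ge0_fin_numE.
  move=> x _ /=; rewrite -ge0_integralZl//.
    by apply: eq_integral => y _; rewrite /= -EFinM normrM.
  by apply/measurable_EFinP; exact: measurableT_comp.
have iM : (m1 \x m2)%E.-integrable setT (fun p => (M%:E * (a p.1 * b p.2)%:E)%E).
  exact: integrableZl.
apply: le_integrable iM => //.
  by apply/measurable_EFinP; exact: measurable_funM.
move=> p _ /=; rewrite lee_fin !normrM [leRHS]mulrC ler_wpM2l ?mulr_ge0//.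
by rewrite (le_trans (cM p))// ler_norm.
Qed.

Section lebesgue_shift_scale.
Variable R : realType.
Local Notation leb := (@lebesgue_measure R).

Lemma Rintegral_shift b (f : R -> R) : measurable_fun setT f ->
  \int[leb]_x f x = \int[leb]_x f (x + b).
Proof.
move=> mf; rewrite /Rintegral (@integral_shift R b (EFin \o f))//.
exact/measurable_EFinP.
Qed.

Lemma integrable_shift b (f : R -> R) : leb.-integrable setT (EFin \o f) ->
  leb.-integrable setT (fun x => (f (x + b))%:E).
Proof.
move=> /[dup] i /integrableP[mf oo]; apply/integrableP; split.
  by apply: (measurableT_comp mf); exact: measurable_funD.
by rewrite -(@integral_shift R b (fun x => `|(f x)%:E|%E))//; exact: measurableT_comp.
Qed.

Lemma ge0_integral_scale a (g : R -> \bar R) : 0 < a -> measurable_fun setT g ->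
  (forall x, 0 <= g x)%E ->
  (\int[leb]_x g x = a%:E * \int[leb]_x g (a * x)%R)%E.
Proof.
move=> a0 mg g0; rewrite (@ge0_integral_scale_shift _ a 0 g)//.
by under eq_integral do rewrite addr0.
Qed.

Lemma integrable_scale a (f : R -> R) : 0 < a -> leb.-integrable setT (EFin \o f) ->
  leb.-integrable setT (fun x => (f (a * x)%R)%:E).
Proof.
move=> a0 i; have mf : measurable_fun setT (EFin \o f) by exact: measurable_int i.
apply/integrableP; split.
  by apply: (measurableT_comp mf); exact: measurable_funM.
have /integrableP[_] := i.
rewrite (@ge0_integral_scale a (fun x => `|(f x)%:E|%E))//; last exact: measurableT_comp.
move=> oo; rewrite ltNge leye_eq; apply/negP => /eqP E'; move: oo.
by rewrite E' mulry gtr0_sg// mul1e ltxx.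
Qed.

Lemma Rintegral_scale a (f : R -> R) : 0 < a -> leb.-integrable setT (EFin \o f) ->
  \int[leb]_x f x = a * \int[leb]_x f (a * x).
Proof.
move=> a0 i; have mf : measurable_fun setT (EFin \o f) by exact: measurable_int i.
rewrite /Rintegral; have E : (\int[leb]_x (f x)%:E = a%:E * \int[leb]_x (f (a * x)%R)%:E)%E.
  rewrite [LHS]integralE [X in (_ * X)%E]integralE.
  have H1 := ge0_integral_scale a0 (measurable_funepos mf) (fun x => funepos_ge0 _ x).
  have H2 := ge0_integral_scale a0 (measurable_funeneg mf) (fun x => funeneg_ge0 _ x).
  have fin (g : R -> \bar R) : (forall x, 0 <= g x)%E ->
      (a%:E * \int[leb]_x g (a * x)%R < +oo)%E -> (\int[leb]_x g (a * x)%R)%E \is a fin_num.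
    move=> g0 oo; rewrite ge0_fin_numE; last exact: integral_ge0.
    rewrite ltNge leye_eq; apply/negP => /eqP E'; move: oo.
    by rewrite E' mulry gtr0_sg// mul1e ltxx.
  have E1 : (\int[leb]_x ((fun x => (f (a * x))%:E)^\+)%E x =
      \int[leb]_x ((EFin \o f)^\+)%E (a * x)%R)%E.
    by apply: eq_integral => x _; rewrite !funeposE.
  have E2 : (\int[leb]_x ((fun x => (f (a * x))%:E)^\-)%E x =
      \int[leb]_x ((EFin \o f)^\-)%E (a * x)%R)%E.
    by apply: eq_integral => x _; rewrite !funenegE.
  have fP := fin _ (fun x => funepos_ge0 (EFin \o f) x).
  have fN := fin _ (fun x => funeneg_ge0 (EFin \o f) x).
  rewrite -H1 -H2 in fP fN; have {}fP := fP (integral_funepos_lt_pinfty measurableT i).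
  have {}fN := fN (integral_funeneg_lt_pinfty measurableT i); rewrite E1 E2 H1 H2.
  move: fP fN; move: (\int[leb]_x _)%E (\int[leb]_x _)%E => P N' fP fN.
  by rewrite muleBr// fin_num_adde_defl// fin_numN.
rewrite E fineM//.
by apply: integrable_fin_num => //; exact: integrable_scale.
Qed.

End lebesgue_shift_scale.

(** * Marchaud kernels *)

Section marchaud_kernels.
Variables (R : realType) (s : R).
Hypotheses (s0 : 0 < s) (s1 : s < 1).
Local Notation leb := (@lebesgue_measure R).

Lemma integral_if_itv (i : interval R) (f : R -> R) :
  (\int[leb]_x (if x \in i then f x else 0)%:E = \int[leb]_(x in [set` i]) (f x)%:E)%E.
Proof.
rewrite [RHS]integral_mkcond; apply: eq_integral => x _; rewrite patchE.
have -> : (x \in [set` i]) = (x \in i) by rewrite mem_setE.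
by case: ifP.
Qed.

Lemma measurable_if_itv (i : interval R) (f : R -> R) : measurable_fun setT f ->
  measurable_fun setT (fun x => if x \in i then f x else 0).
Proof.
move=> mf; rewrite (_ : (fun x => _) = fun x => f x * \1_[set` i] x).
  by apply: measurable_funM => //; exact: measurable_indic.
apply/funext => x; rewrite indicE mem_setE.
by case: ifP; rewrite ?mulr1 ?mulr0.
Qed.

(** The function x_+^(s-1). It and [kap], the Marchaud weight cut at e, are extended by 0 to the
    whole line so that translations and convolutions leave the domain alone. [kdif] is the kernel
    k. *)
Definition ppow (x : R) : R := if x \in `]0, +oo[ then x `^ (s - 1) else 0.

Definition kap (e r : R) : R := if r \in `]e, +oo[ then r `^ (- 1 - s) else 0.

Definition kdif (d x : R) : R := ppow (x - d) - ppow x.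

Lemma ppow_ge0 x : 0 <= ppow x.
Proof. by rewrite /ppow; case: ifP => // _; exact: powR_ge0. Qed.

Lemma kap_ge0 e x : 0 <= kap e x.
Proof. by rewrite /kap; case: ifP => // _; exact: powR_ge0. Qed.

Lemma measurable_ppow : measurable_fun setT ppow.
Proof. by apply: measurable_if_itv; exact: measurable_powR. Qed.

Lemma measurable_kap e : measurable_fun setT (kap e).
Proof. by apply: measurable_if_itv; exact: measurable_powR. Qed.

Lemma measurable_ppow_sub (d : R) : measurable_fun setT (fun x : R => ppow (x - d)).
Proof. by apply: (measurableT_comp measurable_ppow); exact: measurable_funB. Qed.

Lemma measurable_kdif d : measurable_fun setT (kdif d).
Proof. by apply: measurable_funB; [exact: measurable_ppow_sub|exact: measurable_ppow]. Qed.

Lemma integral_kap e : 0 < e -> (\int[leb]_r (kap e r)%:E = (e `^ (- s) / s)%:E)%E.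
Proof. by move=> e0; rewrite integral_if_itv integral_powR_tail. Qed.

Lemma integrable_kap e : 0 < e -> leb.-integrable setT (EFin \o kap e).
Proof.
move=> e0; apply/integrableP; split; first by apply/measurable_EFinP; exact: measurable_kap.
have -> : (\int[leb]_r `|(EFin \o kap e) r| = \int[leb]_r (kap e r)%:E)%E.
  by apply: eq_integral => r _ /=; rewrite ger0_norm// kap_ge0.
by rewrite integral_kap// ltry.
Qed.

Lemma Rintegral_kap e : 0 < e -> \int[leb]_r kap e r = e `^ (- s) / s.
Proof. by move=> e0; rewrite /Rintegral integral_kap. Qed.

Lemma powR_shift_ge0 d x : 0 < d -> d < x -> x `^ (s - 1) <= (x - d) `^ (s - 1).
Proof.
move=> d0 dx; have x0 := lt_trans d0 dx; have xd0 : 0 < x - d by rewrite subr_gt0.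
rewrite -[s - 1]opprB !powRN lef_pV2 ?posrE ?powR_gt0//.
by rewrite ge0_ler_powR ?nnegrE ?subr_ge0 ?(ltW s1) ?(ltW x0) ?(ltW dx)// gerBl ltW.
Qed.

(** The kernel is - x^(s-1) on ]0, d] and nonnegative beyond d; each of the two parts contributes
    d^s / s. *)
Lemma integral_abs_kdif d : 0 < d ->
  (\int[leb]_x `|kdif d x|%:E = (2 * d `^ s / s)%:E)%E.
Proof.
move=> d0.
have kE x : `|kdif d x|%:E = ((if x \in `]0%R, d] then x `^ (s - 1) else 0)%:E +
    (if x \in `]d, +oo[ then (x - d) `^ (s - 1) - x `^ (s - 1) else 0)%:E)%E.
  rewrite /kdif /ppow !in_itv/= !andbT subr_gt0 -EFinD; congr (_%:E).
  have [dx|xd] := ltP d x.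
    rewrite (lt_trans d0 dx) /= add0r ger0_norm// subr_ge0.
    exact: powR_shift_ge0.
  by case: ltP => _; rewrite ?sub0r ?subr0 ?normrN ?addr0 ?normr0// ger0_norm// powR_ge0.
under eq_integral do rewrite kE.
have m1 : measurable_fun setT (fun x => (if x \in `]0%R, d] then x `^ (s - 1) else 0)%:E).
  by apply/measurable_EFinP; apply: measurable_if_itv; exact: measurable_powR.
have m2 : measurable_fun setT (fun x =>
    (if x \in `]d, +oo[ then (x - d) `^ (s - 1) - x `^ (s - 1) else 0)%:E).
  apply/measurable_EFinP; apply: measurable_if_itv; apply: measurable_funB.
    apply: (measurableT_comp (@measurable_powR R (s - 1))); exact: measurable_funB.
  exact: measurable_powR.
rewrite ge0_integralD//; last 2 first.
- by move=> x _; case: ifP => // _; rewrite lee_fin powR_ge0.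
- move=> x _; case: ifP => //; rewrite in_itv/= andbT => dx.
  by rewrite lee_fin subr_ge0 powR_shift_ge0.
rewrite !integral_if_itv integral_powR_shift_diff// -integral_itv_bndo_bndc; last first.
  by apply: measurable_funTS; apply/measurable_EFinP; exact: measurable_powR.
rewrite integral_powR_near0// -EFinD; congr (_%:E).
by field; rewrite gt_eqF.
Qed.

Lemma integrable_kdif d : 0 < d -> leb.-integrable setT (EFin \o kdif d).
Proof.
move=> d0; apply/integrableP; split; first by apply/measurable_EFinP; exact: measurable_kdif.
have -> : (\int[leb]_x `|(EFin \o kdif d) x| = \int[leb]_x `|kdif d x|%:E)%E.
  by apply: eq_integral.
by rewrite integral_abs_kdif// ltry.
Qed.

(** Closed form of the convolution of [kap e] with [ppow]. The inverse of x is written as a power so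
    that measurability of powers applies to it. *)
Definition conv_tail (e x : R) : R :=
  if x \in `]e, +oo[ then (x - e) `^ s * e `^ (- s) * (s^-1 * x `^ (- 1)) else 0.

Lemma integral_conv_tail e x : 0 < e ->
  (\int[leb]_r (kap e r * ppow (x - r))%:E = (conv_tail e x)%:E)%E.
Proof.
move=> e0; rewrite /conv_tail in_itv/= andbT.
have -> : (\int[leb]_r (kap e r * ppow (x - r))%:E =
  \int[leb]_(r in `]e, x[) (r `^ (- 1 - s) * (x - r) `^ (s - 1))%:E)%E.
  rewrite -integral_if_itv; apply: eq_integral => r _; congr (_%:E).
  rewrite /kap /ppow !in_itv/= !andbT subr_gt0.
  by case: (e < r); case: (r < x); rewrite ?mul0r ?mulr0.
case: ltP => ex.
  rewrite integral_powR_beta//; congr (_%:E).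
  by rewrite powR_inv1 ?(ltW (lt_trans e0 ex))// invfM.
rewrite set_itv_ge ?integral_set0// bnd_simp -leNgt//.
Qed.

(** The adjoint of the Marchaud integral truncated at e, applied to x_+^(s-1); the coefficient of
    [ppow] is the mass of [kap e]. At e = 1 this is Psi. *)
Definition marchaud_tail (e x : R) : R := conv_tail e x - e `^ (- s) / s * ppow x.

(** Homogeneity: the degrees -1-s of the weight and s-1 of the power, plus one for the integration,
    add up to -1. *)
Lemma marchaud_tail_scale e x : 0 < e ->
  e * marchaud_tail e (e * x) = marchaud_tail 1 x.
Proof.
move=> e0; rewrite /marchaud_tail /conv_tail /ppow !in_itv/= !andbT.
have -> : (e < e * x) = (1 < x) by rewrite -{1}(mulr1 e) ltr_pM2l.
have -> : (0 < e * x) = (0 < x) by rewrite pmulr_rgt0.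
rewrite !powR1.
have pe : e * e `^ (s - 1) = e `^ s by rewrite mulr_powRB1// ltW.
have pes : e `^ (- s) = (e `^ s)^-1 by rewrite powRN.
have es0 : e `^ s != 0 by rewrite gt_eqF// powR_gt0.
have [x0|x0] := ltP 0 x; last first.
  by rewrite ltNge (le_trans x0)//= !mulr0 subrr mulr0.
rewrite [(e * x) `^ (s - 1)](powRM _ (ltW e0) (ltW x0)).
have [x1|x1] := ltP 1 x.
  rewrite !powR_inv1 ?mulr_ge0 ?(ltW e0) ?(ltW x0)//.
  have -> : e * x - e = e * (x - 1) by ring.
  rewrite powRM ?(ltW e0) ?subr_ge0 ?(ltW x1)// pes -pe.
  have a0 : e `^ (s - 1) != 0 by rewrite gt_eqF// powR_gt0.
  by field; rewrite a0 !gt_eqF.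
rewrite pes -pe.
have a0 : e `^ (s - 1) != 0 by rewrite gt_eqF// powR_gt0.
by field; rewrite a0 !gt_eqF.
Qed.

Lemma measurable_marchaud_tail e : measurable_fun setT (marchaud_tail e).
Proof.
apply: measurable_funB; last by apply: measurable_funM => //; exact: measurable_ppow.
apply: measurable_if_itv; apply: measurable_funM.
  apply: measurable_funM => //; apply: (measurableT_comp (@measurable_powR R s)).
  exact: measurable_funB.
by apply: measurable_funM => //; exact: measurable_powR.
Qed.

(** On ]0, 1] only - x^(s-1) / s is present. Beyond 1 the leading terms cancel, leaving - (x^s - (x
    - 1)^s) / (s x), which [powR_sub_le] bounds by x^(s-2) / s. *)
Lemma integrable_marchaud_tail1 : leb.-integrable setT (EFin \o marchaud_tail 1).
Proof.
have s1' : 0 < 1 - s by rewrite subr_gt0.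
pose g (x : R) : R := s^-1 * (if x \in `]0%R, 1] then x `^ (s - 1) else 0) +
  s^-1 * (if x \in `]1, +oo[ then x `^ (- 1 - (1 - s)) else 0).
have m1 : measurable_fun setT (fun x : R => if x \in `]0%R, 1] then x `^ (s - 1) else 0).
  by apply: measurable_if_itv; exact: measurable_powR.
have m2 : measurable_fun setT (fun x : R => if x \in `]1, +oo[ then x `^ (- 1 - (1 - s)) else 0).
  by apply: measurable_if_itv; exact: measurable_powR.
have n1 (x : R) : 0 <= (if x \in `]0%R, 1] then x `^ (s - 1) else 0).
  by case: ifP => // _; exact: powR_ge0.
have n2 (x : R) : 0 <= (if x \in `]1, +oo[ then x `^ (- 1 - (1 - s)) else 0).
  by case: ifP => // _; exact: powR_ge0.
have i1 : leb.-integrable setT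
    (fun x : R => (s^-1 * (if x \in `]0%R, 1] then x `^ (s - 1) else 0))%:E).
  under eq_fun do rewrite EFinM; apply: integrableZl => //.
  apply/integrableP; split; first exact/measurable_EFinP.
  under eq_integral do rewrite abse_EFin ger0_norm//.
  rewrite integral_if_itv -integral_itv_bndo_bndc; last first.
    by apply: measurable_funTS; apply/measurable_EFinP; exact: measurable_powR.
  by rewrite integral_powR_near0 ?ltry.
have i2 : leb.-integrable setT
    (fun x : R => (s^-1 * (if x \in `]1, +oo[ then x `^ (- 1 - (1 - s)) else 0))%:E).
  under eq_fun do rewrite EFinM; apply: integrableZl => //.
  apply/integrableP; split; first exact/measurable_EFinP.
  under eq_integral do rewrite abse_EFin ger0_norm//.
  by rewrite integral_if_itv integral_powR_tail ?ltry.
have ig : leb.-integrable setT (EFin \o g) by exact: integrableD i1 i2.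
apply: le_integrable ig => //; first by apply/measurable_EFinP; exact: measurable_marchaud_tail.
have sV0 : 0 < s^-1 by rewrite invr_gt0.
move=> x _; rewrite /= lee_fin [leRHS]ger0_norm ?addr_ge0 ?mulr_ge0 ?(ltW sV0)//.
rewrite /g /marchaud_tail /conv_tail /ppow !in_itv/= !andbT powR1 mulr1.
have [x0|x0] := ltP 0 x; last first.
  by rewrite ltNge (le_trans x0)//= !mulr0 subrr normr0 addr0.
have [x1|x1] := ltP 1 x; last first.
  by rewrite mulr0 addr0 sub0r normrN ger0_norm ?mulr_ge0 ?powR_ge0 ?(ltW sV0)// mul1r.
have x0' := ltW x0; rewrite mulr0 add0r.
have h1 := powR_sub_le s0 (ltW s1) ler01 (ltW x1) x0.
have h2 := powR_sub_ge0 s0 ler01 (ltW x1).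
have xs : x `^ (s - 1) = x `^ s * x `^ (- 1).
  by rewrite powRD// (gt_eqF x0) implybT.
have xs2 : x `^ (- 1 - (1 - s)) = x `^ (s - 1) * x `^ (- 1).
  by rewrite -powRD ?(gt_eqF x0) ?implybT//; congr (_ `^ _); ring.
rewrite mul1r in h1; rewrite mul1r xs2.
have -> : (x - 1) `^ s * (s^-1 * x `^ (- 1)) - s^-1 * x `^ (s - 1) =
    - (s^-1 * ((x `^ s - (x - 1) `^ s) * x `^ (- 1))) by rewrite {1}xs; ring.
rewrite normrN ger0_norm ?mulr_ge0 ?(ltW sV0) ?powR_ge0//.
by rewrite ler_wpM2l ?(ltW sV0)// ler_wpM2r// powR_ge0.
Qed.

End marchaud_kernels.

Section bounded_factor.
Variable R : realType.
Local Notation leb := (@lebesgue_measure R).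

Lemma integrable_bounded_factor (a c : R -> R) M : leb.-integrable setT (EFin \o a) ->
  measurable_fun setT c -> (forall x, `|c x| <= M) ->
  leb.-integrable setT (EFin \o (fun x => a x * c x)).
Proof.
move=> ia mc cM.
have ma : measurable_fun setT a by apply/measurable_EFinP; exact: measurable_int ia.
have iM : leb.-integrable setT (fun x => (M%:E * (a x)%:E)%E) by exact: integrableZl.
apply: le_integrable iM => //.
  by apply/measurable_EFinP; exact: measurable_funM.
move=> x _; rewrite /= lee_fin !normrM [leRHS]mulrC ler_wpM2l//.
by rewrite (le_trans (cM x))// ler_norm.
Qed.

Lemma normr_Rintegral_le (f : R -> R) K : measurable_fun setT f ->
  (\int[leb]_x `|f x|%:E <= K%:E)%E ->
  leb.-integrable setT (EFin \o f) /\ `|\int[leb]_x f x| <= K.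
Proof.
move=> mf fK; have fi : leb.-integrable setT (EFin \o f).
  apply/integrableP; split; first exact/measurable_EFinP.
  by rewrite (le_lt_trans _ (ltry K)).
split => //; rewrite (le_trans (le_normr_Rintegral _ fi))// -lee_fin.
by rewrite /Rintegral fineK//; apply: integrable_fin_num => //; exact: integrable_norm.
Qed.

(** Fubini in the variables y = x + r and r, which moves the averaging from [w] onto the kernel
    [k]. *)
Lemma Rintegral_correlation (k a w : R -> R) M :
  leb.-integrable setT (EFin \o k) -> leb.-integrable setT (EFin \o a) ->
  (forall y, leb.-integrable setT (fun r => (a r * k (y - r))%:E)) ->
  measurable_fun setT w -> (forall x, `|w x| <= M) ->
  \int[leb]_x (k x * \int[leb]_r (a r * w (x + r))) =
  \int[leb]_y ((\int[leb]_r (a r * k (y - r))) * w y).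
Proof.
move=> ik ia iak mw wM.
have mk : measurable_fun setT k by apply/measurable_EFinP; exact: measurable_int ik.
have ma : measurable_fun setT a by apply/measurable_EFinP; exact: measurable_int ia.
have mw2 : measurable_fun setT (fun p : R * R => w (p.1 + p.2)).
  by apply: (measurableT_comp mw); exact: measurable_funD.
have iH : (leb \x leb)%E.-integrable setT
    (EFin \o (fun p : R * R => k p.1 * a p.2 * w (p.1 + p.2))).
  exact: (@integrable_prod_mul _ _ _ _ _ leb leb k a _ M).
have mH' : measurable_fun setT (fun p : R * R => a p.2 * k (p.1 - p.2) * w p.1).
  apply: measurable_funM; last exact: (measurableT_comp mw measurable_fst).
  apply: measurable_funM; first exact: (measurableT_comp ma measurable_snd).
  by apply: (measurableT_comp mk); exact: measurable_funB.
(* Joint integrability in the new variables: for fixed r, a translation identifies the inner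
   integral of the absolute value with the one known to be finite from [iH]. *)
have iH' : (leb \x leb)%E.-integrable setT
    (EFin \o (fun p : R * R => a p.2 * k (p.1 - p.2) * w p.1)).
  apply/integrable21ltyP; first exact/measurable_EFinP.
  have [oo _] := @integrable21ltyP _ _ _ _ _ leb leb _ (measurable_int _ iH).
  have {}oo := oo iH.
  apply: le_lt_trans oo; rewrite le_eqVlt; apply/orP; left; apply/eqP; apply: eq_integral => r _.
  rewrite (@integral_shift R r (fun x => `|(a r * k (x - r) * w x)%:E|%E)); last first.
    apply: measurableT_comp => //; apply/measurable_EFinP.
    exact: (measurableT_comp mH' (pair2_measurable r)).
  by apply: eq_integral => x _ /=; rewrite addrK (mulrC (k x)).
transitivity (\int[leb]_x \int[leb]_r (k x * a r * w (x + r))).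
  apply: eq_Rintegral => x _; rewrite -RintegralZl//.
    by apply: eq_Rintegral => r _; rewrite mulrA.
  apply: integrable_bounded_factor ia _ (fun r => wM (x + r)).
  by apply: (measurableT_comp mw); exact: measurable_funD.
rewrite (Rintegral_fubini iH).
transitivity (\int[leb]_r \int[leb]_y (a r * k (y - r) * w y)).
  apply: eq_Rintegral => r _; rewrite [RHS](Rintegral_shift r); last first.
    exact: (measurableT_comp mH' (pair2_measurable r)).
  by apply: eq_Rintegral => x _ /=; rewrite addrK (mulrC (k x)).
rewrite -(Rintegral_fubini iH'); apply: eq_Rintegral => y _ /=.
by rewrite RintegralZr//; exact: iak.
Qed.

End bounded_factor.

(** * Inversion of the truncated Marchaud integral *)

Section marchaud_inversion.
Variables (R : realType) (s : R).
Hypotheses (s0 : 0 < s) (s1 : s < 1).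
Local Notation leb := (@lebesgue_measure R).
Variables (w : R -> R) (M C d : R).
Hypotheses (mw : measurable_fun setT w) (wM : forall x, `|w x| <= M)
  (C0 : 0 <= C) (wC : forall x y, `|w x - w y| <= C * `|x - y|) (d0 : 0 < d).

Let mws (x : R) : measurable_fun setT (fun r : R => w (x + r)).
Proof. by apply: (measurableT_comp mw); exact: measurable_funD. Qed.

(** The Marchaud integral of [w] cut at e, without its constant. At e = 0 it is the full integral,
    which for the orbit of the semigroup is the one in [fracA]. *)
Definition incr_avg (e x : R) : R := \int[leb]_r (kap s e r * (w (x + r) - w x)).

Let integrable_kap_w e x : 0 < e ->
  leb.-integrable setT (EFin \o (fun r => kap s e r * w (x + r))).
Proof.
by move=> e0; apply: integrable_bounded_factor (integrable_kap s0 e0) (mws x) (fun r => wM _).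
Qed.

Lemma incr_avgE e x : 0 < e ->
  incr_avg e x = \int[leb]_r (kap s e r * w (x + r)) - e `^ (- s) / s * w x.
Proof.
move=> e0; rewrite -(Rintegral_kap s0 e0) -RintegralZr//; last exact: integrable_kap.
rewrite -RintegralB//; last 2 first.
- exact: integrable_kap_w.
- exact: integrable_bounded_factor (integrable_kap s0 e0) (measurable_cst (w x)) (fun=> wM x).
by apply: eq_Rintegral => r _; rewrite mulrBr.
Qed.

(** The missing piece lives on ]0, e], where the Lipschitz bound turns r^(-1-s) into C r^(-s), of
    integral C e^(1-s) / (1 - s). Beyond e, [w] is bounded and the weight integrable, which gives
    integrability at e = 0 as well. *)
Lemma incr_avg_sub e x : 0 < e ->
  leb.-integrable setT (EFin \o (fun r => kap s 0 r * (w (x + r) - w x))) /\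
  `|incr_avg 0 x - incr_avg e x| <= C * (e `^ (1 - s) / (1 - s)).
Proof.
move=> e0; have s1' : 0 < 1 - s by rewrite subr_gt0.
pose h r := (kap s 0 r - kap s e r) * (w (x + r) - w x).
have mh : measurable_fun setT h.
  apply: measurable_funM; first by apply: measurable_funB; exact: measurable_kap.
  exact: measurable_funB.
have [ih hle] : leb.-integrable setT (EFin \o h) /\
    `|\int[leb]_r h r| <= C * (e `^ (1 - s) / (1 - s)).
  apply: normr_Rintegral_le => //.
  rewrite EFinM -integral_powR_near0//.
  rewrite [X in (_ * X)%E]integral_itv_bndo_bndc; last first.
    by apply: measurable_funTS; apply/measurable_EFinP; exact: measurable_powR.
  rewrite -integral_if_itv -ge0_integralZl_EFin//; last 2 first.
  - by move=> r _; case: ifP => // _; rewrite lee_fin powR_ge0.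
  - by apply/measurable_EFinP; apply: measurable_if_itv; exact: measurable_powR.
  apply: ge0_le_integral => //.
  - by apply/measurable_EFinP; exact: measurableT_comp.
  - apply/measurable_EFinP; apply: measurable_funM => //.
    by apply: measurable_if_itv; exact: measurable_powR.
  move=> r _; rewrite lee_fin /h /kap !in_itv/= !andbT.
  have [r0|r0] := ltP 0 r; last first.
    by rewrite ltNge (le_trans r0 (ltW e0))/= subrr mul0r mulr0 normr0.
  have [er|re] := ltP e r; first by rewrite subrr mul0r mulr0 normr0.
  rewrite subr0 normrM ger0_norm ?powR_ge0//.
  have := wC (x + r) x; rewrite addrAC subrr add0r (gtr0_norm r0) => h1.
  rewrite (le_trans (ler_wpM2l (powR_ge0 _ _) h1))// mulrCA ler_wpM2l//.
  rewrite -[X in _ * X](@powRr1 _ r) ?(ltW r0)// -powRD; last by rewrite (gt_eqF r0) implybT.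
  by rewrite le_eqVlt; apply/orP; left; apply/eqP; congr (_ `^ _); ring.
have ike : leb.-integrable setT (EFin \o (fun r => kap s e r * (w (x + r) - w x))).
  apply: (@integrable_bounded_factor _ _ _ (M + M)); first exact: integrable_kap.
    exact: measurable_funB.
  by move=> r; rewrite (le_trans (ler_normB _ _))// lerD.
have E r : kap s 0 r * (w (x + r) - w x) = h r + kap s e r * (w (x + r) - w x).
  by rewrite /h; ring.
have i0 : leb.-integrable setT (EFin \o (fun r => kap s 0 r * (w (x + r) - w x))).
  by rewrite (eq_fun E); exact: integrableD ih ike.
split => //; rewrite /incr_avg -RintegralB//.
rewrite (_ : \int[leb]_r _ = \int[leb]_r h r)//.
by apply: eq_Rintegral => r _; rewrite E addrK.
Qed.

Lemma integrable_marchaud_tail e : 0 < e -> leb.-integrable setT (EFin \o marchaud_tail s e).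
Proof.
move=> e0; have eV0 : 0 < e^-1 by rewrite invr_gt0.
have i := integrable_scale eV0 (integrable_marchaud_tail1 s0 s1).
have iZ : leb.-integrable setT (fun x : R => (e^-1)%:E * (marchaud_tail s 1 (e^-1 * x)%R)%:E)%E.
  exact: integrableZl.
rewrite (_ : EFin \o _ = fun x : R => (e^-1)%:E * (marchaud_tail s 1 (e^-1 * x)%R)%:E)%E//.
apply/funext => x /=; rewrite -EFinM -(marchaud_tail_scale s0 _ e0).
by rewrite mulrA mulVf ?gt_eqF// mul1r mulrA mulfV ?gt_eqF// mul1r.
Qed.

Lemma Rintegral_kap_kdif e y : 0 < e ->
  leb.-integrable setT (fun r => (kap s e r * kdif s d (y - r))%:E) /\
  \int[leb]_r (kap s e r * kdif s d (y - r)) = conv_tail s e (y - d) - conv_tail s e y.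
Proof.
move=> e0.
have i z : leb.-integrable setT (EFin \o (fun r => kap s e r * ppow s (z - r))).
  apply/integrableP; split.
    apply/measurable_EFinP; apply: measurable_funM; first exact: measurable_kap.
    by apply: (measurableT_comp (@measurable_ppow R s)); exact: measurable_funB.
  have -> : (\int[leb]_r `|(EFin \o (fun r => kap s e r * ppow s (z - r))%R) r| =
      \int[leb]_r (kap s e r * ppow s (z - r))%:E)%E.
    apply: eq_integral => r _ /=; congr (_%:E); apply: ger0_norm; apply: mulr_ge0.
      exact: kap_ge0.
    exact: ppow_ge0.
  by rewrite integral_conv_tail// ltry.
have E r : kap s e r * kdif s d (y - r) =
    kap s e r * ppow s (y - d - r) - kap s e r * ppow s (y - r).
  by rewrite /kdif mulrBr (addrAC y).
split; first by rewrite (eq_fun (fun r => congr1 EFin (E r))); exact: integrableB (i _) (i _).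
transitivity (\int[leb]_r (kap s e r * ppow s (y - d - r) - kap s e r * ppow s (y - r))).
  by apply: eq_Rintegral => r _; exact: E.
by rewrite RintegralB// /Rintegral !integral_conv_tail.
Qed.

Lemma Rintegral_kdif_incr_avg e : 0 < e ->
  \int[leb]_x (kdif s d x * incr_avg e x) =
  \int[leb]_z (marchaud_tail s 1 z * (w (e * z + d) - w (e * z))).
Proof.
move=> e0; pose c := e `^ (- s) / s.
have ik := integrable_kdif s0 s1 d0; have ia := integrable_kap s0 e0.
have it := integrable_marchaud_tail e0.
have iT := integrable_bounded_factor it mw wM.
have iTd : leb.-integrable setT (EFin \o (fun y => marchaud_tail s e (y - d) * w y)).
  apply: integrable_bounded_factor mw wM; exact: integrable_shift it.
have ikw : leb.-integrable setT (EFin \o (fun x => c * (kdif s d x * w x))).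
  have ikw := integrable_bounded_factor ik mw wM.
  exact: (integrableZl measurableT c ikw).
(* The correlation produces differences of [conv_tail]. Adding and subtracting [c] times the kernel
   completes them to differences of [marchaud_tail]; the extra term is the one that [incr_avgE]
   removes. *)
have first : \int[leb]_x (kdif s d x * \int[leb]_r (kap s e r * w (x + r))) =
    \int[leb]_y (marchaud_tail s e (y - d) * w y - marchaud_tail s e y * w y) +
    \int[leb]_y (c * (kdif s d y * w y)).
  rewrite (Rintegral_correlation ik ia _ mw wM); last first.
    by move=> y; case: (Rintegral_kap_kdif y e0).
  rewrite -RintegralD//; last exact: (integrableB measurableT iTd iT).
  apply: eq_Rintegral => y _; rewrite (Rintegral_kap_kdif y e0).2.
  by rewrite /marchaud_tail /kdif /c; ring.
have iA : leb.-integrable setT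
    (EFin \o (fun x => kdif s d x * \int[leb]_r (kap s e r * w (x + r)))).
  apply: (@integrable_bounded_factor _ _ _ (M * c) ik).
    apply: (@measurable_parametric_Rintegral _ _ R _ R leb
      (fun p : R * R => kap s e p.2 * w (p.1 + p.2))).
    apply: measurable_funM; first exact: (measurableT_comp (@measurable_kap R s e) measurable_snd).
    by apply: (measurableT_comp mw); exact: measurable_funD.
  move=> x; have [||_ h //] := @normr_Rintegral_le _ (fun r => kap s e r * w (x + r)) (M * c).
    by apply: measurable_funM => //; exact: measurable_kap.
  have M0 : 0 <= M by rewrite (le_trans _ (wM 0)).
  rewrite EFinM -integral_kap// -ge0_integralZl_EFin//; last 2 first.
  - by move=> r _; rewrite lee_fin kap_ge0.
  - by apply/measurable_EFinP; exact: measurable_kap.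
  apply: ge0_le_integral => //.
  - apply/measurable_EFinP; apply: measurableT_comp => //; apply: measurable_funM.
      exact: measurable_kap.
    exact: mws.
  - by apply: measurable_funeM; apply/measurable_EFinP; exact: measurable_kap.
  move=> r _; rewrite lee_fin normrM (ger0_norm (kap_ge0 _ _ _)) [leRHS]mulrC ler_wpM2l//.
  exact: kap_ge0.
transitivity (\int[leb]_y (marchaud_tail s e (y - d) * w y - marchaud_tail s e y * w y)).
  rewrite -[RHS](addrK (\int[leb]_y (c * (kdif s d y * w y)))) -first -RintegralB//.
  by apply: eq_Rintegral => x _; rewrite incr_avgE// -/c; ring.
rewrite RintegralB//.
rewrite (Rintegral_shift d) ?(measurable_EFinP _ _).1//; last first.
  by apply/measurable_EFinP; exact: measurable_int iTd.
have mwB : measurable_fun setT (fun y : R => w (y + d) - w y).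
  by apply: measurable_funB => //; apply: (measurableT_comp mw); exact: measurable_funD.
have wB (y : R) : `|w (y + d) - w y| <= M + M by rewrite (le_trans (ler_normB _ _))// lerD.
rewrite -RintegralB//; last exact: (integrable_shift d iTd).
transitivity (\int[leb]_y (marchaud_tail s e y * (w (y + d) - w y))).
  by apply: eq_Rintegral => y _; rewrite addrK mulrBr.
have iTB := integrable_bounded_factor it mwB wB.
rewrite (Rintegral_scale e0 iTB) -RintegralZl//; last exact: integrable_scale e0 iTB.
by apply: eq_Rintegral => z _; rewrite mulrA marchaud_tail_scale.
Qed.

End marchaud_inversion.

(** * Removal of the truncation and value of the constant *)

Section marchaud_limit.
Variables (R : realType) (s : R).
Hypotheses (s0 : 0 < s) (s1 : s < 1).
Local Notation leb := (@lebesgue_measure R).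

Section bounded_lipschitz.
Variables (w : R -> R) (M C d : R).
Hypotheses (mw : measurable_fun setT w) (wM : forall x, `|w x| <= M)
  (C0 : 0 <= C) (wC : forall x y, `|w x - w y| <= C * `|x - y|) (d0 : 0 < d).

Lemma measurable_incr_avg e : measurable_fun setT (incr_avg s w e).
Proof.
apply: (@measurable_parametric_Rintegral _ _ R _ R leb
  (fun p : R * R => kap s e p.2 * (w (p.1 + p.2) - w p.1))).
apply: measurable_funM; first exact: (measurableT_comp (@measurable_kap R s e) measurable_snd).
apply: measurable_funB; last exact: (measurableT_comp mw measurable_fst).
by apply: (measurableT_comp mw); exact: measurable_funD.
Qed.

(** Cut at 1: the near part is controlled by the Lipschitz constant, the far part by the sup
    norm. *)
Lemma incr_avg_bounded : exists K, forall x, `|incr_avg s w 0 x| <= K.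
Proof.
exists (C * (1 `^ (1 - s) / (1 - s)) + (M + M) * (1 `^ (- s) / s)) => x.
have [_ h] := incr_avg_sub s0 s1 mw wM C0 wC x ltr01.
rewrite -[incr_avg s w 0 x](subrK (incr_avg s w 1 x)) (le_trans (ler_normD _ _))// lerD//.
have [||_ //] := @normr_Rintegral_le _ (fun r => kap s 1 r * (w (x + r) - w x))
    ((M + M) * (1 `^ (- s) / s)).
  apply: measurable_funM; first exact: measurable_kap.
  by apply: measurable_funB => //; apply: (measurableT_comp mw); exact: measurable_funD.
have M0 : 0 <= M by rewrite (le_trans _ (wM 0)).
rewrite EFinM -integral_kap// -ge0_integralZl_EFin//; last 3 first.
- by move=> r _; rewrite lee_fin kap_ge0.
- by apply/measurable_EFinP; exact: measurable_kap.
- exact: addr_ge0.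
apply: ge0_le_integral => //.
- apply/measurable_EFinP; apply: measurableT_comp => //; apply: measurable_funM.
    exact: measurable_kap.
  by apply: measurable_funB => //; apply: (measurableT_comp mw); exact: measurable_funD.
- by apply: measurable_funeM; apply/measurable_EFinP; exact: measurable_kap.
move=> r _; rewrite lee_fin normrM (ger0_norm (kap_ge0 _ _ _)) [leRHS]mulrC ler_wpM2l//.
  exact: kap_ge0.
by rewrite (le_trans (ler_normB _ _))// lerD.
Qed.

Lemma integrable_kdif_incr_avg :
  leb.-integrable setT (EFin \o (fun x => kdif s d x * incr_avg s w 0 x)).
Proof.
have [K hK] := incr_avg_bounded.
exact: integrable_bounded_factor (integrable_kdif s0 s1 d0) (measurable_incr_avg 0) hK.
Qed.

Lemma Rintegral_kdif_incr_avg_sub e : 0 < e ->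
  `|\int[leb]_x (kdif s d x * incr_avg s w 0 x) -
    \int[leb]_x (kdif s d x * incr_avg s w e x)| <=
  C * (e `^ (1 - s) / (1 - s)) * (2 * d `^ s / s).
Proof.
move=> e0; pose D := C * (e `^ (1 - s) / (1 - s)).
have D0 : 0 <= D by rewrite mulr_ge0// divr_ge0 ?powR_ge0 ?subr_ge0 ?ltW.
pose h x := kdif s d x * (incr_avg s w 0 x - incr_avg s w e x).
have ik := integrable_kdif s0 s1 d0.
have mk : measurable_fun setT (kdif s d) by exact: measurable_kdif.
have mh : measurable_fun setT h.
  by apply: measurable_funM => //; apply: measurable_funB; exact: measurable_incr_avg.
have [|ih hle] := @normr_Rintegral_le _ h (D * (2 * d `^ s / s)) mh.
  rewrite EFinM -(integral_abs_kdif s0 s1 d0) -ge0_integralZl_EFin//; last first.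
    by apply/measurable_EFinP; exact: measurableT_comp.
  apply: ge0_le_integral => //.
  - by apply/measurable_EFinP; exact: measurableT_comp.
  - by apply: measurable_funeM; apply/measurable_EFinP; exact: measurableT_comp.
  move=> x _; rewrite lee_fin normrM [leRHS]mulrC ler_wpM2l//.
  by have [_] := incr_avg_sub s0 s1 mw wM C0 wC x e0.
have -> : \int[leb]_x (kdif s d x * incr_avg s w e x) =
    \int[leb]_x (kdif s d x * incr_avg s w 0 x) - \int[leb]_x h x.
  rewrite -RintegralB//; last exact: integrable_kdif_incr_avg.
  by apply: eq_Rintegral => x _; rewrite /h; ring.
by rewrite opprB addrC subrK.
Qed.

Lemma cvg_natV_powR (a : R) : 0 < a -> (n.+1%:R^-1 : R) `^ a @[n --> \oo] --> (0 : R).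
Proof.
move=> a0; have E n : (n.+1%:R^-1 : R) `^ a = n.+1%:R `^ (- a).
  by rewrite -powR_inv1// -powRrM mulN1r.
under eq_fun do rewrite E.
apply: (cvg_comp (fun n => n.+1%:R : R) (fun x : R => x `^ (- a)) _ (powRN_cvg_pinfty a0)).
apply/cvgryPge => A; near=> n; rewrite (@le_trans _ _ n%:R)// ?ler_nat//.
by near: n; exact: nbhs_infty_ger.
Unshelve. all: by end_near. Qed.

Lemma cvg_Rintegral_marchaud_tail :
  \int[leb]_z (marchaud_tail s 1 z * (w (n.+1%:R^-1 * z + d) - w (n.+1%:R^-1 * z))) @[n --> \oo]
  --> (\int[leb]_z marchaud_tail s 1 z) * (w d - w 0).
Proof.
have i1 := integrable_marchaud_tail1 s0 s1.
have mt : measurable_fun setT (marchaud_tail s 1) by exact: measurable_marchaud_tail.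
pose f n (z : R) := marchaud_tail s 1 z * (w (n.+1%:R^-1 * z + d) - w (n.+1%:R^-1 * z)).
have mf n : measurable_fun setT (f n).
  apply: measurable_funM => //; apply: measurable_funB; apply: (measurableT_comp mw).
    by apply: measurable_funD => //; exact: measurable_funM.
  exact: measurable_funM.
have ig : leb.-integrable setT (fun z => (M + M)%:E * `|(marchaud_tail s 1 z)%:E|)%E.
  by apply: integrableZl => //; exact: integrable_norm.
rewrite -RintegralZr//.
have [||||i2 _] := @dominated_convergence _ _ R leb setT measurableT (fun n z => (f n z)%:E)
    (fun z => (marchaud_tail s 1 z * (w d - w 0))%:E) _ _ _ _ ig.
- by move=> n; apply/measurable_EFinP; exact: (mf n).
- by apply/measurable_EFinP; exact: measurable_funM.
- apply/aeW => z _; apply: cvg_EFin; first by near=> n.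
  (* Each of the two values of [w] is within C |z| / (n + 1) of its limit. *)
  apply: (@cvg_grid _ _ (`|marchaud_tail s 1 z| * (2 * C * `|z|))) => n.
  rewrite /f -mulrBr normrM -[leRHS]mulrA ler_wpM2l//.
  set e := n.+1%:R^-1; have e0 : 0 < e by rewrite invr_gt0.
  have h1 := wC (e * z + d) d; rewrite addrK normrM (gtr0_norm e0) in h1.
  have h2 := wC (e * z) 0; rewrite subr0 normrM (gtr0_norm e0) in h2.
  have -> : w (e * z + d) - w (e * z) - (w d - w 0) =
    (w (e * z + d) - w d) - (w (e * z) - w 0) by ring.
  rewrite (le_trans (ler_normB _ _))// (le_trans (lerD h1 h2))//.
  by rewrite le_eqVlt; apply/orP; left; apply/eqP; ring.
- apply/aeW => z n _; rewrite /f /= -EFinM lee_fin normrM mulrC ler_wpM2r//.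
  by rewrite (le_trans (ler_normB _ _))// lerD.
have -> : (\int[leb]_z (marchaud_tail s 1 z * (w d - w 0))%:E)%E =
    (\int[leb]_z (marchaud_tail s 1 z * (w d - w 0)))%:E.
  by rewrite /Rintegral fineK//; exact: integrable_fin_num.
by move=> /fine_cvg.
Unshelve. all: by end_near. Qed.

(** Both sides are limits of the same truncated integrals: the left one with error of order e^(1-s),
    the right one by dominated convergence after rescaling. *)
Lemma Rintegral_kdif_incr_avg0 : \int[leb]_x (kdif s d x * incr_avg s w 0 x) =
  (\int[leb]_z marchaud_tail s 1 z) * (w d - w 0).
Proof.
pose e n : R := n.+1%:R^-1; have e0 n : 0 < e n by rewrite invr_gt0.
pose a n := \int[leb]_x (kdif s d x * incr_avg s w (e n) x).
apply: (@cvg_unique _ _ (a n @[n --> \oo])) => //; last first.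
  rewrite (_ : a = fun n => \int[leb]_z (marchaud_tail s 1 z * (w (e n * z + d) - w (e n * z)))).
    exact: cvg_Rintegral_marchaud_tail.
  by apply/funext => n; exact: Rintegral_kdif_incr_avg.
have s1' : 0 < 1 - s by rewrite subr_gt0.
have e1 : C * (e n `^ (1 - s) / (1 - s)) * (2 * d `^ s / s) @[n --> \oo] -->
    C * (0 / (1 - s)) * (2 * d `^ s / s).
  apply: cvgM; last exact: cvg_cst.
  apply: cvgM; first exact: cvg_cst.
  by apply: cvgM; [exact: cvg_natV_powR|exact: cvg_cst].
rewrite mul0r mulr0 mul0r in e1.
apply/cvgrPdist_le => c c0; near=> n.
rewrite (le_trans (Rintegral_kdif_incr_avg_sub (e0 n)))//.
near: n; move/cvgrPdist_le : e1 => /(_ c c0); apply: filterS => n.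
by rewrite sub0r normrN; apply: le_trans; exact: ler_norm.
Unshelve. all: by end_near. Qed.

End bounded_lipschitz.

Lemma integral_ppow_expRN : (\int[leb]_x (ppow s x * expR (- Num.max x 0))%:E = (Gamma s)%:E)%E.
Proof.
rewrite -GammaE// -integral_if_itv; apply: eq_integral => x _; congr (_%:E).
rewrite /ppow in_itv/= andbT; case: ltP => x0; first by [].
by rewrite mul0r.
Qed.

(** On x >= 0 the test function is an eigenfunction of the Marchaud integral, and its integral
    against [kdif s 1] is (e^(-1) - 1) Gamma(s), since a shift by 1 multiplies the exponential by
    e^(-1). Dividing by w(1) - w(0) = e^(-1) - 1 leaves the constant. *)
Lemma Rintegral_marchaud_tail1 :
  \int[leb]_z marchaud_tail s 1 z = - (Gamma (1 - s) * Gamma s / s).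
Proof.
pose w (x : R) := expR (- Num.max x 0).
have mw : measurable_fun setT w.
  by apply: measurableT_comp => //; apply: measurableT_comp => //; exact: measurable_maxr.
have wM x : `|w x| <= 1.
  by rewrite /w ger0_norm ?expR_ge0// -expR0 ler_expR oppr_le0 le_max lexx orbT.
have wC x y : `|w x - w y| <= 1 * `|x - y|.
  rewrite mul1r; wlog xy : x y / x <= y.
    by move=> H; have [/H//|/ltW/H] := leP x y; rewrite distrC (distrC y).
  have ab : Num.max x 0 <= Num.max y 0 by rewrite ge_max !le_max xy lexx orbT.
  have ba : Num.max y 0 - Num.max x 0 <= y - x by case: (leP x 0); case: (leP y 0); lra.
  have a0 : 0 <= Num.max x 0 by rewrite le_max lexx orbT.
  rewrite (distrC x) (ger0_norm (_ : 0 <= y - x)) ?subr_ge0// (le_trans _ ba)//.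
  rewrite /w; move: (Num.max x 0) (Num.max y 0) ab a0 => a b ab a0.
  have -> : expR (- a) - expR (- b) = expR (- a) * (1 - expR (- (b - a))).
    by rewrite mulrBr mulr1 -expRD; congr (_ - expR _); ring.
  have h1 : 1 - expR (- (b - a)) <= b - a by have := expR_ge1Dx (- (b - a)); lra.
  have h0 : 0 <= 1 - expR (- (b - a)).
    by rewrite subr_ge0 -[leRHS]expR0 ler_expR; lra.
  rewrite ger0_norm ?mulr_ge0 ?expR_ge0//.
  by rewrite (le_trans (ler_wpM2r h0 (_ : _ <= 1))) ?mul1r// -[leRHS]expR0 ler_expR; lra.
have mp : measurable_fun setT (fun x => ppow s x * w x) by apply: measurable_funM => //; exact: measurable_ppow.
have ip : leb.-integrable setT (EFin \o (fun x => ppow s x * w x)).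
  apply/integrableP; split; first exact/measurable_EFinP.
  have p0 x : 0 <= ppow s x * w x by rewrite mulr_ge0 ?ppow_ge0 ?expR_ge0.
  by under eq_integral do rewrite /= ger0_norm//; rewrite integral_ppow_expRN ltry.
have Gw x : 0 <= x -> incr_avg s w 0 x = - (Gamma (1 - s) / s) * w x.
  move=> x0; pose g r := if r \in `]0%R, +oo[ then r `^ (- 1 - s) * (1 - expR (- r)) else 0.
  have g0 r : 0 <= g r.
    rewrite /g in_itv/= andbT; case: ifP => // r0; rewrite mulr_ge0 ?powR_ge0// subr_ge0.
    by rewrite -[leRHS]expR0 ler_expR oppr_le0 ltW.
  have mg : measurable_fun setT g.
    apply: measurable_if_itv; apply: measurable_funM; first exact: measurable_powR.
    by apply: measurable_funB => //; exact: measurableT_comp.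
  have gE : (\int[leb]_r (g r)%:E = (Gamma (1 - s) / s)%:E)%E.
    by rewrite integral_if_itv integral_powR_1BexpRN.
  have gi : leb.-integrable setT (EFin \o g).
    apply/integrableP; split; first exact/measurable_EFinP.
    by under eq_integral do rewrite /= ger0_norm//; rewrite gE ltry.
  transitivity (\int[leb]_r (- w x * g r)).
    apply: eq_Rintegral => r _; rewrite /kap /g in_itv/= andbT; case: ifP => r0.
      by rewrite /w !max_l ?addr_ge0 ?(ltW r0)// opprD expRD; ring.
    by rewrite mul0r mulr0.
  by rewrite RintegralZl// /Rintegral gE /=; ring.
have i0 := integrable_shift (-1) ip.
have E1 : \int[leb]_x (kdif s 1 x * w x) = (expR (-1) - 1) * Gamma s.
  have E x : kdif s 1 x * w x = expR (- 1) * (ppow s (x - 1) * w (x - 1)) - ppow s x * w x.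
    rewrite /kdif mulrBl; congr (_ - _); rewrite {1 2}/ppow in_itv/= andbT.
    case: ifP => x1; last by rewrite !mul0r mulr0.
    rewrite /w !max_l ?(ltW x1)//; last by rewrite subr_gt0 in x1; lra.
    by rewrite mulrCA -expRD; congr (_ * expR _); ring.
  transitivity (\int[leb]_x (expR (- 1) * (ppow s (x - 1) * w (x - 1)) - ppow s x * w x)).
    by apply: eq_Rintegral => x _; exact: E.
  have F : \int[leb]_x (ppow s x * w x) = Gamma s by rewrite /Rintegral integral_ppow_expRN.
  rewrite RintegralB//; last exact: (integrableZl measurableT _ i0).
  by rewrite RintegralZl// -(Rintegral_shift (- 1) mp) F; ring.
have := Rintegral_kdif_incr_avg0 mw wM ler01 wC ltr01.
have -> : \int[leb]_x (kdif s 1 x * incr_avg s w 0 x) =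
    - (Gamma (1 - s) / s) * ((expR (-1) - 1) * Gamma s).
  rewrite -E1 -RintegralZl//; last first.
    exact: integrable_bounded_factor (integrable_kdif s0 s1 ltr01) mw wM.
  (* For x < 0 the kernel vanishes, so the eigenvalue relation on x >= 0 suffices. *)
  apply: eq_Rintegral => x _; have [x0|x0] := leP 0 x; first by rewrite Gw//; ring.
  rewrite /kdif /ppow !in_itv/= !andbT subr_gt0 ltNge (ltW (lt_trans x0 ltr01)).
  by rewrite ltNge (ltW x0) subrr !mul0r mulr0.
have -> : w 1 - w 0 = expR (-1) - 1.
  by rewrite /w maxxx oppr0 expR0 max_l.
have e1 : expR (-1) - 1 != 0 :> R by rewrite subr_eq0 lt_eqF// -[ltRHS]expR0 ltr_expR; lra.
move=> H; apply: (mulIf e1); rewrite -H; ring.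
Qed.

Lemma marchaud_inversion (w : R -> R) (M C d : R) : measurable_fun setT w ->
  (forall x, `|w x| <= M) -> 0 <= C -> (forall x y, `|w x - w y| <= C * `|x - y|) -> 0 < d ->
  \int[leb]_x (kdif s d x * incr_avg s w 0 x) = - (Gamma (1 - s) * Gamma s / s) * (w d - w 0).
Proof.
by move=> mw wM C0 wC d0; rewrite (Rintegral_kdif_incr_avg0 mw wM C0 wC d0) Rintegral_marchaud_tail1.
Qed.

End marchaud_limit.

(** * The main estimate *)

Section jensen.
Variable R : realType.
Local Notation leb := (@lebesgue_measure R).

(* Young's inequality for [y] and [m `^ (p - 1)] *)
Lemma powR_tangent_le (p m y : R) : 1 <= p -> 0 < m -> 0 <= y ->
  m `^ p + p * m `^ (p - 1) * (y - m) <= y `^ p.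
Proof.
move=> p1 m0 y0; have p0 : 0 < p by apply: lt_le_trans p1.
have mp : m `^ (p - 1) * m = m `^ p by rewrite mulrC mulr_powRB1// ltW.
have -> : m `^ p + p * m `^ (p - 1) * (y - m) = p * (y * m `^ (p - 1)) - (p - 1) * m `^ p.
  by rewrite -mp; ring.
move: p1; rewrite le_eqVlt => /predU1P[<-|p1].
  by rewrite subrr powRr0 mul0r subr0 mulr1 mul1r powRr1.
have p10 : 0 < p - 1 by rewrite subr_gt0.
have q0 : 0 < p / (p - 1) by rewrite divr_gt0.
have pq : p^-1 + (p / (p - 1))^-1 = 1 by field; rewrite !gt_eqF.
have := conjugate_powR y0 (powR_ge0 m (p - 1)) p0 q0 pq.
have -> : m `^ (p - 1) `^ (p / (p - 1)) = m `^ p.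
  by rewrite -powRrM; congr (_ `^ _); field; rewrite gt_eqF.
move=> h; rewrite lerBlDr.
have -> : y `^ p + (p - 1) * m `^ p = p * (y `^ p / p + m `^ p / (p / (p - 1))).
  by field; rewrite !gt_eqF.
by rewrite ler_pM2l.
Qed.

(** Integrate against [a] the tangent bound taken at the weighted mean m = I / K: the linear term
    integrates to 0. A zero mean is treated apart, because the tangent bound is stated for m > 0. *)
Lemma powR_Rintegral_le (a g : R -> R) (K M p : R) : 1 <= p -> 0 < K ->
  (forall x, 0 <= a x) -> leb.-integrable setT (EFin \o a) -> \int[leb]_x a x = K ->
  measurable_fun setT g -> (forall x, 0 <= g x) -> (forall x, g x <= M) ->
  (\int[leb]_x (a x * g x)) `^ p <= K `^ (p - 1) * \int[leb]_x (a x * g x `^ p).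
Proof.
move=> p1 K0 a0 ia aK mg g0 gM; have p0 : 0 < p by apply: lt_le_trans p1.
set I := \int[leb]_x (a x * g x).
have : 0 <= I by apply: Rintegral_ge0 => x _; exact: mulr_ge0.
rewrite le_eqVlt => /predU1P[<-|I0].
  rewrite powR0 ?gt_eqF// mulr_ge0 ?powR_ge0//.
  by apply: Rintegral_ge0 => x _; rewrite mulr_ge0 ?powR_ge0.
pose m := I / K; have m0 : 0 < m by rewrite divr_gt0.
pose c := p * m `^ (p - 1).
have gN x : `|g x| <= M by rewrite ger0_norm.
have iag := integrable_bounded_factor ia mg gN.
have igp : leb.-integrable setT (EFin \o (fun x => a x * g x `^ p)).
  apply: (@integrable_bounded_factor _ _ _ (M `^ p)) => //.
    exact: (measurableT_comp (@measurable_powR R p) mg).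
  move=> x; rewrite ger0_norm ?powR_ge0// ge0_ler_powR// ?nnegrE// ?(ltW p0)//.
  exact: le_trans (gM x).
have i1 : leb.-integrable setT (EFin \o (fun x => c * (a x * g x))).
  exact: (integrableZl measurableT c iag).
have i2 : leb.-integrable setT (EFin \o (fun x => (m `^ p - c * m) * a x)).
  exact: (integrableZl measurableT (m `^ p - c * m) ia).
have low : K * m `^ p <= \int[leb]_x (a x * g x `^ p).
  have -> : K * m `^ p = \int[leb]_x (c * (a x * g x) + (m `^ p - c * m) * a x).
    rewrite RintegralD// !RintegralZl// aK -/I.
    have -> : I = m * K by rewrite /m mulfVK ?gt_eqF.
    ring.
  apply: le_Rintegral => //; first exact: integrableD i1 i2.
  move=> x _; have := ler_wpM2l (a0 x) (powR_tangent_le p1 m0 (g0 x)).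
  by apply: le_trans; rewrite le_eqVlt; apply/orP; left; apply/eqP; rewrite /c; ring.
apply: le_trans (ler_wpM2l (powR_ge0 K _) low).
have -> : I = K * m by rewrite /m mulrC mulfVK ?gt_eqF.
by rewrite powRM ?(ltW K0) ?(ltW m0)// mulrA (mulrC _ K) mulr_powRB1// ltW.
Qed.

End jensen.

(** * The orbit of the semigroup and its Lp increments *)

Section semigroup_orbit.
Variables (R : realType) (N : nat) (Q B : 'M[R]_N).
Hypothesis hQsym : Q^T = Q.
Hypothesis hK : forall t : R, 0 < t ->
  forall v : 'cV[R]_N, v != 0 -> 0 < (v^T *m Kmx Q B t *m v) 0 0.
Variable f : 'cV[R]_N -> R.
Hypothesis hf : Schwartz f.
Variables (s tau : R).
Hypotheses (s0 : 0 < s) (s1 : s < 1) (tau0 : 0 < tau).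
Local Notation leb := (@lebesgue_measure R).

(* Freezing the orbit for [x <= 0], where the kernel [kdif] vanishes, makes it bounded
   and Lipschitz on the whole line. *)
Definition heat_orbit X (x : R) : R := Pt Q B (tau + Num.max x 0) f X.

Definition orbit_fracA X (x : R) : R := - (s / Gamma (1 - s)) * incr_avg s (heat_orbit X) 0 x.

Let time_gt0 x : 0 < tau + Num.max x 0.
Proof. by rewrite ltr_wpDr// le_max lexx orbT. Qed.

Lemma orbit_lipschitz : exists C, 0 <= C /\
  forall X x y, `|heat_orbit X x - heat_orbit X y| <= C * `|x - y|.
Proof.
have [C [C0 HC]] := Pt_lipschitz hQsym hK hf; exists C; split => // X x y.
rewrite (le_trans (HC _ _ X (time_gt0 x) (time_gt0 y)))// ler_wpM2l//.
have -> : tau + Num.max x 0 - (tau + Num.max y 0) = Num.max x 0 - Num.max y 0 by ring.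
by rewrite ler_norml; case: (leP x 0); case: (leP y 0);
  have := ler_norm (x - y); have := ler_norm (y - x); rewrite (distrC y); lra.
Qed.

Lemma orbit_bounded : exists M, forall x, bounded_by (fun X => heat_orbit X x) M.
Proof.
by have [M bf] := schwartz_bounded hf; exists M => x; exact: Pt_bounded.
Qed.

Lemma measurable_orbit :
  measurable_fun setT (fun p : R * N.-tuple R => heat_orbit (colt p.2) p.1).
Proof.
have [C [C0 HC]] := orbit_lipschitz; have [M HM] := orbit_bounded.
apply: (@measurable_lipschitz_time _ _ _ (fun x t => heat_orbit (colt t) x) C) => //.
by move=> x; exact: (HM x).1.
Qed.

Lemma measurable_orbit_time X : measurable_fun setT (heat_orbit X).
Proof.
have [C [C0 HC]] := orbit_lipschitz.
have h := @measurable_lipschitz_time _ _ _ (fun x (_ : unit) => heat_orbit X x) C C0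
  (fun x => measurable_cst _) (fun _ => HC X).
exact: (measurableT_comp h (pair2_measurable tt)).
Qed.

Lemma measurable_orbit_fracA :
  measurable_fun setT (fun p : R * N.-tuple R => orbit_fracA (colt p.2) p.1).
Proof.
apply: measurable_funM => //.
apply: (@measurable_parametric_Rintegral _ _ _ _ _ leb
  (fun q : (R * N.-tuple R) * R =>
     kap s 0 q.2 * (heat_orbit (colt q.1.2) (q.1.1 + q.2) - heat_orbit (colt q.1.2) q.1.1))).
apply: measurable_funM; first exact: (measurableT_comp (@measurable_kap R s 0) measurable_snd).
apply: measurable_funB; last exact: (measurableT_comp measurable_orbit measurable_fst).
apply: (measurableT_comp (f := fun p : R * N.-tuple R => heat_orbit (colt p.2) p.1)
  (g := fun q : (R * N.-tuple R) * R => (q.1.1 + q.2, q.1.2))); first exact: measurable_orbit.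
apply/measurable_fun_pair => /=; last exact: measurableT_comp.
by apply: measurable_funD => //; exact: measurableT_comp.
Qed.

(** By the semigroup law P_r P_(tau+x) f = P_(tau+x+r) f, so the increments inside [fracA] are
    increments of the orbit. *)
Lemma fracA_orbit X x : 0 <= x ->
  fracA Q B s (Pt Q B (tau + x) f) X = orbit_fracA X x.
Proof.
move=> x0; have [M bf] := schwartz_bounded hf.
rewrite /fracA /orbit_fracA; congr (_ * _); rewrite /incr_avg /Rintegral.
apply: (congr1 fine); rewrite -integral_if_itv; apply: eq_integral => r _; congr (_%:E).
rewrite /kap in_itv/= andbT; case: ifP => r0; last by rewrite mul0r.
rewrite /heat_orbit !max_l ?addr_ge0// ?(ltW r0)//; congr (_ * (_ - _)).
by rewrite (PtD hQsym hK _ r0 _ bf) ?ltr_wpDr// addrC addrA.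
Qed.

Lemma orbit_fracA_bounded X : exists K, forall x, `|orbit_fracA X x| <= K.
Proof.
have [C [C0 HC]] := orbit_lipschitz; have [M HM] := orbit_bounded.
have [K HK] := incr_avg_bounded s0 s1 (measurable_orbit_time X) (fun x => (HM x).2 X) C0 (HC X).
exists (`|- (s / Gamma (1 - s))| * K) => x.
by rewrite normrM ler_wpM2l.
Qed.

(** The factor - s / Gamma(1 - s) in [fracA] cancels against the inversion constant - Gamma(1 - s)
    Gamma(s) / s, up to Gamma(s). *)
Lemma Pt_sub_orbit d X : 0 < d ->
  Pt Q B (tau + d) f X - Pt Q B tau f X =
  (Gamma s)^-1 * \int[leb]_x (kdif s d x * orbit_fracA X x).
Proof.
move=> d0.
have [C [C0 HC]] := orbit_lipschitz; have [M HM] := orbit_bounded.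
have mw := measurable_orbit_time X; have wM x := (HM x).2 X.
have := marchaud_inversion s0 s1 mw wM C0 (HC X) d0.
rewrite {2 3}/heat_orbit maxxx addr0 max_l ?(ltW d0)// => E.
have s1' : 0 < 1 - s by rewrite subr_gt0.
have s1'' : 1 - s < 1 by rewrite ltrBlDr ltrDl.
have G0 := Gamma_gt0 s0 s1; have G1 := Gamma_gt0 s1' s1''.
have -> : \int[leb]_x (kdif s d x * orbit_fracA X x) =
    - (s / Gamma (1 - s)) * \int[leb]_x (kdif s d x * incr_avg s (heat_orbit X) 0 x).
  rewrite -RintegralZl//; last exact: (integrable_kdif_incr_avg s0 s1 mw wM C0 (HC X) d0).
  by apply: eq_Rintegral => x _; rewrite /orbit_fracA mulrCA.
by rewrite E; field; rewrite !gt_eqF.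
Qed.

(** Jensen with the weight |k| of mass K = 2 d^s / s. Its factor K^(p-1) is kept as K^p / K, so that
    the spatial integration, which restores one K, ends with a pure p-th power. *)
Lemma powR_Pt_sub_orbit_le p d X : 1 <= p -> 0 < d ->
  ((`|Pt Q B (tau + d) f X - Pt Q B tau f X| `^ p)%:E <=
  (((Gamma s)^-1 * (2 * d `^ s / s)) `^ p * (2 * d `^ s / s)^-1)%:E *
  \int[leb]_x (`|kdif s d x| * `|orbit_fracA X x| `^ p)%:E)%E.
Proof.
move=> p1 d0; have p0 : 0 < p by apply: lt_le_trans p1.
have [M HM] := orbit_fracA_bounded X.
set K := 2 * d `^ s / s; have K0 : 0 < K by rewrite divr_gt0// mulr_gt0// powR_gt0.
have G0 := Gamma_gt0 s0 s1.
have ik := integrable_kdif s0 s1 d0.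
have iak : leb.-integrable setT (EFin \o (fun x => `|kdif s d x|)) by exact: integrable_norm ik.
have mA : measurable_fun setT (orbit_fracA X).
  by apply: measurable_funM => //; apply: measurable_incr_avg; exact: measurable_orbit_time.
have mAn : measurable_fun setT (fun x => `|orbit_fracA X x|) by exact: measurableT_comp.
have ip : leb.-integrable setT (EFin \o (fun x => `|kdif s d x| * `|orbit_fracA X x| `^ p)).
  apply: (@integrable_bounded_factor _ _ _ (M `^ p) iak).
    exact: (measurableT_comp (@measurable_powR R p) mAn).
  move=> x; rewrite ger0_norm ?powR_ge0// ge0_ler_powR// ?nnegrE// ?(ltW p0)//.
  exact: le_trans (HM x).
have -> : (\int[leb]_x (`|kdif s d x| * `|orbit_fracA X x| `^ p)%:E)%E =
    (\int[leb]_x (`|kdif s d x| * `|orbit_fracA X x| `^ p))%:E.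
  by rewrite /Rintegral fineK//; exact: integrable_fin_num.
rewrite -EFinM lee_fin Pt_sub_orbit// normrM gtr0_norm ?invr_gt0// powRM ?invr_ge0 ?(ltW G0)//.
rewrite powRM ?invr_ge0 ?(ltW G0) ?(ltW K0)// -!mulrA ler_wpM2l ?powR_ge0// mulrA.
have -> : K `^ p / K = K `^ (p - 1).
  by rewrite -[K `^ p](mulr_powRB1 (ltW K0) p0) mulrC mulKf// gt_eqF.
apply: le_trans (powR_Rintegral_le p1 K0 (fun x => normr_ge0 _) iak _ mAn _ HM) => //.
  rewrite ge0_ler_powR ?nnegrE ?(ltW p0)//.
    by apply: Rintegral_ge0 => x _; exact: mulr_ge0.
  rewrite (le_trans (le_normr_Rintegral _ _))//.
    exact: integrable_bounded_factor ik mA HM.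
  rewrite le_eqVlt; apply/orP; left; apply/eqP.
  by apply: eq_Rintegral => x _; rewrite normrM.
by rewrite /Rintegral integral_abs_kdif.
Qed.

Lemma integral_powR_Pt_sub_le p d (S : R) : 1 <= p -> 0 < d -> 0 <= S ->
  (forall sigma, 0 < sigma ->
    (\int[lebn R N]_t (`|fracA Q B s (Pt Q B sigma f) (colt t)| `^ p)%:E <= (S `^ p)%:E)%E) ->
  (\int[lebn R N]_t (`|Pt Q B (tau + d) f (colt t) - Pt Q B tau f (colt t)| `^ p)%:E <=
   (((Gamma s)^-1 * (2 * d `^ s / s) * S) `^ p)%:E)%E.
Proof.
move=> p1 d0 S0 HS; set K := 2 * d `^ s / s.
have K0 : 0 < K by rewrite divr_gt0// mulr_gt0// powR_gt0.
have G0 := Gamma_gt0 s0 s1.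
have [M bf] := schwartz_bounded hf.
pose h (q : N.-tuple R * R) := `|kdif s d q.2| * `|orbit_fracA (colt q.1) q.2| `^ p.
have mh : measurable_fun setT h.
  apply: measurable_funM.
    by apply: measurableT_comp => //; apply: (measurableT_comp (@measurable_kdif R s d)).
  apply: (measurableT_comp (@measurable_powR R p)); apply: measurableT_comp => //.
  apply: (measurableT_comp measurable_orbit_fracA (g := fun q : N.-tuple R * R => (q.2, q.1))).
  by apply/measurable_fun_pair.
have h0 q : 0 <= h q by rewrite mulr_ge0 ?powR_ge0.
have GK0 : 0 < (Gamma s)^-1 * K by apply: mulr_gt0; rewrite ?invr_gt0.
pose c := ((Gamma s)^-1 * K) `^ p * K^-1.
have c0 : 0 < c by apply: mulr_gt0; [exact: powR_gt0|rewrite invr_gt0].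
apply: (@le_trans _ _ (c%:E * \int[lebn R N]_t \int[leb]_x (h (t, x))%:E)%E).
  rewrite -ge0_integralZl_EFin ?(ltW c0)//; last 2 first.
  - by move=> t _; apply: integral_ge0 => x _; rewrite lee_fin.
  - apply: (@measurable_parametric_integral _ _ _ _ _ leb (EFin \o h)).
    exact/measurable_EFinP.
  apply: ge0_le_integral => //.
  - apply/measurable_EFinP; apply: (measurableT_comp (@measurable_powR R p)).
    apply: measurableT_comp => //; apply: measurable_funB.
      exact: (Pt_bounded hQsym hK (addr_gt0 tau0 d0) bf).1.
    exact: (Pt_bounded hQsym hK tau0 bf).1.
  - apply: measurable_funeM.
    apply: (@measurable_parametric_integral _ _ _ _ _ leb (EFin \o h)).
    exact/measurable_EFinP.
  by move=> t _; exact: powR_Pt_sub_orbit_le.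
rewrite (@fubini_tonelli _ _ _ _ _ (lebn R N) leb (EFin \o h))//; last exact/measurable_EFinP.
have -> : ((Gamma s)^-1 * K * S) `^ p = c * (K * S `^ p).
  rewrite (powRM _ (ltW GK0) S0) /c.
  by rewrite mulrA mulfVK ?gt_eqF.
rewrite [leRHS]EFinM lee_pmul2l//.
rewrite EFinM -(integral_abs_kdif s0 s1 d0) -ge0_integralZr//; last 2 first.
- by apply/measurable_EFinP; apply: measurableT_comp => //; exact: measurable_kdif.
- by rewrite lee_fin powR_ge0.
apply: ge0_le_integral => //.
- by move=> x _; apply: integral_ge0 => t _; rewrite lee_fin.
- apply: (@measurable_parametric_integral _ _ _ _ _ (lebn R N) (fun q => (h (q.2, q.1))%:E)).
  apply/measurable_EFinP; apply: (measurableT_comp mh (g := fun q : R * N.-tuple R => (q.2, q.1))).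
  by apply/measurable_fun_pair.
- apply: emeasurable_funM => //; apply/measurable_EFinP; apply: measurableT_comp => //.
  exact: measurable_kdif.
move=> x _; have [x0|x0] := leP x 0.
  have k0 : kdif s d x = 0.
    rewrite /kdif /ppow !in_itv/= !andbT subr_gt0 !ltNge x0.
    by rewrite (le_trans x0 (ltW d0))/= subrr.
  rewrite k0 normr0 mul0e integral0_eq// => t _.
  by rewrite /h /= k0 normr0 mul0r.
under eq_integral do rewrite /h /= EFinM.
rewrite ge0_integralZl_EFin//; last first.
  apply/measurable_EFinP; apply: (measurableT_comp (@measurable_powR R p)).
  apply: measurableT_comp => //.
  exact: (measurableT_comp measurable_orbit_fracA (pair1_measurable x)).
rewrite lee_wpmul2l// ?lee_fin//.
apply: le_trans (HS (tau + x) (addr_gt0 tau0 x0)).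
rewrite le_eqVlt; apply/orP; left; apply/eqP; apply: eq_integral => t _.
by rewrite (fracA_orbit _ (ltW x0)).
Qed.

End semigroup_orbit.

(** * From p-th powers to Lp norms *)

Section lpnorm.
Variables (R : realType) (N : nat).

Lemma LpnormRN_lebn p (g : 'cV[R]_N -> R) :
  measurable_fun setT (fun t : N.-tuple R => g (colt t)) ->
  LpnormRN p g = poweR (\int[lebn R N]_t (`|g (colt t)| `^ p)%:E)%E p^-1.
Proof.
move=> mg; rewrite /LpnormRN.
rewrite (@iEint_lebn R N (fun v => (`|g (\col_(i < N) v i)| `^ p)%:E))//.
apply/measurable_EFinP; apply: (measurableT_comp (@measurable_powR R p)).
exact: measurableT_comp.
Qed.

Variables (Q B : 'M[R]_N).
Hypothesis hQsym : Q^T = Q.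
Hypothesis hK : forall t : R, 0 < t ->
  forall v : 'cV[R]_N, v != 0 -> 0 < (v^T *m Kmx Q B t *m v) 0 0.
Variable f : 'cV[R]_N -> R.
Hypothesis hf : Schwartz f.
Variables (s p : R).
Hypotheses (s0 : 0 < s) (s1 : s < 1) (p1 : 1 <= p).

Let p0 : 0 < p. Proof. exact: lt_le_trans p1. Qed.

Let sup_fracA : \bar R :=
  ereal_sup [set LpnormRN p (fracA Q B s (Pt Q B sigma f)) | sigma in `]0%R, +oo[%classic].

Lemma LpnormRN_fracA sigma : 0 < sigma ->
  LpnormRN p (fracA Q B s (Pt Q B sigma f)) =
  poweR (\int[lebn R N]_t (`|fracA Q B s (Pt Q B sigma f) (colt t)| `^ p)%:E)%E p^-1.
Proof.
move=> sigma0; apply: LpnormRN_lebn.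
(* Taking sigma as base time of an orbit and looking at its origin makes the joint measurability
   result available. *)
rewrite (_ : (fun t => _) = fun t => orbit_fracA Q B f s sigma (colt t) 0).
  apply: (measurableT_comp (measurable_orbit_fracA hQsym hK hf s sigma0)
    (g := fun t : N.-tuple R => (0 : R, t))).
  exact: pair1_measurable.
by apply/funext => t; rewrite -(fracA_orbit hQsym hK hf s sigma0 _ (lexx 0)) addr0.
Qed.

Lemma sup_fracA_ge0 : (0 <= sup_fracA)%E.
Proof.
apply: (@le_trans _ _ (LpnormRN p (fracA Q B s (Pt Q B 1 f)))); first exact: poweR_ge0.
by apply: ereal_sup_ubound; exists 1 => //=; rewrite in_itv/= ltr01.
Qed.

Lemma LpnormRN_Pt_sub_le tau d : 0 < tau -> 0 < d ->
  (LpnormRN p (fun X => (Pt Q B (tau + d) f X - Pt Q B tau f X)%R) <=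
  (2 * d `^ s / Gamma (1 + s))%:E * sup_fracA)%E.
Proof.
move=> tau0 d0; have [M bf] := schwartz_bounded hf.
have G0 := Gamma_gt0 s0 s1; pose c := (Gamma s)^-1 * (2 * d `^ s / s).
have cE : 2 * d `^ s / Gamma (1 + s) = c by rewrite GammaS// /c; field; rewrite !gt_eqF.
have c0 : 0 < c.
  by apply: mulr_gt0; rewrite ?invr_gt0// divr_gt0// mulr_gt0// powR_gt0.
rewrite cE LpnormRN_lebn; last first.
  apply: measurable_funB; first exact: (Pt_bounded hQsym hK (addr_gt0 tau0 d0) bf).1.
  exact: (Pt_bounded hQsym hK tau0 bf).1.
have I0 (g : 'cV[R]_N -> R) : (0 <= \int[lebn R N]_t (`|g (colt t)| `^ p)%:E)%E.
  by apply: integral_ge0 => t _; rewrite lee_fin powR_ge0.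
have pn0 := gt_eqF p0.
have ub sigma : 0 < sigma -> (LpnormRN p (fracA Q B s (Pt Q B sigma f)) <= sup_fracA)%E.
  by move=> sigma0; apply: ereal_sup_ubound; exists sigma => //=; rewrite in_itv/= sigma0.
(* An infinite supremum makes the right side infinite, its factor being positive; nonnegativity
   excludes the value -oo. *)
have := sup_fracA_ge0; move: ub; case: sup_fracA => [S|_ _|_]//; last first.
  by rewrite mulry gtr0_sg// mul1e leey.
move=> ub; rewrite lee_fin => S0.
have HS sigma : 0 < sigma ->
    (\int[lebn R N]_t (`|fracA Q B s (Pt Q B sigma f) (colt t)| `^ p)%:E <= (S `^ p)%:E)%E.
  move=> sigma0; have := ub _ sigma0; rewrite LpnormRN_fracA// => h.
  have := gt0_ler_poweR (ltW p0) _ _ h; rewrite -poweRrM mulVf ?pn0// poweRe1// poweR_EFin.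
  by apply; rewrite in_itv/= ?poweR_ge0 ?lee_fin ?S0 leey.
have h := integral_powR_Pt_sub_le hQsym hK hf s0 s1 tau0 p1 d0 S0 HS.
have pV0 : 0 <= p^-1 by rewrite invr_ge0 ltW.
have := gt0_ler_poweR pV0 _ _ h.
rewrite poweR_EFin -powRrM mulfV ?pn0// powRr1; last by apply: mulr_ge0 => //; exact: ltW.
apply.
  by rewrite in_itv/= (I0 (fun X => Pt Q B (tau + d) f X - Pt Q B tau f X)) leey.
by rewrite in_itv/= lee_fin powR_ge0 leey.
Qed.

End lpnorm.

Theorem theorem5p1 (R : realType) (N : nat) (Q B : 'M[R]_N)
  (hN : (2 <= N)%N)
  (hQsym : Q^T = Q)
  (hQpos : forall v : 'cV[R]_N, 0 <= (v^T *m Q *m v) 0 0)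
  (hK : forall t : R, 0 < t ->
     forall v : 'cV[R]_N, v != 0 -> 0 < (v^T *m Kmx Q B t *m v) 0 0)
  (htrB : 0 <= \tr B)
  (s p : R) (hs0 : 0 < s) (hs1 : s < 1) (hp : 1 <= p)
  (f : 'cV[R]_N -> R) (hf : Schwartz f)
  (t tau : R) (ht : 0 < t) (htau : 0 < tau) :
  (LpnormRN p (fun X => (Pt Q B t f X - Pt Q B tau f X)%R)
   <= (2 * `|t - tau| `^ s / Gamma (1 + s))%:E *
      ereal_sup [set LpnormRN p (fracA Q B s (Pt Q B sigma f)) | sigma in `]0%R, +oo[%classic])%E.
Proof.
have lt_case a b : 0 < a -> a < b ->
    (LpnormRN p (fun X => (Pt Q B b f X - Pt Q B a f X)%R) <=
    (2 * (b - a) `^ s / Gamma (1 + s))%:E *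
    ereal_sup [set LpnormRN p (fracA Q B s (Pt Q B sigma f)) | sigma in `]0%R, +oo[%classic])%E.
  move=> a0 ab; have ba0 : 0 < b - a by rewrite subr_gt0.
  by have := LpnormRN_Pt_sub_le hQsym hK hf hs0 hs1 hp a0 ba0; rewrite addrC subrK.
(* The inversion works with a positive time step, so equal times are separate: the left side is then
   0, and positivity of Gamma(1 + s) makes the right side nonnegative. *)
have [tt|tt|<-] := ltgtP t tau; last first.
- have -> : (fun X => Pt Q B t f X - Pt Q B t f X) = cst 0 by apply/funext => X; rewrite subrr.
  have pn0 : p != 0 by rewrite gt_eqF// (lt_le_trans _ hp).
  rewrite LpnormRN_lebn//= normr0 powR0// integral0 poweR0r ?invr_eq0//.
  apply: mule_ge0; last exact: sup_fracA_ge0.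
  rewrite lee_fin mulr_ge0 ?mulr_ge0 ?powR_ge0// invr_ge0.
  by rewrite GammaS// mulr_ge0 ?(ltW hs0)// ltW// Gamma_gt0.
- by rewrite gtr0_norm ?subr_gt0//; exact: lt_case.
rewrite distrC gtr0_norm ?subr_gt0//; apply: le_trans (lt_case _ _ ht tt).
rewrite /LpnormRN; under [fun v => _]eq_fun do rewrite distrC.
exact: lexx.
Qed.
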